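(* Let $c(n)$, $n\ge 0$, be the Fourier coefficients of the modular invariant $j$. Then the sequence $\{c(n)\}_{n\ge 0}$ is log-concave, and the sequence $\{c(n)\}_{n\ge 1}$ is ratio log-convex.
   Context: The modular invariant $j$ is defined for $\tau$ in the upper half-plane, with $q=e^{2\pi i\tau}$, by $$j(\tau)=\frac{\left(1+240\sum_{n\ge 1}\sigma_3(n)q^n\right)^3}{q\prod_{n\ge 1}(1-q^n)^{24}}=q^{-1}+\sum_{n\ge 0}c(n)q^n=q^{-1}+744+196884q+21493760q^2+\cdots,$$ where $\sigma_3(n)=\sum_{d\mid n}d^3$. This defines the integers $c(n)$, $n\ge 0$. A sequence $\{a_n\}_{n\ge n_0}$ is log-convex (respectively log-concave) if $a_na_{n+2}-a_{n+1}^2\ge 0$ (respectively $\le 0$) for all $n\ge n_0$. A sequence $\{a_n\}_{n\ge n_0}$ is ratio log-convex if the sequence $\{a_{n+1}/a_n\}_{n\ge n_0}$ is log-convex. *)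

(* Defs.v *)
From Stdlib Require Import Reals ZArith List.
From Coquelicot Require Import Coquelicot.

Open Scope R_scope.

Definition sigma (k n : nat) : nat :=
  list_sum (map (fun d => Nat.pow d k)
                (filter (fun d => Nat.eqb (Nat.modulo n d) 0) (seq 1 n))).

Definition Cexp (z : C) : C :=
  (RtoC (exp (Re z)) * (cos (Im z), sin (Im z)))%C.

(* As with [Series] and [Lim_seq], the two operators below are total and
   have their intended meaning only in case of convergence. *)
Definition CSeries (a : nat -> C) : C :=
  (Series (fun n => Re (a n)), Series (fun n => Im (a n))).

Fixpoint Cprod_n (a : nat -> C) (n : nat) : C :=
  match n with
  | O => a O
  | S m => (Cprod_n a m * a (S m))%C
  end.

Definition CProd (a : nat -> C) : C :=
  (real (Lim_seq (fun n => Re (Cprod_n a n))),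
   real (Lim_seq (fun n => Im (Cprod_n a n)))).

Definition nome (tau : C) : C := Cexp (RtoC (2 * PI) * Ci * tau)%C.

(* Sums and products over n >= 1 are indexed by [S n] with n >= 0. *)
Definition j_invariant (tau : C) : C :=
  let q := nome tau in
  ((RtoC 1 + RtoC 240 * CSeries (fun n => RtoC (INR (sigma 3 (S n))) * q ^ S n)) ^ 3
   / (q * CProd (fun n => (RtoC 1 - q ^ S n) ^ 24)))%C.

(* j(tau) = q^-1 + sum_(n >= 0) c(n) q^n on the upper half-plane. *)
Definition j_fourier_coefficients (c : nat -> Z) : Prop :=
  forall tau : C, 0 < Im tau ->
    is_series (V := C_NormedModule)
      (fun n => (RtoC (IZR (c n)) * nome tau ^ n)%C)
      (j_invariant tau - / nome tau)%C.

(* In the next three definitions the sequence is {a_n}_{n >= n0}; the values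
   of [a] below [n0] are irrelevant. *)
Definition log_convex (n0 : nat) (a : nat -> R) : Prop :=
  forall n : nat, (n0 <= n)%nat -> a n * a (n + 2)%nat - a (n + 1)%nat ^ 2 >= 0.

Definition log_concave (n0 : nat) (a : nat -> R) : Prop :=
  forall n : nat, (n0 <= n)%nat -> a n * a (n + 2)%nat - a (n + 1)%nat ^ 2 <= 0.

Definition ratio_log_convex (n0 : nat) (a : nat -> R) : Prop :=
  log_convex n0 (fun n => a (n + 1)%nat / a n).

(* Main.v *)
(** With A = 4 pi^2 let M(n) = sum_k A^(k+1) n^k / (k! (k+1)!), which is
    2 pi / sqrt n * I_1(4 pi sqrt n).  By the Lipschitz formula
    sum_(m in Z) (t+m)^-(k+1) = (-2 pi i)^(k+1) / k! sum_n n^k q^n, the power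
    series sum_n M(n) q^n differs from exp(2 pi i / t) by a bounded quantity on
    |Re t| <= 1/2, 0 < Im t <= 1.  On the other hand j(t) = j(-1/t), and
    j(-1/t) = exp(2 pi i / t) + O(1) when Im(-1/t) >= 1; elsewhere in the strip
    |j(-1/t)| <= j(i Im(-1/t)) is at most about exp(2 pi (1/(4y) + y)) with y = Im t.
    Comparing Fourier coefficients on the line y = 1/(2 sqrt n) gives
    |c(n) - M(n)| = O(exp(2 pi sqrt n)), exponentially smaller than M(n).

    The modularity of j is that of E_4 and of the discriminant.  Both reduce to
    rearranging a sum over the quadrant m, n >= 1: absolutely convergent for E_4,
    and for the logarithmic derivative of the discriminant made so by subtracting
    a kernel that telescopes in both directions.

    M satisfies x M'' + 2 M' = A M, so g = M'/M satisfies a Riccati equation, and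
    (log M)'' and (log M)''' are polynomials in g and 1/x, monotone in the range
    g >= 2 pi / sqrt x - 3 / (4 x), which holds for all x > 0.  This yields
    (log M)'' <= -2/x^2 and (log M)''' >= 1/(4 x^3), which beats the error for
    n >= 64; for n < 64 the coefficients are computed from the q-expansion. *)

Require Import Defs.
From Stdlib Require Import Reals ZArith Lra Lia Psatz List.
From Coquelicot Require Import Coquelicot.
Import ListNotations.
Open Scope R_scope.

(** Log-concavity says that the second differences of log c(n) are nonpositive, ratio log-convexity
    that the third ones are nonnegative. The lower bound available for the third difference of log M
    is only of order n^-3, so an asymptotic equivalence of c and M proves nothing: a relative error
    with explicit constants is required. The weights 1, 3, 3, 1 tolerate an error of 1/(32 (n+3)^3)
    in each logarithm, which fixes the precision of every estimate.

    Complex analysis is kept to derivatives with quadratic remainder: they are unique, can be taken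
    termwise, and a function whose derivative vanishes on a convex domain is constant. No integral
    occurs; the estimate of a coefficient comes from averaging a truncated series over roots of
    unity. Partial fraction expansions come from the duplication trick of Herglotz, and zeta(2) and
    zeta(4), which normalise the Eisenstein sums, from the limit tau -> 1/2.

    For small n a computed list is certified by multiplying it back modulo q^70, and the c(n) are
    identified with it by letting q -> 0 through positive reals. *)

(** * Real series and interchange of summation *)

Lemma ex_series_comparison (a b : nat -> R) :
  (forall n, Rabs (a n) <= b n) -> ex_series b -> ex_series a.
Proof. intros H Hb. exact (@ex_series_le R_AbsRing R_CompleteNormedModule a b H Hb). Qed.

Lemma sum_n_le_Series (a : nat -> R) (n : nat) :
  (forall k, 0 <= a k) -> ex_series a -> sum_n a n <= Series a.
Proof.
intros H0 H. apply (is_lim_seq_incr_compare (sum_n a)).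
- apply Series_correct in H. exact H.
- intros k. rewrite sum_Sn. unfold plus; simpl. specialize (H0 (S k)). lra.
Qed.

Lemma ex_series_bounded (a : nat -> R) (M : R) :
  (forall k, 0 <= a k) -> (forall n, sum_n a n <= M) ->
  ex_series a /\ Series a <= M.
Proof.
intros H0 HM.
assert (H : ex_finite_lim_seq (sum_n a)).
{ apply (ex_finite_lim_seq_incr _ M); auto.
  intros k. rewrite sum_Sn. unfold plus; simpl. specialize (H0 (S k)). lra. }
destruct H as [l Hl].
assert (Hs : is_series a l) by exact Hl.
split; [now exists l|].
rewrite (is_series_unique _ _ Hs).
apply (is_lim_seq_le (sum_n a) (fun _ => M) l M); auto.
apply is_lim_seq_const.
Qed.

(** In the divergent case [Lim_seq] of the partial sums is still at least 0 in [Rbar], and [real]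
    sends infinite values to 0. *)
Lemma Series_nonneg (a : nat -> R) : (forall n, 0 <= a n) -> 0 <= Series a.
Proof.
intros H. rewrite <- (Rmult_0_l (Series a)) at 1.
rewrite <- Series_scal_l.
destruct (ex_series_dec a) as [Ha|Ha].
- apply Series_le; auto. intros n. specialize (H n). lra.
- rewrite Series_scal_l, Rmult_0_l.
  unfold Series.
  assert (Hi : Rbar_le 0 (Lim_seq (sum_n a))).
  { rewrite <- (Lim_seq_const 0). apply Lim_seq_le_loc. exists O. intros n _.
    induction n; [rewrite sum_O; auto|].
    rewrite sum_Sn. unfold plus; simpl. specialize (H (S n)). lra. }
  destruct (Lim_seq (sum_n a)); simpl in *; lra.
Qed.

Lemma Series_sum_n (a : nat -> nat -> R) (N : nat) :
  (forall n, (n <= N)%nat -> ex_series (fun m => a m n)) ->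
  ex_series (fun m => sum_n (a m) N) /\
  Series (fun m => sum_n (a m) N) = sum_n (fun n => Series (fun m => a m n)) N.
Proof.
induction N as [|N IH]; intros H.
- rewrite sum_O. split.
  + apply (ex_series_ext (fun m => a m O)); [intros; now rewrite sum_O|]. apply H; lia.
  + apply Series_ext. intros; now rewrite sum_O.
- destruct IH as [IH1 IH2]; [intros; apply H; lia|].
  assert (E : forall m, plus (sum_n (a m) N) (a m (S N)) = sum_n (a m) (S N))
    by (intros; now rewrite sum_Sn).
  split.
  + apply (ex_series_ext (fun m => plus (sum_n (a m) N) (a m (S N)))); auto.
    apply (@ex_series_plus R_AbsRing R_NormedModule); auto.
  + rewrite sum_Sn, <- IH2.
    rewrite (Series_ext _ (fun m => sum_n (a m) N + a m (S N))).
    * rewrite Series_plus; auto.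
    * intros m. now rewrite sum_Sn.
Qed.

Lemma term_le_Series (a : nat -> R) (n : nat) :
  (forall k, 0 <= a k) -> ex_series a -> a n <= Series a.
Proof.
intros H0 H. apply Rle_trans with (sum_n a n); [|now apply sum_n_le_Series].
destruct n; [rewrite sum_O; lra|].
rewrite sum_Sn. unfold plus; simpl.
assert (0 <= sum_n a n); [|lra].
clear H. induction n; [rewrite sum_O; auto|].
rewrite sum_Sn. unfold plus; simpl. specialize (H0 (S n)). lra.
Qed.

(** Half of Tonelli: a finite block of columns can be summed row by row and stays below the sum of
    the rows. Applied to the transposed array it gives the reverse inequality. *)
Lemma Series_exchange_le (a : nat -> nat -> R) :
  (forall m n, 0 <= a m n) -> (forall m, ex_series (a m)) ->
  ex_series (fun m => Series (a m)) ->
  (forall n, ex_series (fun m => a m n)) /\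
  ex_series (fun n => Series (fun m => a m n)) /\
  Series (fun n => Series (fun m => a m n)) <= Series (fun m => Series (a m)).
Proof.
intros H0 Hr Hs.
assert (Hc : forall n, ex_series (fun m => a m n)).
{ intros n. apply (ex_series_comparison _ (fun m => Series (a m))); auto.
  intros m. rewrite Rabs_pos_eq by auto. apply term_le_Series; auto. }
split; auto.
apply ex_series_bounded.
- intros n. apply Series_nonneg; auto.
- intros N. destruct (Series_sum_n a N) as [H1 H2]; auto.
  rewrite <- H2. apply Series_le; auto.
  intros m. split; [|apply sum_n_le_Series; auto].
  clear -H0. induction N; [rewrite sum_O; auto|].
  rewrite sum_Sn. unfold plus; simpl. specialize (H0 m (S N)). lra.
Qed.

Lemma Series_exchange_nonneg (a : nat -> nat -> R) :
  (forall m n, 0 <= a m n) -> (forall m, ex_series (a m)) ->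
  ex_series (fun m => Series (a m)) ->
  (forall n, ex_series (fun m => a m n)) /\
  ex_series (fun n => Series (fun m => a m n)) /\
  Series (fun m => Series (a m)) = Series (fun n => Series (fun m => a m n)).
Proof.
intros H0 Hr Hs.
destruct (Series_exchange_le a) as (H1 & H2 & H3); auto.
destruct (Series_exchange_le (fun n m => a m n)) as (H4 & H5 & H6); auto.
repeat split; auto. apply Rle_antisym; auto.
Qed.

(** Fubini from Tonelli: a = (a + |a|) - |a| is a difference of two nonnegative arrays. *)
Lemma Series_exchange (a : nat -> nat -> R) :
  (forall m, ex_series (fun n => Rabs (a m n))) ->
  ex_series (fun m => Series (fun n => Rabs (a m n))) ->
  Series (fun m => Series (a m)) = Series (fun n => Series (fun m => a m n)).
Proof.
intros Hr Hs.
set (b := fun m n => Rabs (a m n)).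
set (p := fun m n => a m n + Rabs (a m n)).
assert (Hb : forall m n, 0 <= b m n) by (intros; apply Rabs_pos).
assert (Hp : forall m n, 0 <= p m n).
{ intros m n; unfold p. generalize (Rle_abs (- a m n)). rewrite Rabs_Ropp. lra. }
assert (Hpr : forall m, ex_series (p m)).
{ intros m. apply (@ex_series_plus R_AbsRing R_NormedModule); [|apply Hr].
  apply ex_series_Rabs, Hr. }
assert (Hps : ex_series (fun m => Series (p m))).
{ apply (ex_series_comparison _ (fun m => 2 * Series (b m))).
  - intros m. rewrite Rabs_pos_eq by (apply Series_nonneg; auto).
    rewrite <- Series_scal_l. apply Series_le.
    + intros n. split; auto. unfold p, b. generalize (Rle_abs (a m n)). lra.
    + apply (@ex_series_scal_l R_AbsRing R_NormedModule 2 (b m)). apply Hr.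
  - apply (@ex_series_scal_l R_AbsRing R_NormedModule 2 (fun m => Series (b m))). apply Hs. }
destruct (Series_exchange_nonneg b) as (B1 & B2 & B3); auto.
destruct (Series_exchange_nonneg p) as (P1 & P2 & P3); auto.
rewrite (Series_ext (fun m => Series (a m)) (fun m => Series (p m) - Series (b m))).
2:{ intros m. rewrite <- Series_minus; auto. apply Series_ext. intros; unfold p, b; ring. apply Hr. }
rewrite (Series_ext (fun n => Series (fun m => a m n))
  (fun n => Series (fun m => p m n) - Series (fun m => b m n))).
2:{ intros n. rewrite <- Series_minus; auto. apply Series_ext. intros; unfold p, b; ring. }
rewrite !Series_minus; auto. congruence.
Qed.

Lemma Series_tail_lim (a : nat -> R) :
  ex_series a -> is_lim_seq (fun n => Series (fun k => a (n + k)%nat)) 0.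
Proof.
intros Ha. apply is_lim_seq_incr_1.
apply (is_lim_seq_ext (fun n => Series a - sum_n a n)).
- intros n. rewrite (Series_incr_n a (S n)) by (auto; lia). simpl Init.Nat.pred.
  rewrite sum_n_Reals. ring.
- replace (Finite 0) with (Rbar_minus (Series a) (Series a)) by (simpl; f_equal; ring).
  apply is_lim_seq_minus'; [apply is_lim_seq_const|].
  apply Series_correct in Ha. exact Ha.
Qed.

(** * Absolutely convergent complex series *)

Definition summable (a : nat -> C) : Prop := ex_series (fun n => Cmod (a n)).

Lemma im_le_Cmod (z : C) : Rabs (Im z) <= Cmod z.
Proof.
eapply Rle_trans; [|apply Rmax_Cmod]. apply Rmax_r.
Qed.

Lemma summable_Re_abs a : summable a -> ex_series (fun n => Rabs (Re (a n))).
Proof.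
apply ex_series_comparison. intros n. rewrite Rabs_Rabsolu. apply re_le_Cmod.
Qed.

Lemma summable_Im_abs a : summable a -> ex_series (fun n => Rabs (Im (a n))).
Proof.
apply ex_series_comparison. intros n. rewrite Rabs_Rabsolu. apply im_le_Cmod.
Qed.

Lemma summable_Re a : summable a -> ex_series (fun n => Re (a n)).
Proof. intros; now apply ex_series_Rabs, summable_Re_abs. Qed.

Lemma summable_Im a : summable a -> ex_series (fun n => Im (a n)).
Proof. intros; now apply ex_series_Rabs, summable_Im_abs. Qed.

Lemma summable_le (a : nat -> C) (b : nat -> R) :
  (forall n, Cmod (a n) <= b n) -> ex_series b -> summable a.
Proof.
intros H. apply ex_series_comparison. intros n.
rewrite Rabs_pos_eq; auto using Cmod_ge_0.
Qed.

Lemma summable_ext (a b : nat -> C) :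
  (forall n, a n = b n) -> summable a -> summable b.
Proof. intros H. apply ex_series_ext. intros n; now rewrite H. Qed.

Lemma summable_plus a b : summable a -> summable b -> summable (fun n => a n + b n)%C.
Proof.
intros Ha Hb. apply (summable_le _ (fun n => Cmod (a n) + Cmod (b n))).
- intros; apply Cmod_triangle.
- now apply (@ex_series_plus R_AbsRing R_NormedModule).
Qed.

Lemma summable_scal (c : C) a : summable a -> summable (fun n => c * a n)%C.
Proof.
intros Ha. apply (summable_le _ (fun n => Cmod c * Cmod (a n))).
- intros; rewrite Cmod_mult; lra.
- now apply (@ex_series_scal_l R_AbsRing R_NormedModule (Cmod c)).
Qed.

Lemma summable_opp a : summable a -> summable (fun n => - a n)%C.
Proof. apply ex_series_ext. intros n; now rewrite Cmod_opp. Qed.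

Lemma summable_minus a b : summable a -> summable b -> summable (fun n => a n - b n)%C.
Proof. intros; apply summable_plus; auto using summable_opp. Qed.

Lemma summable_incr_1 a : summable a <-> summable (fun n => a (S n)).
Proof. apply (ex_series_incr_1 (fun n => Cmod (a n))). Qed.

Lemma summable_incr_n a N : summable a -> summable (fun n => a (N + n)%nat).
Proof. apply (ex_series_incr_n (fun n => Cmod (a n)) N). Qed.

Lemma CSeries_ext (a b : nat -> C) : (forall n, a n = b n) -> CSeries a = CSeries b.
Proof.
intros H. unfold CSeries. f_equal; apply Series_ext; intros n; now rewrite H.
Qed.

Lemma C_ext (z w : C) : Re z = Re w -> Im z = Im w -> z = w.
Proof. destruct z, w; simpl; intros; now subst. Qed.

Lemma CSeries_plus a b : summable a -> summable b ->
  CSeries (fun n => a n + b n)%C = (CSeries a + CSeries b)%C.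
Proof.
intros Ha Hb. apply C_ext; simpl; apply Series_plus;
  auto using summable_Re, summable_Im.
Qed.

Lemma CSeries_opp a : CSeries (fun n => - a n)%C = (- CSeries a)%C.
Proof. apply C_ext; simpl; apply Series_opp. Qed.

Lemma CSeries_minus a b : summable a -> summable b ->
  CSeries (fun n => a n - b n)%C = (CSeries a - CSeries b)%C.
Proof.
intros Ha Hb. unfold Cminus.
rewrite (CSeries_plus a (fun n => - b n)%C); auto using summable_opp.
now rewrite CSeries_opp.
Qed.

Lemma CSeries_scal (c : C) a : summable a ->
  CSeries (fun n => c * a n)%C = (c * CSeries a)%C.
Proof.
intros Ha. pose proof (summable_Re _ Ha). pose proof (summable_Im _ Ha).
assert (forall x (f : nat -> R), ex_series f -> ex_series (fun n => x * f n)).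
{ intros x f Hf. now apply (@ex_series_scal_l R_AbsRing R_NormedModule x f). }
apply C_ext; simpl.
- rewrite <- !Series_scal_l. unfold Re, Im in *.
  rewrite <- Series_minus; auto.
- rewrite <- !Series_scal_l. unfold Re, Im in *.
  rewrite <- Series_plus; auto.
Qed.

Lemma CSeries_0 : CSeries (fun _ => 0%C) = 0%C.
Proof.
assert (Series (fun _ => 0) = 0).
{ rewrite (Series_ext _ (fun _ => 0 * 0)) by (intros; ring).
  rewrite Series_scal_l. ring. }
apply C_ext; simpl; auto.
Qed.

(** The rotation u = conj(z) / |z| moves z onto the positive real axis. This reduces the triangle
    inequality for infinite complex sums to the real one. *)
Lemma Cmod_le_of_rotations (z : C) (M : R) :
  0 <= M -> (forall u, Cmod u = 1 -> Re (u * z)%C <= M) -> Cmod z <= M.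
Proof.
intros HM H. destruct (Ceq_dec z 0) as [->|Hz]; [now rewrite Cmod_0|].
assert (Hm : 0 < Cmod z) by now apply Cmod_gt_0.
specialize (H (Cconj z / RtoC (Cmod z))%C).
assert (Hn : RtoC (Cmod z) <> 0%C) by (intros E; apply RtoC_inj in E; lra).
assert (E : (Cconj z / RtoC (Cmod z) * z)%C = RtoC (Cmod z)).
{ transitivity ((z * Cconj z) / RtoC (Cmod z))%C; [field; auto|].
  rewrite <- Cmod2_conj. rewrite RtoC_pow. field; auto. }
rewrite E in H. apply H.
rewrite Cmod_div, Cmod_conj, Cmod_R, Rabs_pos_eq by (auto; lra). field; lra.
Qed.

Lemma Cmod_CSeries (a : nat -> C) :
  summable a -> Cmod (CSeries a) <= Series (fun n => Cmod (a n)).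
Proof.
intros Ha. apply Cmod_le_of_rotations.
- apply Series_nonneg. intros; apply Cmod_ge_0.
- intros u Hu. rewrite <- CSeries_scal by auto.
  change (Series (fun n => Re (u * a n)%C) <= Series (fun n => Cmod (a n))).
  eapply Rle_trans; [apply Rle_abs|].
  pose proof (summable_scal u _ Ha) as Hs.
  eapply Rle_trans; [apply Series_Rabs; now apply summable_Re_abs in Hs|].
  apply Series_le; auto. intros n. split; [apply Rabs_pos|].
  eapply Rle_trans; [apply re_le_Cmod|]. rewrite Cmod_mult, Hu. lra.
Qed.

Lemma Cmod_CSeries_le (a : nat -> C) (b : nat -> R) :
  (forall n, Cmod (a n) <= b n) -> ex_series b -> Cmod (CSeries a) <= Series b.
Proof.
intros H Hb. eapply Rle_trans; [apply Cmod_CSeries; eapply summable_le; eauto|].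
apply Series_le; auto. intros; split; auto using Cmod_ge_0.
Qed.

Lemma CSeries_incr_1 a : summable a -> CSeries a = (a O + CSeries (fun n => a (S n)))%C.
Proof.
intros Ha. apply C_ext; simpl.
- rewrite (Series_incr_1 (fun n => Re (a n))) by now apply summable_Re. reflexivity.
- rewrite (Series_incr_1 (fun n => Im (a n))) by now apply summable_Im. reflexivity.
Qed.

(** Sums the terms of index below [n], unlike [sum_n], so that the remainder after [psum a n] starts
    at index [n]. *)
Fixpoint psum (a : nat -> C) (n : nat) : C :=
  match n with O => 0%C | S m => (psum a m + a m)%C end.

Lemma CSeries_psum a N : summable a ->
  CSeries a = (psum a N + CSeries (fun n => a (N + n)%nat))%C.
Proof.
intros Ha. induction N as [|N IH]; cbn [psum].
{ change (fun n => a (0 + n)%nat) with a. ring. }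
rewrite IH, (CSeries_incr_1 (fun n => a (N + n)%nat)) by now apply summable_incr_n.
rewrite Nat.add_0_r.
rewrite (CSeries_ext (fun n => a (N + S n)%nat) (fun n => a (S N + n)%nat)).
- ring.
- intros n. f_equal. lia.
Qed.

Lemma psum_lim a eps : summable a -> 0 < eps ->
  exists N, forall n, (N <= n)%nat -> Cmod (CSeries a - psum a n)%C < eps.
Proof.
intros Ha He.
pose proof (Series_tail_lim _ Ha) as HT. apply is_lim_seq_spec in HT.
destruct (HT (mkposreal eps He)) as [N HN].
exists N. intros n Hn. specialize (HN n Hn). simpl in HN.
rewrite (CSeries_psum a n Ha).
replace (psum a n + CSeries (fun k => a (n + k)%nat) - psum a n)%C
  with (CSeries (fun k => a (n + k)%nat)) by ring.
eapply Rle_lt_trans; [apply Cmod_CSeries; now apply summable_incr_n|].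
eapply Rle_lt_trans; [apply Rle_abs|]. rewrite Rminus_0_r in HN. exact HN.
Qed.

Lemma Cmod_eq_0_eps (z : C) : (forall eps, 0 < eps -> Cmod z <= eps) -> z = 0%C.
Proof.
intros H. apply Cmod_eq_0.
destruct (Rle_lt_or_eq_dec 0 (Cmod z) (Cmod_ge_0 z)); auto.
specialize (H (Cmod z / 2)). lra.
Qed.

Lemma Ceq_of_eps (z w : C) : (forall eps, 0 < eps -> Cmod (z - w)%C <= eps) -> z = w.
Proof.
intros H. apply Cmod_eq_0_eps in H.
replace z with (z - w + w)%C by ring. rewrite H. ring.
Qed.

Lemma CSeries_telescope (u : nat -> C) :
  (forall eps, 0 < eps -> exists N, forall n, (N <= n)%nat -> Cmod (u n) <= eps) ->
  summable (fun n => u n - u (S n))%C ->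
  CSeries (fun n => u n - u (S n))%C = u O.
Proof.
intros Hu Hs. apply Ceq_of_eps. intros eps He.
destruct (psum_lim _ (eps / 2) Hs) as [N HN]; [lra|].
destruct (Hu (eps / 2)) as [N' HN']; [lra|].
assert (E : forall n, psum (fun n => u n - u (S n))%C n = (u O - u n)%C).
{ induction n; simpl; [ring|]. rewrite IHn. ring. }
specialize (HN (N + N')%nat ltac:(lia)). specialize (HN' (N + N')%nat ltac:(lia)).
rewrite E in HN.
match goal with |- Cmod (?S - _)%C <= _ =>
  replace (S - u O)%C with ((S - (u O - u (N + N')%nat)) + - u (N + N')%nat)%C by ring end.
eapply Rle_trans; [apply Cmod_triangle|]. rewrite Cmod_opp. lra.
Qed.

Lemma CSeries_exchange (a : nat -> nat -> C) :
  (forall m, summable (a m)) ->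
  ex_series (fun m => Series (fun n => Cmod (a m n))) ->
  (forall n, summable (fun m => a m n)) /\
  summable (fun m => CSeries (a m)) /\
  summable (fun n => CSeries (fun m => a m n)) /\
  CSeries (fun m => CSeries (a m)) = CSeries (fun n => CSeries (fun m => a m n)).
Proof.
intros Hr Hs.
destruct (Series_exchange_nonneg (fun m n => Cmod (a m n))) as (H1 & H2 & H3);
  auto using Cmod_ge_0.
repeat split; auto.
- eapply summable_le; [|exact Hs]. intros m. now apply Cmod_CSeries.
- eapply summable_le; [|exact H2]. intros m. apply Cmod_CSeries, H1.
- apply C_ext; simpl; apply Series_exchange; auto using summable_Re_abs, summable_Im_abs.
  + eapply ex_series_comparison; [|exact Hs]. intros m.
    rewrite Rabs_pos_eq by (apply Series_nonneg; intros; apply Rabs_pos).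
    apply Series_le; [|apply Hr]. intros n; split; [apply Rabs_pos|apply re_le_Cmod].
  + eapply ex_series_comparison; [|exact Hs]. intros m.
    rewrite Rabs_pos_eq by (apply Series_nonneg; intros; apply Rabs_pos).
    apply Series_le; [|apply Hr]. intros n; split; [apply Rabs_pos|apply im_le_Cmod].
Qed.

Lemma ex_series_scalR (c : R) (a : nat -> R) :
  ex_series a -> ex_series (fun n => c * a n).
Proof. intros. now apply (@ex_series_scal_l R_AbsRing R_NormedModule c a). Qed.

(** Domination by a product of two convergent series is the criterion behind every later interchange
    of complex sums. *)
Lemma CSeries_exchange_prod (a : nat -> nat -> C) (u v : nat -> R) :
  ex_series u -> ex_series v -> (forall m n, Cmod (a m n) <= u m * v n) ->
  (forall m, summable (a m)) /\
  (forall n, summable (fun m => a m n)) /\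
  summable (fun m => CSeries (a m)) /\
  summable (fun n => CSeries (fun m => a m n)) /\
  CSeries (fun m => CSeries (a m)) = CSeries (fun n => CSeries (fun m => a m n)).
Proof.
intros Hu Hv H.
assert (S1 : forall m, summable (a m)).
{ intros m. eapply summable_le; [apply H|]. now apply ex_series_scalR. }
split; auto. apply CSeries_exchange; auto.
eapply ex_series_comparison; [|apply (ex_series_scalR (Series v)), Hu].
intros m. rewrite Rabs_pos_eq by (apply Series_nonneg; intros; apply Cmod_ge_0).
rewrite Rmult_comm, <- Series_scal_l. apply Series_le.
- intros n. split; [apply Cmod_ge_0|apply H].
- now apply ex_series_scalR.
Qed.

Lemma sum_n_subseq_le (a : nat -> R) (f : nat -> nat) (n : nat) :
  (forall k, 0 <= a k) -> (forall k, (f k < f (S k))%nat) ->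
  sum_n (fun k => a (f k)) n <= sum_n a (f n).
Proof.
intros H0 Hf.
assert (Hm : forall i j, (i <= j)%nat -> sum_n a i <= sum_n a j).
{ intros i j Hij. induction Hij; [lra|]. rewrite sum_Sn. unfold plus; simpl.
  specialize (H0 (S m)). lra. }
induction n.
- rewrite sum_O. destruct (f O) as [|n0] eqn:E; [rewrite sum_O; lra|].
  rewrite sum_Sn. unfold plus; simpl. specialize (Hm O n0 ltac:(lia)). rewrite sum_O in Hm.
  specialize (H0 O). lra.
- rewrite sum_Sn. specialize (Hf n). destruct (f (S n)) as [|p] eqn:E; [lia|].
  rewrite sum_Sn. unfold plus; simpl. specialize (Hm (f n) p ltac:(lia)). lra.
Qed.

Lemma summable_subseq (a : nat -> C) (f : nat -> nat) :
  (forall k, (f k < f (S k))%nat) -> summable a -> summable (fun n => a (f n)).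
Proof.
intros Hf Ha. apply (ex_series_bounded _ (Series (fun n => Cmod (a n)))).
- intros; apply Cmod_ge_0.
- intros n. eapply Rle_trans; [apply (sum_n_subseq_le (fun n => Cmod (a n)))|];
    auto using Cmod_ge_0.
  apply sum_n_le_Series; auto using Cmod_ge_0.
Qed.

Lemma CSeries_even_odd (a : nat -> C) : summable a ->
  CSeries a = (CSeries (fun n => a (2 * n)%nat) + CSeries (fun n => a (2 * n + 1)%nat))%C.
Proof.
intros Ha.
assert (He : summable (fun n => a (2 * n)%nat)) by (apply summable_subseq; auto; intros; lia).
assert (Ho : summable (fun n => a (2 * n + 1)%nat)) by (apply summable_subseq; auto; intros; lia).
assert (E : forall n, psum a (2 * n) =
  (psum (fun n => a (2 * n)%nat) n + psum (fun n => a (2 * n + 1)%nat) n)%C).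
{ induction n; [simpl; ring|].
  replace (2 * S n)%nat with (S (S (2 * n))) by lia. cbn [psum]. rewrite IHn.
  replace (2 * n + 1)%nat with (S (2 * n)) by lia. ring. }
apply Ceq_of_eps. intros eps Heps.
destruct (psum_lim _ (eps / 3) Ha) as [N1 H1]; [lra|].
destruct (psum_lim _ (eps / 3) He) as [N2 H2]; [lra|].
destruct (psum_lim _ (eps / 3) Ho) as [N3 H3]; [lra|].
set (N := (N1 + N2 + N3)%nat).
specialize (H1 (2 * N)%nat ltac:(lia)). specialize (H2 N ltac:(lia)).
specialize (H3 N ltac:(lia)). rewrite E in H1.
match goal with |- Cmod (?A - (?B + ?D))%C <= _ =>
  match type of H1 with Cmod (_ - (?p + ?q))%C < _ =>
  replace (A - (B + D))%C with ((A - (p + q)) + (- (B - p) + - (D - q)))%C by ring end end.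
eapply Rle_trans; [apply Cmod_triangle|].
eapply Rle_trans; [apply Rplus_le_compat_l, Cmod_triangle|].
rewrite !Cmod_opp. lra.
Qed.

(** * Complex differentiation with quadratic remainder *)

(** The quadratic error makes the calculus explicit: sums, products and compositions are handled by
    algebra, and for series it suffices to add up the constants [K]. *)
Definition Cder (f : C -> C) (z l : C) : Prop :=
  exists K d : R, 0 <= K /\ 0 < d /\
    forall h : C, Cmod h < d -> Cmod (f (z + h) - f z - h * l)%C <= K * Cmod h ^ 2.

Lemma Cder_const (c z : C) : Cder (fun _ => c) z (RtoC 0).
Proof.
exists 0, 1. repeat split; try lra. intros h _.
replace (c - c - h * 0)%C with (RtoC 0) by ring. rewrite Cmod_0. lra.
Qed.

Lemma Cder_id (z : C) : Cder (fun w => w) z (RtoC 1).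
Proof.
exists 0, 1. repeat split; try lra. intros h _.
replace (z + h - z - h * 1)%C with (RtoC 0) by ring. rewrite Cmod_0. lra.
Qed.

Lemma Cder_ext_loc (f g : C -> C) (z l : C) (d : R) :
  0 < d -> (forall h, Cmod h < d -> f (z + h)%C = g (z + h)%C) -> Cder f z l -> Cder g z l.
Proof.
intros Hd He (K & d' & HK & Hd' & H).
assert (Ez : f z = g z).
{ specialize (He (RtoC 0)). replace (z + 0)%C with z in He by ring. apply He. now rewrite Cmod_0. }
exists K, (Rmin d d'). repeat split; auto. { now apply Rmin_glb_lt. }
intros h Hh. rewrite <- He, <- Ez. apply H.
- eapply Rlt_le_trans; [exact Hh|apply Rmin_r].
- eapply Rlt_le_trans; [exact Hh|apply Rmin_l].
Qed.

Lemma Cder_eq (f : C -> C) (z l l' : C) : Cder f z l -> l = l' -> Cder f z l'.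
Proof. now intros H <-. Qed.

Lemma Cder_plus f g z a b : Cder f z a -> Cder g z b ->
  Cder (fun w => f w + g w)%C z (a + b)%C.
Proof.
intros (K & d & HK & Hd & H) (K' & d' & HK' & Hd' & H').
exists (K + K'), (Rmin d d'). repeat split; [lra|now apply Rmin_glb_lt|].
intros h Hh.
replace (f (z + h) + g (z + h) - (f z + g z) - h * (a + b))%C with
  ((f (z + h) - f z - h * a) + (g (z + h) - g z - h * b))%C by ring.
eapply Rle_trans; [apply Cmod_triangle|]. rewrite Rmult_plus_distr_r.
apply Rplus_le_compat; [apply H|apply H'];
  (eapply Rlt_le_trans; [exact Hh|]); [apply Rmin_l|apply Rmin_r].
Qed.

Lemma Cder_cont f z l : Cder f z l ->
  exists B d, 0 <= B /\ 0 < d /\ forall h, Cmod h < d ->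
    Cmod (f (z + h) - f z)%C <= B * Cmod h.
Proof.
intros (K & d & HK & Hd & H).
exists (K + Cmod l), (Rmin d 1). pose proof (Cmod_ge_0 l).
repeat split; [lra|apply Rmin_glb_lt; lra|].
intros h Hh. pose proof (Cmod_ge_0 h).
assert (Cmod h < d) by (eapply Rlt_le_trans; [exact Hh|apply Rmin_l]).
assert (Cmod h < 1) by (eapply Rlt_le_trans; [exact Hh|apply Rmin_r]).
replace (f (z + h) - f z)%C with ((f (z + h) - f z - h * l) + h * l)%C by ring.
eapply Rle_trans; [apply Cmod_triangle|]. rewrite Cmod_mult.
specialize (H h H2).
assert (K * Cmod h ^ 2 <= K * Cmod h) by (apply Rmult_le_compat_l; nra). nra.
Qed.

Lemma Cder_mult f g z a b : Cder f z a -> Cder g z b ->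
  Cder (fun w => f w * g w)%C z (a * g z + f z * b)%C.
Proof.
intros Hf Hg.
destruct (Cder_cont _ _ _ Hf) as (B & e & HB & He & HcB).
destruct (Cder_cont _ _ _ Hg) as (B' & e' & HB' & He' & HcB').
destruct Hf as (K & d & HK & Hd & H). destruct Hg as (K' & d' & HK' & Hd' & H').
exists (K * Cmod (g z) + Cmod (f z) * K' + B * B'), (Rmin (Rmin d d') (Rmin e e')).
pose proof (Cmod_ge_0 (g z)). pose proof (Cmod_ge_0 (f z)).
repeat split; [|repeat apply Rmin_glb_lt; auto|].
{ repeat apply Rplus_le_le_0_compat; apply Rmult_le_pos; auto. }
intros h Hh.
assert (Cmod h < d /\ Cmod h < d' /\ Cmod h < e /\ Cmod h < e') as (h1 & h2 & h3 & h4).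
{ generalize (Rmin_l d d'), (Rmin_r d d'), (Rmin_l e e'), (Rmin_r e e'),
   (Rmin_l (Rmin d d') (Rmin e e')), (Rmin_r (Rmin d d') (Rmin e e')). lra. }
replace (f (z + h) * g (z + h) - f z * g z - h * (a * g z + f z * b))%C with
 ((f (z + h) - f z - h * a) * g z + f z * (g (z + h) - g z - h * b)
   + (f (z + h) - f z) * (g (z + h) - g z))%C by ring.
eapply Rle_trans; [apply Cmod_triangle|].
eapply Rle_trans; [apply Rplus_le_compat_r, Cmod_triangle|].
rewrite !Cmod_mult. rewrite !Rmult_plus_distr_r. pose proof (Cmod_ge_0 h).
apply Rplus_le_compat; [apply Rplus_le_compat|].
- specialize (H h h1). nra.
- specialize (H' h h2). nra.
- specialize (HcB h h3). specialize (HcB' h h4).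
  replace (B * B' * Cmod h ^ 2) with ((B * Cmod h) * (B' * Cmod h)) by ring.
  apply Rmult_le_compat; auto using Cmod_ge_0.
Qed.

Lemma Cder_scal c f z a : Cder f z a -> Cder (fun w => c * f w)%C z (c * a)%C.
Proof.
intros Hf. eapply Cder_eq; [apply Cder_mult; [apply Cder_const|exact Hf]|]. cbn beta. ring.
Qed.

Lemma Cder_opp f z a : Cder f z a -> Cder (fun w => - f w)%C z (- a)%C.
Proof.
intros (K & d & HK & Hd & H). exists K, d. repeat split; auto.
intros h Hh.
replace (- f (z + h) - - f z - h * - a)%C with (- (f (z + h) - f z - h * a))%C by ring.
rewrite Cmod_opp. auto.
Qed.

Lemma Cder_minus f g z a b : Cder f z a -> Cder g z b ->
  Cder (fun w => f w - g w)%C z (a - b)%C.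
Proof. intros; apply Cder_plus; auto using Cder_opp. Qed.

Lemma Cder_comp f g z a b : Cder g z b -> Cder f (g z) a ->
  Cder (fun w => f (g w)) z (a * b)%C.
Proof.
intros Hg. destruct (Cder_cont _ _ _ Hg) as (B & e & HB & He & HcB).
destruct Hg as (K' & d' & HK' & Hd' & H'). intros (K & d & HK & Hd & H).
exists (K * B ^ 2 + Cmod a * K'), (Rmin (Rmin d' e) (d / (B + 1))).
pose proof (Cmod_ge_0 a).
assert (0 < d / (B + 1)) by (apply Rdiv_lt_0_compat; lra).
repeat split; [|repeat apply Rmin_glb_lt; auto|].
{ apply Rplus_le_le_0_compat; apply Rmult_le_pos; auto. apply pow_le; auto. }
intros h Hh.
assert (Cmod h < d' /\ Cmod h < e /\ Cmod h < d / (B + 1)) as (h1 & h2 & h3).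
{ generalize (Rmin_l d' e), (Rmin_r d' e), (Rmin_l (Rmin d' e) (d / (B + 1))),
   (Rmin_r (Rmin d' e) (d / (B + 1))). lra. }
specialize (HcB h h2). specialize (H' h h1). pose proof (Cmod_ge_0 h).
set (k := (g (z + h) - g z)%C) in *.
assert (Hk : Cmod k < d).
{ apply Rle_lt_trans with (1 := HcB).
  apply Rmult_lt_compat_r with (r := B + 1) in h3; [|lra].
  replace (d / (B + 1) * (B + 1)) with d in h3 by (field; lra). nra. }
replace (g (z + h)%C) with (g z + k)%C by (unfold k; ring).
replace (f (g z + k) - f (g z) - h * (a * b))%C with
  ((f (g z + k) - f (g z) - k * a) + a * (k - h * b))%C by ring.
eapply Rle_trans; [apply Cmod_triangle|]. rewrite Cmod_mult.
specialize (H k Hk).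
rewrite Rmult_plus_distr_r. apply Rplus_le_compat.
- apply Rle_trans with (1 := H). rewrite Rmult_assoc. apply Rmult_le_compat_l; auto.
  rewrite <- Rpow_mult_distr. apply pow_incr. split; auto using Cmod_ge_0.
- rewrite Rmult_assoc. apply Rmult_le_compat_l; auto.
Qed.

Lemma Cmod_triangle_rev (z w : C) : Cmod z - Cmod w <= Cmod (z + w)%C.
Proof.
generalize (Cmod_triangle (z + w) (- w)). rewrite Cmod_opp.
replace (z + w + - w)%C with z by ring. lra.
Qed.

Lemma Cmod_pos_neq (z : C) : 0 < Cmod z -> z <> (RtoC 0).
Proof. intros H ->. rewrite Cmod_0 in H. lra. Qed.

Lemma Cder_inv (z : C) : z <> (RtoC 0) -> Cder (fun w => / w)%C z (- / (z * z))%C.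
Proof.
intros Hz. assert (Hm : 0 < Cmod z) by now apply Cmod_gt_0.
exists (2 / Cmod z ^ 3), (Cmod z / 2). split; [|split; [lra|]].
{ apply Rlt_le, Rdiv_lt_0_compat; [lra|]. now apply pow_lt. }
intros h Hh. pose proof (Cmod_triangle_rev z h).
assert (Hzh : (z + h)%C <> (RtoC 0)) by (apply Cmod_pos_neq; lra).
replace (/ (z + h) - / z - h * - / (z * z))%C with (h * h / (z * z * (z + h)))%C
  by (field; auto).
assert (z * z * (z + h) <> 0)%C by (repeat apply Cmult_neq_0; auto).
rewrite Cmod_div, !Cmod_mult by auto.
replace (2 / Cmod z ^ 3 * Cmod h ^ 2) with (Cmod h * Cmod h / (Cmod z * Cmod z * (Cmod z / 2)))
  by (field; lra).
apply Rmult_le_compat_l; [pose proof (Cmod_ge_0 h); nra|].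
apply Rinv_le_contravar.
- repeat apply Rmult_lt_0_compat; lra.
- apply Rmult_le_compat_l; [nra|]. lra.
Qed.

Lemma Cder_unique f z a b : Cder f z a -> Cder f z b -> a = b.
Proof.
intros Ha Hb.
assert (H : Cder (fun w => f w - f w)%C z (a - b)%C) by (apply Cder_minus; auto).
destruct H as (K & d & HK & Hd & H).
apply Ceq_of_eps. intros eps He.
set (t := Rmin (d / 2) (eps / (K + 1))).
assert (0 < eps / (K + 1)) by (apply Rdiv_lt_0_compat; lra).
assert (0 < t) by (apply Rmin_glb_lt; lra).
assert (t < d) by (generalize (Rmin_l (d / 2) (eps / (K + 1))); fold t; lra).
assert (t * (K + 1) <= eps).
{ generalize (Rmin_r (d / 2) (eps / (K + 1))); fold t; intros Ht.
  apply Rmult_le_compat_r with (r := K + 1) in Ht; [|lra].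
  replace (eps / (K + 1) * (K + 1)) with eps in Ht by (field; lra). auto. }
specialize (H (RtoC t)). rewrite Cmod_R, Rabs_pos_eq in H by lra. specialize (H H2).
replace (f (z + t) - f (z + t) - (f z - f z) - t * (a - b))%C with (- (t * (a - b)))%C in H by ring.
rewrite Cmod_opp, Cmod_mult, Cmod_R, Rabs_pos_eq in H by lra.
assert (t * Cmod (a - b)%C <= t * (K * t)) by nra.
apply Rmult_le_reg_l in H4; nra.
Qed.

(** Along the segment from [a] to [b] this is a statement on a function of one real variable. The
    projection [p], later [Re] or [Im], is there because the mean value theorem holds only for real
    values. *)
Lemma Cder_0_component (p : C -> R) (f : C -> C) (a b : C) :
  (forall z, Rabs (p z) <= Cmod z) -> (forall z w, p (z - w)%C = p z - p w) ->
  (forall t, 0 <= t <= 1 -> Cder f (a + RtoC t * (b - a))%C (RtoC 0)) ->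
  p (f a) = p (f b).
Proof.
intros Hp Hpm H.
set (g := fun t : R => p (f (a + RtoC t * (b - a))%C)).
assert (Hg : forall t, 0 <= t <= 1 -> is_derive g t 0).
{ intros t Ht. apply is_derive_Reals. intros eps He.
  destruct (H t Ht) as (K & d & HK & Hd & HH).
  set (M := Cmod (b - a)%C). assert (HM : 0 <= M) by apply Cmod_ge_0.
  assert (Hd1 : 0 < d / (M + 1)) by (apply Rdiv_lt_0_compat; lra).
  assert (HKM : 0 <= K * M ^ 2) by (apply Rmult_le_pos; auto; apply pow_le; auto).
  assert (Hd2 : 0 < eps / (K * M ^ 2 + 1)) by (apply Rdiv_lt_0_compat; lra).
  assert (Hdd : 0 < Rmin (d / (M + 1)) (eps / (K * M ^ 2 + 1))) by now apply Rmin_glb_lt.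
  exists (mkposreal _ Hdd). simpl. intros h Hh0 Hh.
  assert (h1 : Rabs h < d / (M + 1)) by (eapply Rlt_le_trans; [exact Hh|apply Rmin_l]).
  assert (h2 : Rabs h < eps / (K * M ^ 2 + 1)) by (eapply Rlt_le_trans; [exact Hh|apply Rmin_r]).
  assert (hp : 0 < Rabs h) by now apply Rabs_pos_lt.
  rewrite Rminus_0_r. unfold Rdiv. rewrite Rabs_mult, Rabs_inv.
  specialize (HH (RtoC h * (b - a))%C).
  rewrite Cmod_mult, Cmod_R in HH. fold M in HH.
  assert (hd : Rabs h * M < d).
  { apply Rmult_lt_compat_r with (r := M + 1) in h1; [|lra].
    replace (d / (M + 1) * (M + 1)) with d in h1 by (field; lra). nra. }
  specialize (HH hd).
  match type of HH with Cmod (?A - ?B - ?X)%C <= _ =>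
    replace (A - B - X)%C with (A - B)%C in HH by ring end.
  replace (a + t * (b - a) + h * (b - a))%C with (a + RtoC (t + h) * (b - a))%C in HH
    by (rewrite RtoC_plus; ring).
  assert (Rabs (g (t + h) - g t) <= K * (Rabs h * M) ^ 2).
  { unfold g. rewrite <- Hpm. eapply Rle_trans; [apply Hp|exact HH]. }
  apply Rle_lt_trans with (K * (Rabs h * M) ^ 2 * / Rabs h).
  { apply Rmult_le_compat_r; auto. now apply Rlt_le, Rinv_0_lt_compat. }
  replace (K * (Rabs h * M) ^ 2 * / Rabs h) with (Rabs h * (K * M ^ 2)) by (field; lra).
  apply Rmult_lt_compat_r with (r := K * M ^ 2 + 1) in h2; [|lra].
  replace (eps / (K * M ^ 2 + 1) * (K * M ^ 2 + 1)) with eps in h2 by (field; lra). nra. }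
destruct (MVT_gen g 0 1 (fun _ => 0)) as (c & Hc & E).
- intros x Hx. rewrite Rmin_left, Rmax_right in Hx by lra. apply Hg; lra.
- intros x Hx. rewrite Rmin_left, Rmax_right in Hx by lra.
  apply derivable_continuous_pt. exists 0. apply is_derive_Reals, Hg; lra.
- unfold g in E.
  replace (a + RtoC 1 * (b - a))%C with b in E by ring.
  replace (a + RtoC 0 * (b - a))%C with a in E by ring. lra.
Qed.

Lemma Cder_0_const (P : C -> Prop) (f : C -> C) :
  (forall a b t, P a -> P b -> 0 <= t <= 1 -> P (a + RtoC t * (b - a))%C) ->
  (forall z, P z -> Cder f z (RtoC 0)) ->
  forall a b, P a -> P b -> f a = f b.
Proof.
intros HP Hf a b Ha Hb. apply C_ext.
- apply (Cder_0_component Re); auto using re_le_Cmod.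
- apply (Cder_0_component Im); auto using im_le_Cmod.
Qed.

Lemma Cder_CSeries (f : nat -> C -> C) (f' : nat -> C) (z : C) (d : R) (K : nat -> R) :
  0 < d -> ex_series K ->
  (forall n h, Cmod h < d -> Cmod (f n (z + h) - f n z - h * f' n)%C <= K n * Cmod h ^ 2) ->
  (forall h, Cmod h < d -> summable (fun n => f n (z + h)%C)) ->
  summable f' ->
  Cder (fun w => CSeries (fun n => f n w)) z (CSeries f').
Proof.
intros Hd HK H Hs Hf'.
assert (Hz : summable (fun n => f n z)).
{ apply (summable_ext (fun n => f n (z + 0)%C)); [intros; f_equal; ring|].
  apply Hs. now rewrite Cmod_0. }
(* The sign of [K n] is read off from [H] at a single nonzero increment. *)
assert (HK0 : forall n, 0 <= K n).
{ intros n. specialize (H n (RtoC (d / 2))).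
  rewrite Cmod_R, Rabs_pos_eq in H by lra. specialize (H ltac:(lra)).
  pose proof (Cmod_ge_0 (f n (z + RtoC (d / 2)) - f n z - RtoC (d / 2) * f' n)%C).
  assert (0 < (d / 2) ^ 2) by (apply pow_lt; lra). nra. }
exists (Series K), d. repeat split; auto. { now apply Series_nonneg. }
intros h Hh.
assert (Hhf : summable (fun n => h * f' n)%C) by now apply summable_scal.
rewrite <- CSeries_scal, <- !CSeries_minus by auto using summable_minus.
rewrite <- Series_scal_r. apply Cmod_CSeries_le.
- intros n. now apply H.
- apply (ex_series_ext (fun n => scal (Cmod h ^ 2) (K n))).
  { intros n; unfold scal; simpl; unfold mult; simpl; ring. }
  now apply (@ex_series_scal_l R_AbsRing R_NormedModule).
Qed.

(** The bound is n^2 rho^(n-2) |h|^2, written as a quotient because n - 2 may be negative. The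
    remainders satisfy D_(n+1) = (z + h) D_n + n h^2 z^(n-1). *)
Lemma pow_remainder (z h : C) (rho : R) (n : nat) :
  0 < rho -> Cmod z <= rho -> Cmod (z + h)%C <= rho ->
  Cmod ((z + h) ^ n - z ^ n - h * (RtoC (INR n) * z ^ pred n))%C
    <= INR n ^ 2 * rho ^ n / rho ^ 2 * Cmod h ^ 2.
Proof.
intros Hr Hz Hzh.
assert (Hr2 : 0 < rho ^ 2) by now apply pow_lt.
enough (H : rho ^ 2 * Cmod ((z + h) ^ n - z ^ n - h * (RtoC (INR n) * z ^ pred n))%C
   <= INR n ^ 2 * rho ^ n * Cmod h ^ 2).
{ apply Rmult_le_reg_l with (rho ^ 2); auto.
  replace (rho ^ 2 * (INR n ^ 2 * rho ^ n / rho ^ 2 * Cmod h ^ 2))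
    with (INR n ^ 2 * rho ^ n * Cmod h ^ 2) by (field; lra). auto. }
induction n as [|n IH].
- simpl. replace (1 - 1 - h * (0 * 1))%C with (RtoC 0) by ring. rewrite Cmod_0. lra.
- set (D := ((z + h) ^ n - z ^ n - h * (RtoC (INR n) * z ^ pred n))%C) in *.
  assert (E : ((z + h) ^ S n - z ^ S n - h * (RtoC (INR (S n)) * z ^ pred (S n)))%C
    = ((z + h) * D + h * h * (RtoC (INR n) * z ^ pred n))%C).
  { unfold D. rewrite S_INR, RtoC_plus. destruct n; simpl; ring. }
  rewrite E. pose proof (Cmod_ge_0 h). pose proof (Cmod_ge_0 D). pose proof (pos_INR n).
  assert (Hb : rho ^ 2 * Cmod (h * h * (RtoC (INR n) * z ^ pred n))%C
     <= INR n * rho ^ S n * Cmod h ^ 2).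
  { rewrite !Cmod_mult, Cmod_R, Cmod_pow, Rabs_pos_eq by auto.
    destruct n; [simpl; lra|]. cbn [pred].
    assert (Cmod z ^ n <= rho ^ n) by (apply pow_incr; split; auto using Cmod_ge_0).
    replace (rho ^ S (S n)) with (rho ^ 2 * rho ^ n) by (simpl; ring).
    replace (rho ^ 2 * (Cmod h * Cmod h * (INR (S n) * Cmod z ^ n)))
      with (INR (S n) * Cmod h ^ 2 * rho ^ 2 * Cmod z ^ n) by ring.
    replace (INR (S n) * (rho ^ 2 * rho ^ n) * Cmod h ^ 2)
      with (INR (S n) * Cmod h ^ 2 * rho ^ 2 * rho ^ n) by ring.
    apply Rmult_le_compat_l; auto.
    assert (0 <= Cmod h ^ 2) by (apply pow_le; auto).
    repeat apply Rmult_le_pos; auto; lra. }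
  apply Rle_trans with (rho * (INR n ^ 2 * rho ^ n * Cmod h ^ 2) + INR n * rho ^ S n * Cmod h ^ 2).
  + apply Rle_trans with (rho ^ 2 * Cmod ((z + h) * D)%C
      + rho ^ 2 * Cmod (h * h * (RtoC (INR n) * z ^ pred n))%C).
    * rewrite <- Rmult_plus_distr_l. apply Rmult_le_compat_l; [lra|]. apply Cmod_triangle.
    * apply Rplus_le_compat; auto. rewrite Cmod_mult.
      apply Rle_trans with (rho * (rho ^ 2 * Cmod D)).
      { assert (Cmod (z + h)%C * Cmod D <= rho * Cmod D) by nra. nra. }
      apply Rmult_le_compat_l; lra.
  + rewrite S_INR. simpl (rho ^ S n).
    assert (0 <= rho * rho ^ n * Cmod h ^ 2).
    { repeat apply Rmult_le_pos; auto; try lra; apply pow_le; lra. }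
    replace (rho * (INR n ^ 2 * rho ^ n * Cmod h ^ 2) + INR n * (rho * rho ^ n) * Cmod h ^ 2)
      with ((INR n ^ 2 + INR n) * (rho * rho ^ n * Cmod h ^ 2)) by ring.
    replace ((INR n + 1) ^ 2 * (rho * rho ^ n) * Cmod h ^ 2)
      with ((INR n + 1) ^ 2 * (rho * rho ^ n * Cmod h ^ 2)) by ring.
    apply Rmult_le_compat_r; auto. nra.
Qed.

Lemma Cder_power_series (a : nat -> C) (rho : R) (z : C) :
  ex_series (fun n => INR n ^ 2 * Cmod (a n) * rho ^ n) -> Cmod z < rho ->
  Cder (fun w => CSeries (fun n => a n * w ^ n)%C) z
    (CSeries (fun n => a n * (RtoC (INR n) * z ^ pred n))%C).
Proof.
intros Ha Hz. pose proof (Cmod_ge_0 z).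
assert (Hs : forall k : nat, (k <= 2)%nat -> ex_series (fun n => INR n ^ k * Cmod (a n) * rho ^ n)).
{ intros k Hk. apply ex_series_incr_1. apply ex_series_incr_1 in Ha.
  eapply ex_series_comparison; [|exact Ha]. intros n.
  assert (1 <= INR (S n)) by (rewrite S_INR; generalize (pos_INR n); lra).
  rewrite Rabs_pos_eq.
  - apply Rmult_le_compat_r; [apply pow_le; lra|].
    apply Rmult_le_compat_r; [apply Cmod_ge_0|]. now apply Rle_pow.
  - repeat apply Rmult_le_pos; try apply pow_le; try lra. apply Cmod_ge_0. }
assert (Hw : forall w, Cmod w <= rho -> summable (fun n => a n * w ^ n)%C).
{ intros w Hw. eapply summable_le; [|apply (Hs O); lia].
  intros n. rewrite Cmod_mult, Cmod_pow. simpl. rewrite Rmult_1_l.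
  apply Rmult_le_compat_l; [apply Cmod_ge_0|]. apply pow_incr; split; auto using Cmod_ge_0. }
apply (Cder_CSeries (fun n w => a n * w ^ n)%C _ z (rho - Cmod z)
   (fun n => / rho ^ 2 * (INR n ^ 2 * Cmod (a n) * rho ^ n))).
- lra.
- now apply ex_series_scalR.
- intros n h Hh.
  replace (a n * (z + h) ^ n - a n * z ^ n - h * (a n * (INR n * z ^ Init.Nat.pred n)))%C
   with (a n * ((z + h) ^ n - z ^ n - h * (INR n * z ^ Init.Nat.pred n)))%C by ring.
  rewrite Cmod_mult.
  assert (Cmod (z + h)%C <= rho) by (eapply Rle_trans; [apply Cmod_triangle|lra]).
  pose proof (pow_remainder z h rho n ltac:(lra) ltac:(lra) H0).
  apply Rmult_le_compat_l with (r := Cmod (a n)) in H1; [|apply Cmod_ge_0].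
  eapply Rle_trans; [exact H1|]. right. field. lra.
- intros h Hh. apply Hw. eapply Rle_trans; [apply Cmod_triangle|lra].
- eapply summable_le; [|apply (ex_series_scalR (/ rho)), (Hs 1%nat); lia].
  intros n. rewrite !Cmod_mult, Cmod_R, Cmod_pow, Rabs_pos_eq by apply pos_INR.
  destruct n; [simpl; lra|]. cbn [pred].
  replace (/ rho * (INR (S n) ^ 1 * Cmod (a (S n)) * rho ^ S n))
    with (Cmod (a (S n)) * (INR (S n) * rho ^ n)) by (simpl; field; lra).
  apply Rmult_le_compat_l; [apply Cmod_ge_0|].
  apply Rmult_le_compat_l; [apply pos_INR|]. apply pow_incr; split; auto; lra.
Qed.

(** The sum 1 + x + ... + x^(n-1) = (1 - x^n)/(1 - x) has n terms, each at least x^n. *)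
Lemma n_pow_n_le (x : R) (n : nat) : 0 <= x < 1 -> INR n * x ^ n <= / (1 - x).
Proof.
intros Hx.
assert (H : INR n * x ^ n * (1 - x) <= 1 - x ^ n).
{ induction n; [simpl; lra|]. rewrite S_INR. simpl.
  assert (0 <= x ^ n <= 1) by (split; [apply pow_le|rewrite <- (pow1 n); apply pow_incr]; lra).
  assert (x * (INR n * x ^ n * (1 - x)) <= x * (1 - x ^ n)) by (apply Rmult_le_compat_l; lra).
  assert (0 <= (1 - x) * (1 - x * x ^ n)) by (apply Rmult_le_pos; nra).
  nra. }
apply Rmult_le_reg_r with (1 - x); [lra|].
rewrite Rinv_l by lra. assert (0 <= x ^ n) by (apply pow_le; lra). lra.
Qed.

(** Each factor n is absorbed by passing from the ratio r to a larger s < 1: n (r/s)^n stays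
    bounded. *)
Lemma ex_series_pow_geom (k : nat) (r : R) :
  0 <= r < 1 -> ex_series (fun n => INR n ^ k * r ^ n).
Proof.
revert r. induction k as [|k IH]; intros r Hr.
- apply (ex_series_ext (fun n => r ^ n)); [intros; simpl; now rewrite Rmult_1_l|].
  apply ex_series_geom. rewrite Rabs_pos_eq; lra.
- set (s := (1 + r) / 2).
  assert (Hs : 0 < s < 1) by (unfold s; lra).
  assert (Hx : 0 <= r / s < 1).
  { split; [apply Rmult_le_pos; [lra|apply Rlt_le, Rinv_0_lt_compat; lra]|].
    apply Rmult_lt_reg_r with s; [lra|]. unfold Rdiv. rewrite Rmult_assoc, Rinv_l by lra.
    unfold s; lra. }
  eapply ex_series_comparison; [|apply (ex_series_scalR (/ (1 - r / s))), (IH s); lra].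
  intros n. rewrite Rabs_pos_eq.
  2:{ apply Rmult_le_pos; apply pow_le; try lra. apply pos_INR. }
  replace (INR n ^ S k * r ^ n) with ((INR n * (r / s) ^ n) * (INR n ^ k * s ^ n)).
  + apply Rmult_le_compat_r; [apply Rmult_le_pos; apply pow_le; try lra; apply pos_INR|].
    now apply n_pow_n_le.
  + unfold Rdiv. rewrite Rpow_mult_distr, pow_inv. simpl. field. apply pow_nonzero; lra.
Qed.

(** * The complex exponential and logarithm series *)

Lemma Cexp_plus (z w : C) : Cexp (z + w)%C = (Cexp z * Cexp w)%C.
Proof.
unfold Cexp. apply C_ext; simpl; rewrite exp_plus, ?cos_plus, ?sin_plus; unfold Re, Im; ring.
Qed.

Lemma Cexp_0 : Cexp (RtoC 0) = (RtoC 1).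
Proof. unfold Cexp. apply C_ext; simpl; rewrite exp_0, ?cos_0, ?sin_0; ring. Qed.

Lemma Cmod_Cexp (z : C) : Cmod (Cexp z) = exp (Re z).
Proof.
unfold Cexp. rewrite Cmod_mult, Cmod_R, Rabs_pos_eq by (apply Rlt_le, exp_pos).
replace (Cmod (cos (Im z), sin (Im z))) with 1; [ring|].
unfold Cmod; simpl. transitivity (sqrt 1); [now rewrite sqrt_1|]. f_equal.
generalize (sin2_cos2 (Im z)). unfold Rsqr. lra.
Qed.

Lemma Cexp_neq_0 (z : C) : Cexp z <> (RtoC 0).
Proof. apply Cmod_pos_neq. rewrite Cmod_Cexp. apply exp_pos. Qed.

Lemma Cexp_opp (z : C) : Cexp (- z)%C = (/ Cexp z)%C.
Proof.
assert (E : (Cexp (- z) * Cexp z)%C = (RtoC 1)).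
{ rewrite <- Cexp_plus. replace (- z + z)%C with (RtoC 0) by ring. apply Cexp_0. }
rewrite <- (Cmult_1_l (/ Cexp z)), <- E. field. apply Cexp_neq_0.
Qed.

Lemma Cexp_RtoC (x : R) : Cexp (RtoC x) = RtoC (exp x).
Proof. unfold Cexp. apply C_ext; simpl; rewrite ?cos_0, ?sin_0; ring. Qed.

Lemma Cexp_nat (z : C) (n : nat) : (Cexp z ^ n)%C = Cexp (RtoC (INR n) * z)%C.
Proof.
induction n.
- simpl. replace (0 * z)%C with (RtoC 0) by ring. now rewrite Cexp_0.
- rewrite S_INR, RtoC_plus. cbn [Cpow]. rewrite IHn, <- Cexp_plus. f_equal. ring.
Qed.

Lemma Cmod_le_Re_Im (z : C) : Cmod z <= Rabs (Re z) + Rabs (Im z).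
Proof.
replace z with (RtoC (Re z) + RtoC (Im z) * Ci)%C at 1.
- eapply Rle_trans; [apply Cmod_triangle|]. rewrite Cmod_mult, Cmod_Ci, !Cmod_R. lra.
- apply C_ext; simpl; ring.
Qed.

Lemma exp_remainder (a : R) : Rabs a <= 1 / 2 -> 0 <= exp a - 1 - a <= 2 * a ^ 2.
Proof.
intros Ha. apply Rabs_le_between in Ha. split.
- generalize (exp_ineq1_le a). lra.
- generalize (exp_ineq1_le (- a)). rewrite exp_Ropp. intros H.
  assert (H2 : exp a * (1 - a) <= 1).
  { pose proof (exp_pos a). apply Rle_trans with (exp a * / exp a); [|right; field; lra].
    apply Rmult_le_compat_l; lra. }
  assert (exp a <= / (1 - a)).
  { apply Rmult_le_reg_r with (1 - a); [lra|]. rewrite Rinv_l; lra. }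
  assert (/ (1 - a) - 1 - a = a ^ 2 * / (1 - a)) by (field; lra).
  assert (/ (1 - a) <= 2).
  { replace 2 with (/ (1 / 2)) by field. apply Rinv_le_contravar; lra. }
  nra.
Qed.

Lemma Rabs_sin_le (x : R) : Rabs (sin x) <= Rabs x.
Proof.
assert (H : forall y, 0 <= y -> sin y <= y).
{ intros y [Hy| <-]; [left; now apply sin_lt_x|rewrite sin_0; lra]. }
assert (H' : forall y, 0 <= y -> - y <= sin y).
{ intros y Hy. destruct (MVT_gen (fun t => t + sin t) 0 y (fun t => 1 + cos t)) as (c & Hc & E).
  - intros t _. auto_derive; auto. ring.
  - intros t _. apply derivable_continuous_pt. apply derivable_pt_plus;
     [apply derivable_pt_id|apply derivable_pt_sin].
  - rewrite sin_0 in E. generalize (COS_bound c). nra. }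
destruct (Rle_dec 0 x).
- rewrite (Rabs_pos_eq x) by auto. apply Rabs_le. split; auto.
- rewrite <- Rabs_Ropp, <- sin_neg, (Rabs_left x) by lra. apply Rabs_le.
  split; [apply H'|apply H]; lra.
Qed.

Lemma cos_remainder (b : R) : 0 <= 1 - cos b <= b ^ 2 / 2.
Proof.
generalize (COS_bound b); intros Hb. split; [lra|].
replace b with (2 * (b / 2)) at 1 by field. rewrite cos_2a_sin.
generalize (Rabs_sin_le (b / 2)); intros H.
apply Rsqr_le_abs_1 in H. unfold Rsqr in H. lra.
Qed.

Lemma sin_remainder (b : R) : Rabs (sin b - b) <= Rabs b * b ^ 2 / 2.
Proof.
destruct (MVT_gen (fun t => sin t - t) 0 b (fun t => cos t - 1)) as (c & Hc & E).
- intros t _. auto_derive; auto. ring.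
- intros t _. apply derivable_continuous_pt. apply derivable_pt_minus;
   [apply derivable_pt_sin|apply derivable_pt_id].
- rewrite sin_0 in E. replace (sin b - b) with ((cos c - 1) * b) by lra.
  rewrite Rabs_mult. generalize (cos_remainder c); intros Hcc.
  rewrite (Rabs_left1 (cos c - 1)) by lra.
  assert (c ^ 2 <= b ^ 2).
  { rewrite <- !Rsqr_pow2. apply Rsqr_le_abs_1.
    unfold Rmin, Rmax in Hc. destruct (Rle_dec 0 b).
    - rewrite !Rabs_pos_eq; lra.
    - rewrite !Rabs_left1; lra. }
  generalize (Rabs_pos b). nra.
Qed.

Lemma Cexp_remainder (h : C) :
  Cmod h <= 1 / 2 -> Cmod (Cexp h - 1 - h)%C <= 6 * Cmod h ^ 2.
Proof.
intros Hh. pose proof (re_le_Cmod h) as Ha. pose proof (im_le_Cmod h) as Hb.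
pose proof (Cmod_ge_0 h).
eapply Rle_trans; [apply Cmod_le_Re_Im|].
destruct h as [a b]. change (Re (a, b)) with a in *. change (Im (a, b)) with b in *.
set (m := Cmod (a, b)) in *.
assert (Ea : exp a - 1 - a <= 2 * a ^ 2 /\ 0 <= exp a - 1 - a) by (generalize (exp_remainder a); lra).
assert (Ha2 : a ^ 2 <= m ^ 2) by (rewrite <- (pow2_abs a); apply pow_incr; split; auto; apply Rabs_pos).
assert (Hb2 : b ^ 2 <= m ^ 2) by (rewrite <- (pow2_abs b); apply pow_incr; split; auto; apply Rabs_pos).
pose proof (cos_remainder b). pose proof (sin_remainder b). pose proof (Rabs_sin_le b).
assert (Hal : -1/2 <= a <= 1/2) by (apply Rabs_le_between in Ha; lra).
assert (He2 : exp a <= 2) by nra.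
pose proof (exp_pos a).
assert (R1 : Rabs (Re (Cexp (a, b) - 1 - (a, b))%C) <= 3 * m ^ 2).
{ unfold Cexp; simpl.
  replace (exp a * cos b - 0 * sin b + - (1) + - a) with ((exp a - 1 - a) - exp a * (1 - cos b)) by ring.
  apply Rabs_le. nra. }
assert (R2 : Rabs (Im (Cexp (a, b) - 1 - (a, b))%C) <= 3 * m ^ 2).
{ unfold Cexp; simpl.
  replace (exp a * sin b + 0 * cos b + - 0 + - b) with ((exp a - 1) * sin b + (sin b - b)) by ring.
  eapply Rle_trans; [apply Rabs_triang|]. rewrite Rabs_mult.
  assert (Rabs (exp a - 1) <= 2 * Rabs a).
  { replace (exp a - 1) with ((exp a - 1 - a) + a) by ring.
    eapply Rle_trans; [apply Rabs_triang|]. rewrite (Rabs_pos_eq (exp a - 1 - a)) by lra.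
    rewrite <- (pow2_abs a) in Ea. generalize (Rabs_pos a). nra. }
  generalize (Rabs_pos a) (Rabs_pos b) (Rabs_pos (sin b)) (Rabs_pos (exp a - 1)).
  intros.
  assert (Rabs (exp a - 1) * Rabs (sin b) <= 2 * m * m) by nra. nra. }
lra.
Qed.

Lemma Cder_Cexp (z : C) : Cder Cexp z (Cexp z).
Proof.
exists (Cmod (Cexp z) * 6), (1 / 2). repeat split; try lra.
{ pose proof (Cmod_ge_0 (Cexp z)); lra. }
intros h Hh. rewrite Cexp_plus.
replace (Cexp z * Cexp h - Cexp z - h * Cexp z)%C with (Cexp z * (Cexp h - 1 - h))%C by ring.
rewrite Cmod_mult, Rmult_assoc. apply Rmult_le_compat_l; [apply Cmod_ge_0|].
apply Cexp_remainder; lra.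
Qed.

Lemma is_series_exp (x : R) : is_series (fun n => x ^ n / INR (fact n)) (exp x).
Proof.
generalize (is_exp_Reals x). intros H.
eapply is_series_ext; [|exact H]. intros n. simpl.
unfold scal; simpl; unfold mult; simpl. rewrite pow_n_pow. unfold Rdiv. ring.
Qed.

(** As n <= 2^n, the factor n^k is absorbed by enlarging x to 2^k x. *)
Lemma ex_series_exp_poly (k : nat) (x : R) :
  0 <= x -> ex_series (fun n => INR n ^ k * (x ^ n / INR (fact n))).
Proof.
intros Hx.
assert (Hex : forall y, ex_series (fun n => y ^ n / INR (fact n))) by (intros y; eexists; apply is_series_exp).
eapply ex_series_comparison; [|apply (ex_series_scalR (2 ^ k)), (Hex (2 ^ k * x))].
intros n. assert (0 < INR (fact n)) by apply lt_0_INR, lt_O_fact.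
assert (0 <= x ^ n / INR (fact n)).
{ apply Rmult_le_pos; [now apply pow_le|now apply Rlt_le, Rinv_0_lt_compat]. }
rewrite Rabs_pos_eq.
2:{ apply Rmult_le_pos; auto. apply pow_le, pos_INR. }
assert (INR n ^ k <= (2 ^ k) ^ n).
{ rewrite <- pow_mult, Nat.mul_comm, pow_mult. apply pow_incr. split; [apply pos_INR|].
  clear. induction n; [simpl; lra|]. rewrite S_INR. simpl.
  assert (1 <= 2 ^ n) by (apply pow_R1_Rle; lra). lra. }
rewrite Rpow_mult_distr.
assert (1 <= 2 ^ k) by (apply pow_R1_Rle; lra).
assert (0 <= (2 ^ k) ^ n) by (apply pow_le; lra).
replace (2 ^ k * ((2 ^ k) ^ n * x ^ n / INR (fact n))) with (2 ^ k * (2 ^ k) ^ n * (x ^ n / INR (fact n)))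
  by (field; lra).
apply Rmult_le_compat_r; auto. nra.
Qed.

Lemma summable_exp (z : C) : summable (fun n => RtoC (/ INR (fact n)) * z ^ n)%C.
Proof.
eapply summable_le; [|apply (ex_series_exp_poly 0 (Cmod z)), Cmod_ge_0].
intros n. assert (0 < / INR (fact n)) by apply Rinv_0_lt_compat, lt_0_INR, lt_O_fact.
rewrite Cmod_mult, Cmod_R, Cmod_pow, Rabs_pos_eq by lra. unfold Rdiv. simpl. lra.
Qed.

(** [Cexp] is given through exp, cos and sin, so the series needs an argument: its sum [E] satisfies
    E' = E and E(0) = 1, hence Cexp(-z) E(z) has zero derivative and equals 1. *)
Lemma Cexp_series (z : C) : Cexp z = CSeries (fun n => RtoC (/ INR (fact n)) * z ^ n)%C.
Proof.
set (E := fun w => CSeries (fun n => RtoC (/ INR (fact n)) * w ^ n)%C).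
assert (HE : forall w, Cder E w (E w)).
{ intros w. eapply Cder_eq.
  - apply (Cder_power_series (fun n => RtoC (/ INR (fact n))) (Cmod w + 1)); [|lra].
    eapply ex_series_ext; [|apply (ex_series_exp_poly 2 (Cmod w + 1))].
    + intros n. assert (0 < / INR (fact n)) by apply Rinv_0_lt_compat, lt_0_INR, lt_O_fact.
      cbn beta. rewrite Cmod_R, Rabs_pos_eq by lra. unfold Rdiv.
      match goal with |- @eq _ ?a ?b => change (@eq R a b) end. ring.
    + pose proof (Cmod_ge_0 w); lra.
  - match goal with |- CSeries ?a = _ => assert (Hs : summable a) end.
    { apply summable_incr_1. eapply summable_ext; [|apply (summable_exp w)].
      intros n. cbn beta. cbn [pred]. rewrite fact_simpl, mult_INR.
      rewrite Cmult_assoc, <- RtoC_mult. f_equal. f_equal.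
      field. split; [apply INR_fact_neq_0|apply not_0_INR; lia]. }
    rewrite CSeries_incr_1 by auto. cbn [pred]. change (INR 0) with 0.
    replace (RtoC (/ INR (fact 0)) * (RtoC 0 * w ^ 0))%C with (RtoC 0) by ring. rewrite Cplus_0_l.
    apply CSeries_ext. intros n. rewrite fact_simpl, mult_INR.
    rewrite Cmult_assoc, <- RtoC_mult. f_equal. f_equal.
    field. split; [apply INR_fact_neq_0|apply not_0_INR; lia]. }
assert (HG : (Cexp (- z) * E z)%C = (Cexp (- 0) * E 0)%C).
{ apply (Cder_0_const (fun _ => True) (fun w => Cexp (- w) * E w)%C); auto.
  intros w _. eapply Cder_eq.
  - apply Cder_mult; [|apply HE].
    apply (Cder_comp Cexp (fun w => - w)%C); [|apply Cder_Cexp].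
    apply Cder_opp, Cder_id.
  - cbn beta. ring. }
assert (E0 : E (RtoC 0) = (RtoC 1)).
{ unfold E. rewrite CSeries_incr_1 by apply summable_exp.
  rewrite (CSeries_ext _ (fun _ => (RtoC 0))).
  - rewrite CSeries_0. simpl. rewrite Rinv_1. ring.
  - intros n. cbn [Cpow]. ring. }
rewrite E0, Cexp_opp in HG.
replace (- 0)%C with (RtoC 0) in HG by ring. rewrite Cexp_0 in HG.
change (Cexp z = E z).
assert (H : E z = (Cexp z * (/ Cexp z * E z))%C) by (field; apply Cexp_neq_0).
rewrite H, HG. ring.
Qed.

Lemma summable_geom (w : C) : Cmod w < 1 -> summable (fun n => w ^ n)%C.
Proof.
intros Hw. eapply ex_series_ext; [|apply (ex_series_geom (Cmod w))].
- intros n; cbn beta. now rewrite Cmod_pow.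
- rewrite Rabs_pos_eq; auto using Cmod_ge_0.
Qed.

Lemma one_minus_neq_0 (w : C) : Cmod w < 1 -> (1 - w)%C <> (RtoC 0).
Proof.
intros Hw E. assert (w = (RtoC 1)) by (replace w with (1 - (1 - w))%C by ring; rewrite E; ring).
subst. rewrite Cmod_1 in Hw. lra.
Qed.

Lemma CSeries_geom (w : C) : Cmod w < 1 -> CSeries (fun n => w ^ n)%C = (/ (1 - w))%C.
Proof.
intros Hw. pose proof (summable_geom w Hw) as Hs. pose proof (one_minus_neq_0 w Hw).
pose proof (CSeries_incr_1 _ Hs) as E. cbn [Cpow] in E.
rewrite CSeries_scal in E by auto.
set (G := CSeries (fun n => w ^ n)%C) in *.
assert (E2 : ((1 - w) * G)%C = (RtoC 1)).
{ replace ((1 - w) * G)%C with (G - w * G)%C by ring. rewrite E at 1. ring. }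
assert (E3 : G = (/ (1 - w) * ((1 - w) * G))%C) by (field; auto).
rewrite E3, E2. ring.
Qed.

(* The term of index 0 vanishes because / 0 = 0. *)
Definition mlog1m (w : C) : C := CSeries (fun n => RtoC (/ INR n) * w ^ n)%C.

Lemma Cmod_inv_INR (n : nat) : Cmod (RtoC (/ INR n)) = / INR n /\ 0 <= / INR n <= 1.
Proof.
assert (0 <= / INR n <= 1).
{ destruct n; [simpl; rewrite Rinv_0; lra|].
  assert (1 <= INR (S n)) by (rewrite S_INR; generalize (pos_INR n); lra).
  split; [apply Rlt_le, Rinv_0_lt_compat; lra|].
  rewrite <- Rinv_1. apply Rinv_le_contravar; lra. }
split; auto. rewrite Cmod_R. apply Rabs_pos_eq; lra.
Qed.

Lemma summable_mlog1m (w : C) : Cmod w < 1 -> summable (fun n => RtoC (/ INR n) * w ^ n)%C.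
Proof.
intros Hw. eapply summable_le; [|apply (summable_geom w Hw)].
intros n. destruct (Cmod_inv_INR n) as [E H]. rewrite Cmod_mult, E.
pose proof (Cmod_ge_0 (w ^ n)%C). nra.
Qed.

Lemma Cder_mlog1m (w : C) : Cmod w < 1 -> Cder mlog1m w (/ (1 - w))%C.
Proof.
intros Hw. pose proof (Cmod_ge_0 w). eapply Cder_eq.
- apply (Cder_power_series _ ((1 + Cmod w) / 2)); [|lra].
  eapply ex_series_comparison; [|apply (ex_series_pow_geom 2 ((1 + Cmod w) / 2)); lra].
  intros n. destruct (Cmod_inv_INR n) as [E H1]. rewrite E.
  assert (0 <= INR n ^ 2) by apply pow_le, pos_INR.
  assert (0 <= ((1 + Cmod w) / 2) ^ n) by (apply pow_le; lra).
  rewrite Rabs_pos_eq by (apply Rmult_le_pos; [apply Rmult_le_pos|]; lra).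
  apply Rmult_le_compat_r; auto.
  rewrite <- (Rmult_1_r (INR n ^ 2)) at 2. apply Rmult_le_compat_l; lra.
- match goal with |- CSeries ?a = _ => assert (Hs : summable a) end.
  { apply summable_incr_1. eapply summable_ext; [|apply (summable_geom w Hw)].
    intros n. cbn beta. cbn [pred]. rewrite Cmult_assoc, <- RtoC_mult, Rinv_l, Cmult_1_l; auto.
    apply not_0_INR; lia. }
  rewrite CSeries_incr_1, <- CSeries_geom by auto. cbn [pred]. change (INR 0) with 0.
  replace (RtoC (/ 0) * (RtoC 0 * w ^ 0))%C with (RtoC 0) by ring. rewrite Cplus_0_l.
  apply CSeries_ext. intros n. rewrite Cmult_assoc, <- RtoC_mult, Rinv_l, Cmult_1_l; auto.
  apply not_0_INR; lia.
Qed.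

Lemma mlog1m_0 : mlog1m (RtoC 0) = (RtoC 0).
Proof.
unfold mlog1m. rewrite (CSeries_ext _ (fun _ => (RtoC 0))); [apply CSeries_0|].
intros [|n]; simpl; rewrite ?Rinv_0; ring.
Qed.

Lemma Cmod_convex_lt (r : R) (a b : C) (t : R) :
  Cmod a < r -> Cmod b < r -> 0 <= t <= 1 -> Cmod (a + RtoC t * (b - a))%C < r.
Proof.
intros Ha Hb Ht.
replace (a + RtoC t * (b - a))%C with (RtoC (1 - t) * a + RtoC t * b)%C
  by (rewrite RtoC_minus; ring).
eapply Rle_lt_trans; [apply Cmod_triangle|].
rewrite !Cmod_mult, !Cmod_R, !Rabs_pos_eq by lra.
destruct (Rle_dec t (1 / 2)); [|]; nra.
Qed.

(** Identifies [mlog1m w] as -log(1 - w) without choosing a branch: the product of 1 - w and Cexp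
    (mlog1m w) has zero derivative on the unit disc. *)
Lemma Cexp_mlog1m (w : C) : Cmod w < 1 -> Cexp (- mlog1m w)%C = (1 - w)%C.
Proof.
intros Hw.
assert (H : ((1 - w) * Cexp (mlog1m w))%C = ((1 - 0) * Cexp (mlog1m 0))%C).
{ apply (Cder_0_const (fun z => Cmod z < 1) (fun w => (1 - w) * Cexp (mlog1m w))%C).
  - intros. now apply Cmod_convex_lt.
  - intros z Hz. eapply Cder_eq.
    + apply Cder_mult.
      * apply Cder_minus; [apply Cder_const|apply Cder_id].
      * apply (Cder_comp Cexp mlog1m); [now apply Cder_mlog1m|apply Cder_Cexp].
    + cbn beta. field. now apply one_minus_neq_0.
  - auto.
  - rewrite Cmod_0; lra. }
rewrite mlog1m_0, Cexp_0 in H. rewrite Cexp_opp.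
replace (/ Cexp (mlog1m w))%C with ((1 - 0) * 1 / Cexp (mlog1m w))%C by (field; apply Cexp_neq_0).
rewrite <- H. field. apply Cexp_neq_0.
Qed.

(** * Lattice sums over the integers *)

Lemma ex_series_inv_sq : ex_series (fun n => / INR (S n) ^ 2).
Proof.
apply (ex_series_bounded _ 2).
- intros n. apply Rlt_le, Rinv_0_lt_compat, pow_lt, lt_0_INR; lia.
- intros n. enough (sum_n (fun k => / INR (S k) ^ 2) n <= 2 - / INR (S n)).
  { assert (0 < / INR (S n)) by (apply Rinv_0_lt_compat, lt_0_INR; lia). lra. }
  induction n.
  + rewrite sum_O. simpl. lra.
  + rewrite sum_Sn.
    assert (P : forall a b : R, plus a b = a + b) by reflexivity. rewrite P.
    assert (0 < INR (S n)) by (apply lt_0_INR; lia).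
    rewrite (S_INR (S n)). set (x := INR (S n)) in *.
    assert (/ (x + 1) ^ 2 <= / x - / (x + 1)); [|lra].
    replace (/ x - / (x + 1)) with (/ (x * (x + 1))) by (field; lra).
    apply Rinv_le_contravar; nra.
Qed.

Lemma Im_le_Cmod_add (tau : C) (r : R) : 0 < Im tau -> Im tau <= Cmod (tau + RtoC r)%C.
Proof.
intros H. eapply Rle_trans; [|apply im_le_Cmod]. destruct tau as [x y]; simpl in *.
rewrite Rplus_0_r. apply Rle_abs.
Qed.

(** Satisfied by both halves of Z, the shifts n and -(n+1) for n >= 0, so that lattice sums are
    treated once for the two halves. *)
Definition spread (r : nat -> R) : Prop := forall n, INR n <= Rabs (r n).

Lemma spread_pos : spread INR.
Proof. intros n. apply Rle_abs. Qed.

Lemma spread_neg : spread (fun n => - INR (S n)).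
Proof. intros n. rewrite Rabs_Ropp, S_INR, Rabs_pos_eq; generalize (pos_INR n); lra. Qed.

Lemma upper_neq_0 (tau : C) (r : R) : 0 < Im tau -> (tau + RtoC r)%C <> 0%C.
Proof. intros H. apply Cmod_pos_neq. generalize (Im_le_Cmod_add tau r H). lra. Qed.

(** After scaling out x, put s = r/x. Then |tau + s| is at least Im tau and at least |s| - |tau|; a
    combination of the two bounds controls 1 + |s|. *)
Lemma lattice_lower_bound (tau : C) : 0 < Im tau ->
  exists B, 0 < B /\ forall x r : R, 0 < x ->
    x + Rabs r <= B * Cmod (RtoC x * tau + RtoC r)%C.
Proof.
intros Ht. pose proof (Cmod_ge_0 tau).
exists ((1 + Cmod tau + Im tau) / Im tau).
split; [apply Rdiv_lt_0_compat; lra|].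
intros x r Hx.
replace (RtoC x * tau + RtoC r)%C with (RtoC x * (tau + RtoC (r / x)))%C.
2:{ rewrite Cmult_plus_distr_l, <- RtoC_mult. do 2 f_equal. field. lra. }
rewrite Cmod_mult, Cmod_R, (Rabs_pos_eq x) by lra.
replace (x + Rabs r) with (x * (1 + Rabs (r / x))).
2:{ unfold Rdiv. rewrite Rabs_mult, Rabs_inv, (Rabs_pos_eq x) by lra. field. lra. }
set (s := r / x).
assert (H1 : Im tau <= Cmod (tau + RtoC s)%C) by now apply Im_le_Cmod_add.
assert (H2 : Rabs s - Cmod tau <= Cmod (tau + RtoC s)%C).
{ generalize (Cmod_triangle_rev (RtoC s) tau). now rewrite Cmod_R, Cplus_comm. }
set (m := Cmod (tau + RtoC s)%C) in *.
replace ((1 + Cmod tau + Im tau) / Im tau * (x * m)) with (x * ((1 + Cmod tau) * (m / Im tau) + m)) by (field; lra).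
apply Rmult_le_compat_l; [lra|].
assert (1 <= m / Im tau).
{ apply Rmult_le_reg_r with (Im tau); [lra|]. unfold Rdiv. rewrite Rmult_assoc, Rinv_l; lra. }
nra.
Qed.

Lemma shift_lower_bound (r : nat -> R) (tau : C) : spread r -> 0 < Im tau ->
  exists B, 0 < B /\ forall n, / Cmod (tau + RtoC (r n))%C <= B * / INR (S n).
Proof.
intros Hr Ht. destruct (lattice_lower_bound tau Ht) as (B & HB & H).
exists B. split; auto. intros n. specialize (H 1 (r n) Rlt_0_1). rewrite Cmult_1_l in H.
specialize (Hr n). pose proof (Im_le_Cmod_add tau (r n) Ht). rewrite S_INR. pose proof (pos_INR n).
set (m := Cmod (tau + RtoC (r n))%C) in *.
apply Rmult_le_reg_r with (m * (INR n + 1)); [nra|].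
replace (/ m * (m * (INR n + 1))) with (INR n + 1) by (field; lra).
replace (B * / (INR n + 1) * (m * (INR n + 1))) with (B * m) by (field; lra). lra.
Qed.

Definition shift_sum (r : nat -> R) (k : nat) (tau : C) : C :=
  CSeries (fun n => / (tau + RtoC (r n)) ^ k)%C.

Lemma ex_series_shift (r : nat -> R) (k : nat) (tau : C) : spread r -> 0 < Im tau ->
  (2 <= k)%nat -> ex_series (fun n => (/ Cmod (tau + RtoC (r n))%C) ^ k).
Proof.
intros Hr Ht Hk. destruct (shift_lower_bound r tau Hr Ht) as (B & HB & H).
eapply ex_series_comparison; [|apply (ex_series_scalR (B ^ k)), ex_series_inv_sq].
intros n. pose proof (Im_le_Cmod_add tau (r n) Ht).
assert (0 < / Cmod (tau + RtoC (r n))%C) by (apply Rinv_0_lt_compat; lra).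
rewrite Rabs_pos_eq by (apply pow_le; lra).
apply Rle_trans with ((B * / INR (S n)) ^ k).
- apply pow_incr. split; [lra|auto].
- rewrite Rpow_mult_distr. apply Rmult_le_compat_l; [apply pow_le; lra|].
  rewrite pow_inv. apply Rinv_le_contravar; [apply pow_lt, lt_0_INR; lia|].
  apply Rle_pow; auto. rewrite S_INR. generalize (pos_INR n); lra.
Qed.

Lemma Cmod_inv_pow (z : C) (k : nat) : z <> 0%C -> Cmod (/ z ^ k)%C = (/ Cmod z) ^ k.
Proof. intros. rewrite Cmod_inv, Cmod_pow, pow_inv; auto using Cpow_nz. Qed.

Lemma summable_shift (r : nat -> R) (k : nat) (tau : C) : spread r -> 0 < Im tau ->
  (2 <= k)%nat -> summable (fun n => / (tau + RtoC (r n)) ^ k)%C.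
Proof.
intros Hr Ht Hk. eapply ex_series_ext; [|now apply (ex_series_shift r k tau)].
intros n. cbn beta. now rewrite Cmod_inv_pow by now apply upper_neq_0.
Qed.

(** Meant for u = 1/z and v = 1/(z+h), of which only the relation v - u = - h u v is used. The
    induction is thereby free of divisions. *)
Lemma inv_pow_remainder (k : nat) : exists K, 0 <= K /\ forall u v h : C,
  (v - u = - (h * u * v))%C -> Cmod v <= 2 * Cmod u ->
  Cmod (v ^ k - u ^ k - h * - (RtoC (INR k) * u ^ S k))%C <= K * Cmod u ^ (k + 2) * Cmod h ^ 2.
Proof.
induction k as [|k (K & HK & IH)].
- exists 0. split; [lra|]. intros u v h _ _. simpl.
  replace (1 - 1 - h * - (0 * (u * 1)))%C with (RtoC 0) by ring. rewrite Cmod_0. lra.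
- exists (2 * K + 2 + 2 * INR k). pose proof (pos_INR k). split; [lra|].
  intros u v h E Hv.
  specialize (IH u v h E Hv).
  set (D := (v ^ k - u ^ k - h * - (RtoC (INR k) * u ^ S k))%C) in *.
  assert (E2 : (v ^ S k - u ^ S k - h * - (RtoC (INR (S k)) * u ^ S (S k)))%C
    = (v * D + (RtoC (1 + INR k)) * (h * h * u ^ (k + 2) * v))%C).
  { assert (Hv' : v = (u - h * u * v)%C) by (replace v with (u + (v - u))%C at 1 by ring; rewrite E; ring).
    unfold D. rewrite S_INR, !RtoC_plus. replace (k + 2)%nat with (S (S k)) by lia. cbn [Cpow].
    (* Two multiples of (u - h u v) - v = 0 are inserted, after which both sides are equal as
       polynomials. *)
    transitivity (v * v ^ k - u * u ^ k + h * (RtoC (INR k) + 1) * u * u * u ^ k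
      + u ^ k * ((u - h * u * v) - v) - (RtoC (INR k) + 1) * h * u * u ^ k * ((u - h * u * v) - v))%C.
    - rewrite <- Hv'. ring.
    - ring. }
  rewrite E2. pose proof (Cmod_ge_0 u). pose proof (Cmod_ge_0 h). pose proof (Cmod_ge_0 v).
  assert (P : 0 <= Cmod u ^ (k + 2)) by now apply pow_le.
  eapply Rle_trans; [apply Cmod_triangle|]. rewrite !Cmod_mult, Cmod_R, Cmod_pow.
  rewrite Rabs_pos_eq by lra.
  replace (S k + 2)%nat with (S (k + 2)) by lia. simpl (Cmod u ^ S (k + 2)).
  set (U := Cmod u ^ (k + 2)) in *.
  apply Rle_trans with ((2 * Cmod u) * (K * U * Cmod h ^ 2)
     + (1 + INR k) * (Cmod h * Cmod h * U * (2 * Cmod u))).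
  + apply Rplus_le_compat.
    * apply Rmult_le_compat; auto using Cmod_ge_0.
    * apply Rmult_le_compat_l; [lra|]. apply Rmult_le_compat_l; auto.
      repeat apply Rmult_le_pos; auto.
  + right. ring.
Qed.

Lemma shift_inv_diff (tau h : C) (r : R) : Cmod h <= Im tau / 2 -> 0 < Im tau ->
  (tau + h + RtoC r)%C <> 0%C /\
  Cmod (/ (tau + h + RtoC r))%C <= 2 * Cmod (/ (tau + RtoC r))%C /\
  (/ (tau + h + RtoC r) - / (tau + RtoC r) =
   - (h * / (tau + RtoC r) * / (tau + h + RtoC r)))%C.
Proof.
intros Hh Ht. pose proof (Im_le_Cmod_add tau r Ht) as H1.
pose proof (upper_neq_0 tau r Ht) as H2.
pose proof (Cmod_triangle_rev (tau + RtoC r) h) as H3.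
replace (tau + RtoC r + h)%C with (tau + h + RtoC r)%C in H3 by ring.
assert (H4 : (tau + h + RtoC r)%C <> 0%C) by (apply Cmod_pos_neq; lra).
repeat split; auto.
- rewrite !Cmod_inv by auto. set (m := Cmod (tau + RtoC r)%C) in *.
  replace (2 * / m) with (/ (m / 2)) by (field; lra).
  apply Rinv_le_contravar; lra.
- field. auto.
Qed.

Lemma upper_open (tau h : C) : Cmod h <= Im tau / 2 -> 0 < Im tau -> 0 < Im (tau + h)%C.
Proof.
intros Hh Ht. pose proof (im_le_Cmod h) as H. apply Rabs_le_between in H.
change (Im (tau + h)%C) with (Im tau + Im h). lra.
Qed.

Lemma Cder_shift_sum (r : nat -> R) (k : nat) (tau : C) : spread r -> 0 < Im tau ->
  (2 <= k)%nat ->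
  Cder (shift_sum r k) tau (- (RtoC (INR k) * shift_sum r (S k) tau))%C.
Proof.
intros Hr Ht Hk. destruct (inv_pow_remainder k) as (K & HK & H).
eapply Cder_eq.
- apply (Cder_CSeries (fun n w => / (w + RtoC (r n)) ^ k)%C
   (fun n => - (RtoC (INR k) * / (tau + RtoC (r n)) ^ S k))%C tau (Im tau / 2)
   (fun n => K * (/ Cmod (tau + RtoC (r n))%C) ^ (k + 2))).
  + lra.
  + apply ex_series_scalR, ex_series_shift; auto; lia.
  + intros n h Hh. destruct (shift_inv_diff tau h (r n)) as (h1 & h2 & h3); auto; try lra.
    rewrite <- !Cpow_inv by (auto; now apply upper_neq_0).
    rewrite <- Cmod_inv by now apply upper_neq_0. now apply H.
  + intros h Hh. apply summable_shift; auto. apply upper_open; auto; lra.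
  + apply summable_opp, summable_scal, summable_shift; auto; lia.
- rewrite (CSeries_opp (fun n => RtoC (INR k) * / (tau + RtoC (r n)) ^ S k)%C).
  f_equal. apply CSeries_scal, summable_shift; auto; lia.
Qed.

Definition Zsum (k : nat) (tau : C) : C :=
  (shift_sum INR k tau + shift_sum (fun n => - INR (S n))%R k tau)%C.

Lemma Cder_Zsum (k : nat) (tau : C) : 0 < Im tau -> (2 <= k)%nat ->
  Cder (Zsum k) tau (- (RtoC (INR k) * Zsum (S k) tau))%C.
Proof.
intros Ht Hk. eapply Cder_eq.
- apply Cder_plus; apply Cder_shift_sum; auto using spread_pos, spread_neg.
- unfold Zsum. ring.
Qed.

Lemma Im_RtoC_plus (tau : C) (r : R) : Im (tau + RtoC r)%C = Im tau.
Proof. destruct tau; simpl. ring. Qed.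

(** The translation moves one term, 1/tau^k, from one half of the sum to the other. *)
Lemma Zsum_periodic (k : nat) (tau : C) : 0 < Im tau -> (2 <= k)%nat ->
  Zsum k (tau + 1)%C = Zsum k tau.
Proof.
intros Ht Hk. unfold Zsum, shift_sum.
rewrite (CSeries_incr_1 (fun n => / (tau + RtoC (INR n)) ^ k)%C)
  by now apply summable_shift, Hk; auto using spread_pos.
rewrite (CSeries_incr_1 (fun n => / (tau + 1 + RtoC (- INR (S n))) ^ k)%C).
2:{ apply summable_shift; auto using spread_neg. now rewrite Im_RtoC_plus. }
rewrite (CSeries_ext (fun n => / (tau + RtoC (INR (S n))) ^ k)%C
  (fun n => / (tau + 1 + RtoC (INR n)) ^ k)%C).
2:{ intros n. rewrite S_INR, RtoC_plus. do 2 f_equal. ring. }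
rewrite (CSeries_ext (fun n => / (tau + 1 + RtoC (- INR (S (S n)))) ^ k)%C
  (fun n => / (tau + RtoC (- INR (S n))) ^ k)%C).
2:{ intros n. do 2 f_equal. rewrite (S_INR (S n)), !RtoC_opp, RtoC_plus. ring. }
replace (tau + 1 + RtoC (- INR 1))%C with (tau + RtoC (INR 0))%C.
2:{ simpl. rewrite RtoC_opp. ring. }
ring.
Qed.

Lemma RtoC_2_neq_0 : RtoC 2 <> 0%C.
Proof. intros E. apply RtoC_inj in E. lra. Qed.

Lemma CSeries_duplicate (f : nat -> C) (g1 g2 : nat -> C) : summable f ->
  (forall n, g1 n = (4 * f (2 * n)%nat)%C) -> (forall n, g2 n = (4 * f (2 * n + 1)%nat)%C) ->
  (CSeries g1 + CSeries g2)%C = (4 * CSeries f)%C.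
Proof.
intros Hf H1 H2. rewrite (CSeries_ext _ _ H1), (CSeries_ext _ _ H2).
rewrite !CSeries_scal, (CSeries_even_odd f); auto; [ring| |];
  apply summable_subseq; auto; intros; lia.
Qed.

Lemma Im_half (tau : C) : Im (tau / 2)%C = Im tau / 2.
Proof. destruct tau; simpl. field. Qed.

(** Since (tau/2 + n)^-2 = 4 (tau + 2n)^-2, the argument tau/2 produces the even integers and
    (tau+1)/2 the odd ones. *)
Lemma Zsum2_duplicate (tau : C) : 0 < Im tau ->
  (Zsum 2 (tau / 2) + Zsum 2 ((tau + 1) / 2))%C = (4 * Zsum 2 tau)%C.
Proof.
intros Ht. pose proof RtoC_2_neq_0.
assert (Hh : 0 < Im (tau / 2)%C) by (rewrite Im_half; lra).
assert (Hh' : 0 < Im ((tau + 1) / 2)%C) by (rewrite Im_half, Im_RtoC_plus; lra).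
assert (HA : (shift_sum INR 2 (tau / 2) + shift_sum INR 2 ((tau + 1) / 2))%C
   = (4 * shift_sum INR 2 tau)%C).
{ apply CSeries_duplicate.
  - apply summable_shift; auto using spread_pos.
  - intros n. rewrite mult_INR, RtoC_mult. change (INR 2) with 2.
    assert (H1 := upper_neq_0 _ (INR n) Hh). assert (H2 := upper_neq_0 _ (2 * INR n) Ht).
    rewrite RtoC_mult in H2.
    replace (tau / 2 + INR n)%C with ((tau + 2 * INR n) / 2)%C by (field; auto).
    simpl. field. auto.
  - intros n. rewrite plus_INR, mult_INR. change (INR 2) with 2. change (INR 1) with 1.
    assert (H2 := upper_neq_0 _ (2 * INR n + 1) Ht).
    rewrite RtoC_plus, RtoC_mult in *.
    replace ((tau + 1) / 2 + INR n)%C with ((tau + (2 * INR n + 1)) / 2)%C by (field; auto).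
    simpl. field. auto. }
(* On the negative half the even indices carry the odd integers -(2n+1), so the two arguments appear
   in the opposite order. *)
assert (HB : (shift_sum (fun n => - INR (S n))%R 2 ((tau + 1) / 2)
   + shift_sum (fun n => - INR (S n))%R 2 (tau / 2))%C
   = (4 * shift_sum (fun n => - INR (S n))%R 2 tau)%C).
{ apply CSeries_duplicate.
  - apply summable_shift; auto using spread_neg.
  - intros n. rewrite !S_INR, mult_INR. change (INR 2) with 2.
    assert (H2 := upper_neq_0 _ (- (2 * INR n + 1)) Ht).
    rewrite !RtoC_opp, !RtoC_plus, RtoC_mult in *.
    replace ((tau + 1) / 2 + - (INR n + 1))%C with ((tau + - (2 * INR n + 1)) / 2)%C by (field; auto).
    simpl. field. auto.
  - intros n. rewrite !S_INR, plus_INR, mult_INR. change (INR 2) with 2. change (INR 1) with 1.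
    assert (H2 := upper_neq_0 _ (- (2 * INR n + 1 + 1)) Ht).
    rewrite !RtoC_opp, !RtoC_plus, RtoC_mult in *.
    replace (tau / 2 + - (INR n + 1))%C with ((tau + - (2 * INR n + 1 + 1)) / 2)%C by (field; auto).
    simpl. field. auto. }
unfold Zsum.
transitivity ((shift_sum INR 2 (tau / 2) + shift_sum INR 2 ((tau + 1) / 2))
 + (shift_sum (fun n => - INR (S n))%R 2 ((tau + 1) / 2) + shift_sum (fun n => - INR (S n))%R 2 (tau / 2)))%C.
- ring.
- rewrite HA, HB. ring.
Qed.

(** * The nome and the partial fractions of pi^2 / sin^2 *)

Lemma Cmod_nome (tau : C) : Cmod (nome tau) = exp (- (2 * PI * Im tau)).
Proof.
unfold nome. rewrite Cmod_Cexp. f_equal. destruct tau; simpl. ring.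
Qed.

Lemma Cmod_nome_lt_1 (tau : C) : 0 < Im tau -> 0 < Cmod (nome tau) < 1.
Proof.
intros H. rewrite Cmod_nome. split; [apply exp_pos|].
rewrite <- exp_0. apply exp_increasing. generalize PI_RGT_0. nra.
Qed.

Lemma nome_plus (a b : C) : nome (a + b)%C = (nome a * nome b)%C.
Proof. unfold nome. rewrite <- Cexp_plus. f_equal. ring. Qed.

Lemma nome_1 : nome 1%C = 1%C.
Proof.
unfold nome, Cexp. apply C_ext; simpl.
- replace (2 * PI * 0 - 0 * 1) with 0 by ring. replace ((2 * PI * 0 - 0 * 1) * 0) with 0 by ring.
  match goal with |- exp ?a * cos ?b - 0 * sin _ = 1 => replace a with 0 by ring; replace b with (2 * PI) by ring end.
  rewrite exp_0, cos_2PI. ring.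
- match goal with |- exp ?a * sin ?b + _ = 0 => replace b with (2 * PI) by ring end.
  rewrite sin_2PI. ring.
Qed.

Lemma nome_half : nome (/ 2)%C = (- (1))%C.
Proof.
unfold nome, Cexp. apply C_ext; simpl.
- match goal with |- exp ?a * cos ?b - 0 * sin _ = _ => replace a with 0 by field; replace b with PI by field end.
  rewrite exp_0, cos_PI. ring.
- match goal with |- exp ?a * sin ?b + _ = _ => replace b with PI by field end.
  rewrite sin_PI. ring.
Qed.

Lemma exp_le (x y : R) : x <= y -> exp x <= exp y.
Proof. intros [H| ->]; [left; now apply exp_increasing|apply Rle_refl]. Qed.

Definition inv_sq_total : R := Series (fun n => / INR (S n) ^ 2).

Lemma inv_sq_total_pos : 0 <= inv_sq_total.
Proof.
apply Series_nonneg. intros n. apply Rlt_le, Rinv_0_lt_compat, pow_lt, lt_0_INR; lia.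
Qed.

Lemma shift_lower_bound_strip (tau : C) (n : nat) (s : R) : Rabs (Re tau) <= 1 / 2 ->
  Rabs s = INR (S n) -> INR (S n) / 2 <= Cmod (tau + RtoC s)%C.
Proof.
intros Hx Hs. eapply Rle_trans; [|apply re_le_Cmod].
destruct tau as [x y]. unfold Re in *; simpl fst in *.
assert (1 <= INR (S n)) by (rewrite S_INR; generalize (pos_INR n); lra).
generalize (Rabs_triang_inv s (- x)). rewrite Rabs_Ropp.
replace (s - - x) with (x + s) by ring. lra.
Qed.

Lemma Cmod_shift_tail (k : nat) (tau : C) (s : nat -> R) :
  (2 <= k)%nat -> Rabs (Re tau) <= 1 / 2 ->
  (forall n, Rabs (s n) = INR (S n)) ->
  Cmod (CSeries (fun n => / (tau + RtoC (s n)) ^ k)%C) <= 2 ^ k * inv_sq_total.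
Proof.
intros Hk Hx Hs. unfold inv_sq_total. rewrite <- Series_scal_l.
apply Cmod_CSeries_le; [|apply ex_series_scalR, ex_series_inv_sq].
intros n. pose proof (shift_lower_bound_strip tau n (s n) Hx (Hs n)) as H.
assert (1 <= INR (S n)) by (rewrite S_INR; generalize (pos_INR n); lra).
assert (Hm : 0 < Cmod (tau + RtoC (s n))%C) by lra.
rewrite Cmod_inv_pow by now apply Cmod_pos_neq.
apply Rle_trans with ((2 * / INR (S n)) ^ k).
- apply pow_incr. split; [now apply Rlt_le, Rinv_0_lt_compat|].
  replace (2 * / INR (S n)) with (/ (INR (S n) / 2)) by (field; lra).
  apply Rinv_le_contravar; lra.
- rewrite Rpow_mult_distr, pow_inv. apply Rmult_le_compat_l; [apply pow_le; lra|].
  apply Rinv_le_contravar; [apply pow_lt; lra|]. now apply Rle_pow.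
Qed.

Lemma Zsum_near_pole (k : nat) (tau : C) : (2 <= k)%nat -> 0 < Im tau -> Rabs (Re tau) <= 1 / 2 ->
  Cmod (Zsum k tau - / tau ^ k)%C <= 2 * 2 ^ k * inv_sq_total.
Proof.
intros Hk Ht Hx. unfold Zsum, shift_sum at 1.
rewrite (CSeries_incr_1 (fun n => / (tau + RtoC (INR n)) ^ k)%C)
  by (apply summable_shift; auto using spread_pos).
change (INR 0) with 0. replace (tau + 0)%C with tau by ring.
match goal with |- Cmod (?A + ?B + ?D - ?A)%C <= _ =>
  replace (A + B + D - A)%C with (B + D)%C by ring end.
eapply Rle_trans; [apply Cmod_triangle|].
replace (2 * 2 ^ k * inv_sq_total) with (2 ^ k * inv_sq_total + 2 ^ k * inv_sq_total) by ring.
apply Rplus_le_compat.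
- apply (Cmod_shift_tail k tau (fun n => INR (S n))); auto.
  intros n. apply Rabs_pos_eq, pos_INR.
- apply (Cmod_shift_tail k tau (fun n => - INR (S n))); auto.
  intros n. rewrite Rabs_Ropp. apply Rabs_pos_eq, pos_INR.
Qed.

Lemma Cexp_remainder_4 (w : C) :
  Cmod (Cexp w - (1 + w + w ^ 2 / 2 + w ^ 3 / 6))%C <= Cmod w ^ 4 * exp (Cmod w).
Proof.
rewrite Cexp_series, (CSeries_psum _ 4) by apply summable_exp. cbn [psum Cpow].
match goal with |- Cmod (?P + ?T - _)%C <= _ =>
  replace (P + T - (1 + w + w * (w * 1) / 2 + w * (w * (w * 1)) / 6))%C with T end.
2:{ simpl fact. change (INR 1) with 1. replace (INR 2) with 2 by (simpl; ring).
  replace (INR 6) with 6 by (simpl; ring). rewrite !RtoC_inv by lra.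
  field. }
rewrite <- (is_series_unique _ _ (is_series_exp (Cmod w))), <- Series_scal_l.
pose proof (Cmod_ge_0 w).
apply Cmod_CSeries_le.
2:{ apply ex_series_scalR. eexists; apply is_series_exp. }
intros n. rewrite Cmod_mult, Cmod_pow, Cmod_R, Rabs_pos_eq.
2:{ apply Rlt_le, Rinv_0_lt_compat, lt_0_INR, lt_O_fact. }
rewrite pow_add. unfold Rdiv.
assert (/ INR (fact (4 + n)) <= / INR (fact n)).
{ apply Rinv_le_contravar; [apply lt_0_INR, lt_O_fact|]. apply le_INR, fact_le. lia. }
assert (0 <= Cmod w ^ 4 * Cmod w ^ n) by (apply Rmult_le_pos; now apply pow_le).
nra.
Qed.

(** The odd terms cancel, which leaves an error of order w^4. The combination matters because (e^w -
    1)^2 / e^w = e^w - 2 + e^-w. *)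
Lemma Cexp_cosh_remainder (w : C) :
  Cmod (Cexp w - 2 + Cexp (- w) - w ^ 2)%C <= 2 * (Cmod w ^ 4 * exp (Cmod w)).
Proof.
pose proof (Cexp_remainder_4 w) as H1. pose proof (Cexp_remainder_4 (- w)) as H2.
rewrite Cmod_opp in H2.
replace (Cexp w - 2 + Cexp (- w) - w ^ 2)%C with
 ((Cexp w - (1 + w + w ^ 2 / 2 + w ^ 3 / 6)) +
  (Cexp (- w) - (1 + - w + (- w) ^ 2 / 2 + (- w) ^ 3 / 6)))%C.
- eapply Rle_trans; [apply Cmod_triangle|]. lra.
- simpl. field.
Qed.

(** For 0 <= x <= pi/2 write sin x = 2 sin(x/2) cos(x/2). Both sin(x/2) / (x/2) and cos(x/2) are at
    least cos(pi/4), whose square is 1/2. *)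
Lemma sin_lower (x : R) : Rabs x <= PI / 2 -> Rabs x / 2 <= Rabs (sin x).
Proof.
assert (H : forall x, 0 <= x <= PI / 2 -> x / 2 <= sin x).
{ clear x. intros x Hx. pose proof PI_RGT_0.
  assert (E : cos (PI / 4) ^ 2 = / 2).
  { rewrite cos_PI4. unfold Rdiv. rewrite Rmult_1_l, pow_inv.
    f_equal. simpl. rewrite Rmult_1_r. apply sqrt_sqrt. lra. }
  assert (Hs : forall y, 0 <= y <= PI / 4 -> y * cos (PI / 4) <= sin y).
  { intros y Hy. destruct (MVT_gen sin 0 y cos) as (c & Hc & Ec).
    - intros t _. apply is_derive_sin.
    - intros t _. apply derivable_continuous_pt, derivable_pt_sin.
    - rewrite Rmin_left, Rmax_right in Hc by lra. rewrite sin_0 in Ec.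
      assert (cos (PI / 4) <= cos c) by (apply cos_decr_1; lra). nra. }
  replace x with (2 * (x / 2)) at 2 by field. rewrite sin_2a.
  specialize (Hs (x / 2) ltac:(lra)).
  assert (cos (PI / 4) <= cos (x / 2)) by (apply cos_decr_1; lra).
  assert (0 < cos (PI / 4)) by (apply cos_gt_0; lra).
  set (k := cos (PI / 4)) in *.
  assert (H3 : x / 2 * k * k <= sin (x / 2) * cos (x / 2)).
  { apply Rmult_le_compat; auto; [|lra]. apply Rmult_le_pos; lra. }
  replace (x / 2 * k * k) with (x / 2 * k ^ 2) in H3 by ring. rewrite E in H3. lra. }
intros Hx. destruct (Rle_dec 0 x).
- rewrite Rabs_pos_eq in Hx |- * by lra. specialize (H x ltac:(lra)).
  rewrite Rabs_pos_eq; lra.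
- rewrite (Rabs_left x) in Hx |- * by lra. specialize (H (- x) ltac:(lra)).
  rewrite sin_neg in H. rewrite (Rabs_left (sin x)); lra.
Qed.

(** For w = a + ib one has |e^w - 1|^2 = (1 - e^a)^2 + 4 e^a sin(b/2)^2; the first summand controls
    a, the second controls b. *)
Lemma Cexp_minus_1_lower (A : R) (w : C) : 0 <= A -> - A <= Re w <= 0 -> Rabs (Im w) <= PI ->
  exp (- A) / 2 * Cmod w <= Cmod (Cexp w - 1)%C.
Proof.
intros HA Hr Hi. destruct w as [a b]. unfold Re, Im in *; simpl fst in *; simpl snd in *.
pose proof (exp_pos (- A)) as Hp.
assert (Hre : exp (- A) <= exp a) by (apply exp_le; lra).
assert (H1 : exp a <= 1) by (rewrite <- exp_0; apply exp_le; lra).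
assert (H2 : exp a * - a <= 1 - exp a).
{ generalize (exp_ineq1_le (- a)). rewrite exp_Ropp. intros H.
  pose proof (exp_pos a). apply Rmult_le_compat_l with (r := exp a) in H; [|lra].
  rewrite Rinv_r in H by lra. lra. }
pose proof (sin_lower (b / 2)) as Hs.
assert (Hb : Rabs (b / 2) = Rabs b / 2).
{ unfold Rdiv. rewrite Rabs_mult, (Rabs_pos_eq (/ 2)); lra. }
rewrite Hb in Hs. specialize (Hs ltac:(lra)).
assert (Hs2 : b ^ 2 / 16 <= sin (b / 2) ^ 2).
{ rewrite <- (pow2_abs (sin (b / 2))), <- (pow2_abs b).
  pose proof (Rabs_pos b). nra. }
assert (Hc : 1 - cos b = 2 * sin (b / 2) ^ 2).
{ replace b with (2 * (b / 2)) at 1 by field. rewrite cos_2a_sin. ring. }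
apply Rsqr_incr_0_var; [|apply Cmod_ge_0].
rewrite !Rsqr_pow2, Rpow_mult_distr, !Cmod2_alt.
unfold Cexp; simpl Re; simpl Im.
replace ((exp a * cos b - 0 * sin b + - (1)) ^ 2 + (exp a * sin b + 0 * cos b + - 0) ^ 2)
  with ((1 - exp a) ^ 2 + 2 * exp a * (1 - cos b)).
2:{ generalize (sin2_cos2 b). unfold Rsqr. intros E.
    replace ((exp a * cos b - 0 * sin b + - (1)) ^ 2 + (exp a * sin b + 0 * cos b + - 0) ^ 2)
     with (exp a ^ 2 * (sin b * sin b + cos b * cos b) - 2 * exp a * cos b + 1) by ring.
    rewrite E. ring. }
rewrite Hc. set (e := exp (- A)) in *. set (r := exp a) in *.
assert (e * - a <= 1 - r) by nra.
assert (e <= 1) by lra.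
assert (e ^ 2 * a ^ 2 <= (1 - r) ^ 2).
{ replace (e ^ 2 * a ^ 2) with ((e * - a) ^ 2) by ring. apply pow_incr. nra. }
assert (e ^ 2 * b ^ 2 / 4 <= 2 * r * (2 * sin (b / 2) ^ 2)).
{ assert (e * (b ^ 2 / 16) <= r * sin (b / 2) ^ 2) by (apply Rmult_le_compat; nra).
  assert (e ^ 2 * b ^ 2 <= e * b ^ 2) by (apply Rmult_le_compat_r; nra). lra. }
replace ((e / 2) ^ 2 * (a ^ 2 + b ^ 2)) with (e ^ 2 * a ^ 2 / 4 + e ^ 2 * b ^ 2 / 4) by field.
nra.
Qed.

(** The function pi^2 / sin(pi tau)^2, expressed in q. *)
Definition csc2 (tau : C) : C :=
  (- RtoC (4 * PI ^ 2) * (nome tau / (1 - nome tau) ^ 2))%C.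

Lemma nome_Cexp (tau : C) : nome tau = Cexp (RtoC (2 * PI) * Ci * tau)%C.
Proof. reflexivity. Qed.

Lemma Cmod_2PIi (tau : C) : Cmod (RtoC (2 * PI) * Ci * tau)%C = 2 * PI * Cmod tau.
Proof.
rewrite !Cmod_mult, Cmod_Ci, Cmod_R, Rabs_pos_eq; [ring|]. generalize PI_RGT_0; lra.
Qed.

Lemma Ci2 : (Ci * Ci)%C = (- (1))%C.
Proof. apply C_ext; simpl; ring. Qed.

(** With w = 2 pi i tau the difference is 4 pi^2 (e^w - 2 + e^-w - w^2) e^w / ((e^w - 1)^2 w^2),
    where numerator and denominator are both of order w^4. For Im tau >= 1 the two terms are bounded
    separately instead. *)
Lemma csc2_near_pole : exists K, forall tau, 0 < Im tau -> Rabs (Re tau) <= 1 / 2 ->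
  Cmod (csc2 tau - / tau ^ 2)%C <= K.
Proof.
pose proof PI_RGT_0 as HPI.
set (e := exp (- (2 * PI))).
assert (He : 0 < e < 1).
{ split; [apply exp_pos|]. rewrite <- exp_0. apply exp_increasing. lra. }
set (c := e / 2).
set (K1 := 4 * PI ^ 2 * (2 * exp (2 * PI * 2) / c ^ 2)).
set (K2 := 4 * PI ^ 2 * (/ (1 - e) ^ 2) + 1).
assert (Hc : 0 < c) by (unfold c; lra).
assert (HK1 : 0 <= K1).
{ unfold K1. apply Rmult_le_pos; [nra|]. apply Rmult_le_pos.
  - generalize (exp_pos (2 * PI * 2)). lra.
  - apply Rlt_le, Rinv_0_lt_compat, pow_lt; auto. }
assert (HK2 : 0 <= K2).
{ unfold K2. apply Rplus_le_le_0_compat; [|lra]. apply Rmult_le_pos; [nra|].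
  apply Rlt_le, Rinv_0_lt_compat, pow_lt; lra. }
exists (K1 + K2). intros tau Ht Hx.
assert (Htau : tau <> 0%C).
{ intros ->. simpl in Ht. lra. }
pose proof (Cmod_nome_lt_1 tau Ht) as Hq.
assert (Hq1 : (1 - nome tau)%C <> 0%C) by (apply one_minus_neq_0; lra).
destruct (Rle_dec 1 (Im tau)) as [Hy|Hy].
- apply Rle_trans with K2; [|lra]. unfold Cminus. eapply Rle_trans; [apply Cmod_triangle|].
  rewrite Cmod_opp. apply Rplus_le_compat.
  + unfold csc2. rewrite Cmod_mult, Cmod_opp, Cmod_R, Rabs_pos_eq by nra.
    apply Rmult_le_compat_l; [nra|].
    rewrite Cmod_div, Cmod_pow by now apply Cpow_nz.
    assert (Hqe : Cmod (nome tau) <= e).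
    { rewrite Cmod_nome. apply exp_le. nra. }
    assert (Hd : 1 - e <= Cmod (1 - nome tau)%C).
    { generalize (Cmod_triangle_rev 1 (- nome tau)). rewrite Cmod_1, Cmod_opp. unfold Cminus. lra. }
    rewrite <- (Rmult_1_l (/ (1 - e) ^ 2)). apply Rmult_le_compat; try lra.
    * apply Rlt_le, Rinv_0_lt_compat, pow_lt; lra.
    * apply Rinv_le_contravar; [apply pow_lt; lra|]. apply pow_incr; lra.
  + rewrite Cmod_inv_pow by auto. rewrite <- (pow1 2). apply pow_incr.
    assert (1 <= Cmod tau).
    { generalize (im_le_Cmod tau). rewrite Rabs_pos_eq; lra. }
    split; [apply Rlt_le, Rinv_0_lt_compat; lra|]. rewrite <- Rinv_1. apply Rinv_le_contravar; lra.
- apply Rle_trans with K1; [|lra].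
  set (w := (RtoC (2 * PI) * Ci * tau)%C).
  assert (Hw0 : w <> 0%C).
  { apply Cmod_pos_neq. unfold w. rewrite Cmod_2PIi. apply Rmult_lt_0_compat; [lra|].
    now apply Cmod_gt_0. }
  assert (Hw2 : (w ^ 2)%C = (- RtoC (4 * PI ^ 2) * tau ^ 2)%C).
  { unfold w. simpl. transitivity ((Ci * Ci) * (RtoC (2 * PI) * RtoC (2 * PI)) * (tau * tau))%C; [ring|].
    rewrite Ci2, <- RtoC_mult. replace (2 * PI * (2 * PI)) with (4 * (PI * (PI * 1))) by ring. ring. }
  assert (Hlow : c * Cmod w <= Cmod (Cexp w - 1)%C).
  { apply Cexp_minus_1_lower; [lra| |].
    - unfold w. destruct tau as [x y]; simpl in *. nra.
    - unfold w. destruct tau as [x y]; simpl in *.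
      replace ((2 * PI * 0 - 0 * 1) * y + (2 * PI * 1 + 0 * 0) * x) with (2 * PI * x) by ring.
      rewrite Rabs_mult, Rabs_pos_eq by lra. nra. }
  assert (Hmw : 0 < Cmod w) by now apply Cmod_gt_0.
  assert (Hq1' : (Cexp w - 1)%C <> 0%C) by (apply Cmod_pos_neq; nra).
  pose proof (Cexp_cosh_remainder w) as Hr.
  assert (E : (csc2 tau - / tau ^ 2)%C =
    (RtoC (4 * PI ^ 2) * ((Cexp w - 2 + Cexp (- w) - w ^ 2) * Cexp w) / ((Cexp w - 1) ^ 2 * w ^ 2))%C).
  { unfold csc2. rewrite nome_Cexp. fold w. rewrite Cexp_opp.
    rewrite nome_Cexp in Hq1. fold w in Hq1.
    replace (/ tau ^ 2)%C with (- RtoC (4 * PI ^ 2) / w ^ 2)%C.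
    2:{ rewrite Hw2. field. split; auto. intros EE; apply (f_equal Re) in EE; simpl in EE; nra. }
    simpl. field. repeat split; auto using Cexp_neq_0. }
  rewrite E. rewrite Cmod_div.
  2:{ apply Cmult_neq_0; apply Cpow_nz; auto. }
  rewrite !Cmod_mult, Cmod_R, !Cmod_pow, Rabs_pos_eq by nra.
  assert (Hq1m : Cmod (Cexp w) <= 1) by (rewrite nome_Cexp in Hq; fold w in Hq; lra).
  assert (Hwb : Cmod w <= 2 * PI * 2).
  { unfold w. rewrite Cmod_2PIi. apply Rmult_le_compat_l; [lra|].
    eapply Rle_trans; [apply Cmod_le_Re_Im|]. rewrite (Rabs_pos_eq (Im tau)); lra. }
  unfold K1, Rdiv. rewrite Rmult_assoc. apply Rmult_le_compat_l; [nra|].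
  set (m := Cmod w) in *.
  assert (Hem : exp m <= exp (2 * PI * 2)) by now apply exp_le.
  assert (Hm4 : 0 < m ^ 4) by now apply pow_lt.
  apply Rle_trans with (2 * (m ^ 4 * exp (2 * PI * 2)) * / ((c * m) ^ 2 * m ^ 2)).
  + apply Rmult_le_compat.
    * apply Rmult_le_pos; apply Cmod_ge_0.
    * apply Rlt_le, Rinv_0_lt_compat. apply Rmult_lt_0_compat; apply pow_lt; auto.
      now apply Cmod_gt_0.
    * pose proof (exp_pos m).
      assert (2 * (m ^ 4 * exp m) <= 2 * (m ^ 4 * exp (2 * PI * 2))) by nra.
      pose proof (Cmod_ge_0 (Cexp w - 2 + Cexp (- w) - w ^ 2)%C). pose proof (Cmod_ge_0 (Cexp w)). nra.
    * apply Rinv_le_contravar; [apply Rmult_lt_0_compat; apply pow_lt; nra|].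
      apply Rmult_le_compat_r; [apply pow_le; lra|]. apply pow_incr. nra.
  + right. field. lra.
Qed.

(** With u the nome of tau/2, the nome of (tau+1)/2 is -u and that of tau is u^2, so this is the
    identity u/(1-u)^2 - u/(1+u)^2 = 4 u^2/(1-u^2)^2. *)
Lemma csc2_duplicate (tau : C) : 0 < Im tau ->
  (csc2 (tau / 2) + csc2 ((tau + 1) / 2))%C = (4 * csc2 tau)%C.
Proof.
intros Ht. pose proof RtoC_2_neq_0.
assert (Hh : 0 < Im (tau / 2)%C) by (rewrite Im_half; lra).
assert (E1 : nome tau = (nome (tau / 2) * nome (tau / 2))%C).
{ rewrite <- nome_plus. f_equal. field; auto. }
assert (E2 : nome ((tau + 1) / 2)%C = (- nome (tau / 2))%C).
{ replace ((tau + 1) / 2)%C with (tau / 2 + / 2)%C by (field; auto).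
  rewrite nome_plus, nome_half. ring. }
unfold csc2. rewrite E1, E2. set (u := nome (tau / 2)%C).
assert (Cmod u < 1) by (apply Cmod_nome_lt_1; auto).
assert ((1 - u)%C <> 0%C) by now apply one_minus_neq_0.
assert ((1 - - u)%C <> 0%C) by (apply one_minus_neq_0; now rewrite Cmod_opp).
assert ((1 - u * u)%C <> 0%C).
{ replace (1 - u * u)%C with ((1 - u) * (1 - - u))%C by ring. now apply Cmult_neq_0. }
simpl. field; repeat split; auto.
Qed.

Lemma csc2_periodic (tau : C) : csc2 (tau + 1)%C = csc2 tau.
Proof. unfold csc2. rewrite nome_plus, nome_1, Cmult_1_r. reflexivity. Qed.

Lemma upper_periodic_reduction (P : C -> Prop) :
  (forall tau, 0 < Im tau -> P (tau + 1)%C <-> P tau) ->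
  (forall tau, 0 < Im tau -> Rabs (Re tau) <= 1 / 2 -> P tau) ->
  forall tau, 0 < Im tau -> P tau.
Proof.
intros Hp Hs.
assert (Hn : forall n tau, 0 < Im tau -> P (tau + RtoC (INR n))%C <-> P tau).
{ induction n; intros tau Ht.
  - simpl. replace (tau + 0)%C with tau by ring. tauto.
  - rewrite S_INR, RtoC_plus. replace (tau + (INR n + 1))%C with (tau + INR n + 1)%C by ring.
    rewrite Hp by now rewrite Im_RtoC_plus. auto. }
intros tau Ht.
(* The integer k with Re tau - 1/2 < k <= Re tau + 1/2; its sign decides in which direction to
   translate. *)
set (k := up (Re tau - 1 / 2)).
destruct (archimed (Re tau - 1 / 2)) as [H1 H2]. fold k in H1, H2.
destruct (Z_le_gt_dec 0 k) as [Hk|Hk].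
- set (n := Z.to_nat k).
  assert (En : IZR k = INR n) by (unfold n; rewrite INR_IZR_INZ, Z2Nat.id; auto).
  rewrite En in *.
  replace tau with (tau + RtoC (- INR n) + RtoC (INR n))%C by (rewrite RtoC_opp; ring).
  apply Hn; [now rewrite Im_RtoC_plus|]. apply Hs; [now rewrite Im_RtoC_plus|].
  destruct tau as [x y]; simpl in *. apply Rabs_le. lra.
- set (n := Z.to_nat (- k)).
  assert (En : IZR k = - INR n).
  { unfold n. rewrite INR_IZR_INZ, Z2Nat.id by lia. rewrite opp_IZR. ring. }
  rewrite En in *.
  apply (Hn n); auto. apply Hs; [now rewrite Im_RtoC_plus|].
  destruct tau as [x y]; simpl in *. apply Rabs_le. lra.
Qed.

(* Herglotz: the difference D of the two sides is bounded and satisfies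
   4 D(t) = D(t/2) + D((t+1)/2), so every bound can be halved. *)
Lemma Zsum2_csc2 (tau : C) : 0 < Im tau -> Zsum 2 tau = csc2 tau.
Proof.
destruct csc2_near_pole as [K HK].
set (D := fun t => (Zsum 2 t - csc2 t)%C).
set (M := 2 * 2 ^ 2 * inv_sq_total + K).
assert (HM : forall t, 0 < Im t -> Cmod (D t) <= M).
{ apply (upper_periodic_reduction (fun t => Cmod (D t) <= M)).
  - intros t Ht. unfold D. rewrite Zsum_periodic, csc2_periodic by auto. tauto.
  - intros t Ht Hx. unfold D.
    replace (Zsum 2 t - csc2 t)%C with ((Zsum 2 t - / t ^ 2) + - (csc2 t - / t ^ 2))%C by ring.
    eapply Rle_trans; [apply Cmod_triangle|]. rewrite Cmod_opp. unfold M.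
    apply Rplus_le_compat; [apply Zsum_near_pole; auto|apply HK; auto]. }
assert (HD : forall n t, 0 < Im t -> Cmod (D t) <= M * (1 / 2) ^ n).
{ induction n; intros t Ht; [simpl; specialize (HM t Ht); lra|].
  assert (E : (4 * D t)%C = (D (t / 2) + D ((t + 1) / 2))%C).
  { unfold D. transitivity ((Zsum 2 (t / 2) + Zsum 2 ((t + 1) / 2)) - (csc2 (t / 2) + csc2 ((t + 1) / 2)))%C.
    - rewrite Zsum2_duplicate, csc2_duplicate by auto. ring.
    - ring. }
  assert (H4 : 4 * Cmod (D t) <= M * (1 / 2) ^ n + M * (1 / 2) ^ n).
  { replace (4 * Cmod (D t)) with (Cmod (4 * D t)%C)
      by (rewrite Cmod_mult, Cmod_R, Rabs_pos_eq; lra).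
    rewrite E. eapply Rle_trans; [apply Cmod_triangle|].
    apply Rplus_le_compat; apply IHn; rewrite Im_half, ?Im_RtoC_plus; lra. }
  simpl. lra. }
intros Ht. apply Ceq_of_eps. intros eps He. fold (D tau).
assert (HM0 : 0 <= M) by (eapply Rle_trans; [apply Cmod_ge_0|apply (HM tau Ht)]).
destruct (pow_lt_1_zero (1 / 2) ltac:(rewrite Rabs_pos_eq; lra) (eps / (M + 1))) as [N HN].
{ apply Rdiv_lt_0_compat; lra. }
specialize (HN N (Nat.le_refl N)). specialize (HD N tau Ht).
rewrite Rabs_pos_eq in HN by (apply pow_le; lra).
apply Rmult_lt_compat_r with (r := M + 1) in HN; [|lra].
replace (eps / (M + 1) * (M + 1)) with eps in HN by (field; lra).
assert (0 <= (1 / 2) ^ N) by (apply pow_le; lra). nra.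
Qed.

(** * The Lipschitz formula *)

(** The polylogarithm of order -k. With 0^0 = 1 the term of index 0 is 1 for k = 0 and vanishes for
    k >= 1, so that order 0 gives 1/(1-w). *)
Definition npow_series (k : nat) (w : C) : C :=
  CSeries (fun n => RtoC (INR n ^ k) * w ^ n)%C.

Lemma ex_series_npow (k : nat) (r : R) : 0 <= r < 1 ->
  ex_series (fun n => Cmod (RtoC (INR n ^ k)) * r ^ n).
Proof.
intros Hr. eapply ex_series_ext; [|apply (ex_series_pow_geom k r Hr)].
intros n. cbn beta. rewrite Cmod_R, Rabs_pos_eq; auto. apply pow_le, pos_INR.
Qed.

Lemma summable_npow (k : nat) (w : C) : Cmod w < 1 ->
  summable (fun n => RtoC (INR n ^ k) * w ^ n)%C.
Proof.
intros Hw. eapply ex_series_ext; [|apply (ex_series_npow k (Cmod w))].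
- intros n. cbn beta. now rewrite Cmod_mult, Cmod_pow.
- split; auto using Cmod_ge_0.
Qed.

Lemma Cder_npow (k : nat) (w : C) : Cmod w < 1 ->
  exists D, Cder (npow_series k) w D /\ (w * D)%C = npow_series (S k) w.
Proof.
intros Hw. pose proof (Cmod_ge_0 w). set (rho := (1 + Cmod w) / 2).
eexists. split.
- apply (Cder_power_series _ rho); [|unfold rho; lra].
  eapply ex_series_ext; [|apply (ex_series_pow_geom (2 + k) rho); unfold rho; lra].
  intros n. cbn beta. rewrite Cmod_R, Rabs_pos_eq by apply pow_le, pos_INR.
  now rewrite pow_add.
- assert (E : forall n, (w * (RtoC (INR n ^ k) * (RtoC (INR n) * w ^ pred n)))%C
     = (RtoC (INR n ^ S k) * w ^ n)%C).
  { intros n. simpl pow. rewrite RtoC_mult. destruct n; [simpl; ring|]. cbn [pred Cpow]. ring. }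
  (* Summability of the derived series is obtained by dividing by w, which excludes w = 0. *)
  destruct (Ceq_dec w 0) as [->|Hw0].
  + rewrite Cmult_0_l. symmetry. unfold npow_series.
    rewrite (CSeries_ext _ (fun _ => RtoC 0)); [apply CSeries_0|].
    intros [|n]; simpl; [rewrite Rmult_0_l; ring|ring].
  + rewrite <- CSeries_scal.
    * apply CSeries_ext. exact E.
    * eapply summable_ext; [|apply (summable_scal (/ w)), (summable_npow (S k) w Hw)].
      intros n. cbn beta. rewrite <- E. field. auto.
Qed.

Lemma Cder_geom (w : C) : Cmod w < 1 -> Cder (fun z => / (1 - z))%C w (/ ((1 - w) * (1 - w)))%C.
Proof.
intros Hw. pose proof (one_minus_neq_0 w Hw).
eapply Cder_eq.
- apply (Cder_comp Cinv (fun z => 1 - z)%C).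
  + apply Cder_minus; [apply Cder_const|apply Cder_id].
  + now apply Cder_inv.
- field. auto.
Qed.

(** The operator w d/dw raises the order by one; uniqueness of the derivative transfers it from the
    series to a closed form already known on the disc. *)
Lemma npow_step (k : nat) (f : C -> C) (w D : C) : Cmod w < 1 ->
  (forall z, Cmod z < 1 -> npow_series k z = f z) -> Cder f w D ->
  npow_series (S k) w = (w * D)%C.
Proof.
intros Hw Hf HD. destruct (Cder_npow k w Hw) as (D' & H1 & <-).
f_equal. apply (Cder_unique f w); auto.
apply (Cder_ext_loc (npow_series k) f w D' (1 - Cmod w)); auto; [lra|].
intros h Hh. apply Hf. eapply Rle_lt_trans; [apply Cmod_triangle|]. lra.
Qed.

Lemma npow_0 (w : C) : Cmod w < 1 -> npow_series 0 w = (/ (1 - w))%C.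
Proof.
intros Hw. rewrite <- CSeries_geom by auto. apply CSeries_ext. intros n. simpl. ring.
Qed.

Lemma npow_1 (w : C) : Cmod w < 1 -> npow_series 1 w = (w * (/ (1 - w) * / (1 - w)))%C.
Proof.
intros Hw. rewrite (npow_step 0 _ w _ Hw npow_0 (Cder_geom w Hw)).
pose proof (one_minus_neq_0 w Hw). field. auto.
Qed.

Lemma npow_2 (w : C) : Cmod w < 1 ->
  npow_series 2 w = (w * (1 + w) * (/ (1 - w) * / (1 - w) * / (1 - w)))%C.
Proof.
intros Hw. pose proof (one_minus_neq_0 w Hw). erewrite (npow_step 1 _ w _ Hw npow_1).
2:{ apply Cder_mult; [apply Cder_id|]. apply Cder_mult; apply Cder_geom; auto. }
cbn beta. field. auto.
Qed.

Lemma npow_3 (w : C) : Cmod w < 1 ->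
  npow_series 3 w = (w * (1 + 4 * w + w * w) / (1 - w) ^ 4)%C.
Proof.
intros Hw. pose proof (one_minus_neq_0 w Hw). erewrite (npow_step 2 _ w _ Hw npow_2).
2:{ apply Cder_mult.
  - apply Cder_mult; [apply Cder_id|apply Cder_plus; [apply Cder_const|apply Cder_id]].
  - apply Cder_mult; [apply Cder_mult|]; apply Cder_geom; auto. }
cbn beta. simpl. field. auto.
Qed.

Lemma Cder_nome (tau : C) : Cder nome tau (RtoC (2 * PI) * Ci * nome tau)%C.
Proof.
eapply Cder_eq.
- apply (Cder_comp Cexp (fun t => RtoC (2 * PI) * Ci * t)%C); [|apply Cder_Cexp].
  apply Cder_scal, Cder_id.
- rewrite (nome_Cexp tau). ring.
Qed.

Definition lip (k : nat) : C :=
  ((- (RtoC (2 * PI) * Ci)) ^ S k * RtoC (/ INR (fact k)))%C.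

Lemma upper_nbhd (tau h : C) : Cmod h < Im tau -> 0 < Im (tau + h)%C.
Proof.
intros Hh. pose proof (im_le_Cmod h) as H. apply Rabs_le_between in H.
change (Im (tau + h)%C) with (Im tau + Im h). lra.
Qed.

(** The case k = 1 is the expansion of pi^2 / sin^2. Differentiating both sides in tau leads from k
    to k + 1. *)
Lemma Lipschitz_formula (k : nat) (tau : C) : (1 <= k)%nat -> 0 < Im tau ->
  Zsum (S k) tau = (lip k * npow_series k (nome tau))%C.
Proof.
intros Hk. revert tau. induction Hk as [|k Hk IH]; intros tau Ht.
- rewrite Zsum2_csc2 by auto. pose proof (Cmod_nome_lt_1 tau Ht).
  rewrite npow_1 by lra. unfold csc2, lip. simpl fact. change (INR 1) with 1. rewrite Rinv_1.
  pose proof (one_minus_neq_0 (nome tau) ltac:(lra)).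
  replace (RtoC (4 * PI ^ 2)) with (RtoC (2 * PI) * RtoC (2 * PI))%C
    by (rewrite <- RtoC_mult; f_equal; ring).
  transitivity ((Ci * Ci) * (RtoC (2 * PI) * RtoC (2 * PI)) * (nome tau / (1 - nome tau) ^ 2))%C.
  + rewrite Ci2. ring.
  + simpl. field. auto.
- pose proof (Cmod_nome_lt_1 tau Ht) as Hq.
  destruct (Cder_npow k (nome tau)) as (D & HD & ED); [lra|].
  assert (H : (- (RtoC (INR (S k)) * Zsum (S (S k)) tau))%C
    = (lip k * (D * (RtoC (2 * PI) * Ci * nome tau)))%C).
  { apply (Cder_unique (Zsum (S k)) tau); [apply Cder_Zsum; auto; lia|].
    apply (Cder_ext_loc (fun t => lip k * npow_series k (nome t))%C _ tau _ (Im tau)); auto.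
    - intros h Hh. rewrite IH; auto. now apply upper_nbhd.
    - apply Cder_scal. apply (Cder_comp (npow_series k) nome); auto using Cder_nome. }
  assert (Hn : RtoC (INR (S k)) <> 0%C).
  { intros E. apply RtoC_inj in E. apply not_0_INR in E; auto. }
  assert (E3 : Zsum (S (S k)) tau = (- / RtoC (INR (S k)) * (- (RtoC (INR (S k)) * Zsum (S (S k)) tau)))%C)
    by (field; auto).
  rewrite E3, H, <- ED. unfold lip. rewrite fact_simpl, mult_INR, Rinv_mult, (RtoC_mult (/ INR (S k))).
  rewrite (RtoC_inv (INR (S k))) by (apply not_0_INR; lia). cbn [Cpow]. ring.
Qed.

(** * Partial fractions of the cotangent *)

(** The function pi cot(pi tau). Pairing n with -(n+1) makes the sum absolutely convergent: the pair
    equals 2 tau - 1 divided by a product of two linear factors. *)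
Definition cot_series (tau : C) : C :=
  CSeries (fun n => / (tau + RtoC (INR n)) + / (tau + RtoC (- INR (S n))))%C.

Lemma summable_cot (tau : C) : 0 < Im tau ->
  summable (fun n => / (tau + RtoC (INR n)) + / (tau + RtoC (- INR (S n))))%C.
Proof.
intros Ht.
destruct (shift_lower_bound INR tau spread_pos Ht) as (B & HB & H1).
destruct (shift_lower_bound _ tau spread_neg Ht) as (B' & HB' & H2).
eapply summable_le.
2:{ apply (ex_series_scalR (Cmod (2 * tau - 1)%C * B * B')), ex_series_inv_sq. }
intros n. specialize (H1 n). specialize (H2 n). cbn beta in *.
pose proof (upper_neq_0 tau (INR n) Ht). pose proof (upper_neq_0 tau (- INR (S n)) Ht).
replace (/ (tau + INR n) + / (tau + RtoC (- INR (S n))))%C with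
  ((2 * tau - 1) * / (tau + INR n) * / (tau + RtoC (- INR (S n))))%C.
2:{ rewrite S_INR, RtoC_opp, RtoC_plus in *. field. auto. }
rewrite !Cmod_mult, !Cmod_inv by auto.
replace (Cmod (2 * tau - 1) * B * B' * / INR (S n) ^ 2) with
  (Cmod (2 * tau - 1)%C * (B * / INR (S n)) * (B' * / INR (S n))).
2:{ field. apply not_0_INR; lia. }
assert (forall z : C, z <> RtoC 0 -> 0 <= / Cmod z).
{ intros z Hz. apply Rlt_le, Rinv_0_lt_compat. now apply Cmod_gt_0. }
apply Rmult_le_compat; auto.
- apply Rmult_le_pos; auto using Cmod_ge_0.
- apply Rmult_le_compat_l; auto using Cmod_ge_0.
Qed.

Lemma Cder_cot_series (tau : C) : 0 < Im tau -> Cder cot_series tau (- Zsum 2 tau)%C.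
Proof.
intros Ht. eapply Cder_eq.
- apply (Cder_CSeries (fun n w => / (w + RtoC (INR n)) + / (w + RtoC (- INR (S n))))%C
    (fun n => - (/ (tau + RtoC (INR n)) ^ 2 + / (tau + RtoC (- INR (S n))) ^ 2))%C tau (Im tau / 2)
    (fun n => 2 * (/ Cmod (tau + RtoC (INR n))%C) ^ 3 + 2 * (/ Cmod (tau + RtoC (- INR (S n)))%C) ^ 3)).
  + lra.
  + apply (@ex_series_plus R_AbsRing R_NormedModule); apply ex_series_scalR.
    * apply (ex_series_shift INR); auto using spread_pos.
    * apply (ex_series_shift (fun n => - INR (S n))); auto using spread_neg.
  + intros n h Hh.
    assert (P : forall r, Cmod (/ (tau + h + RtoC r) - / (tau + RtoC r) - h * - / (tau + RtoC r) ^ 2)%C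
       <= 2 * (/ Cmod (tau + RtoC r)%C) ^ 3 * Cmod h ^ 2).
    { intros r. destruct (shift_inv_diff tau h r) as (h1 & h2 & h3); auto; try lra.
      pose proof (upper_neq_0 tau r Ht) as h4.
      replace (/ (tau + h + r) - / (tau + r) - h * - / (tau + r) ^ 2)%C
       with ((h * h) * (/ (tau + r) * / (tau + r)) * / (tau + h + r))%C by (simpl; field; auto).
      rewrite !Cmod_mult. rewrite <- Cmod_inv by auto.
      set (u := Cmod (/ (tau + r))%C) in *. assert (0 <= u) by apply Cmod_ge_0.
      pose proof (Cmod_ge_0 h). simpl pow.
      replace (2 * (u * (u * (u * 1))) * (Cmod h * (Cmod h * 1)))
        with (Cmod h * Cmod h * (u * u) * (2 * u)) by ring.
      apply Rmult_le_compat_l; auto. repeat apply Rmult_le_pos; auto. }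
    match goal with |- Cmod ?X <= _ => replace X with
     ((/ (tau + h + RtoC (INR n)) - / (tau + RtoC (INR n)) - h * - / (tau + RtoC (INR n)) ^ 2)
     + (/ (tau + h + RtoC (- INR (S n))) - / (tau + RtoC (- INR (S n)))
        - h * - / (tau + RtoC (- INR (S n))) ^ 2))%C by ring end.
    eapply Rle_trans; [apply Cmod_triangle|]. rewrite Rmult_plus_distr_r.
    apply Rplus_le_compat; apply P.
  + intros h Hh. apply summable_cot. apply upper_open; auto; lra.
  + apply summable_opp, summable_plus.
    * apply (summable_shift INR); auto using spread_pos.
    * apply (summable_shift (fun n => - INR (S n))); auto using spread_neg.
- rewrite (CSeries_opp (fun n => / (tau + RtoC (INR n)) ^ 2 + / (tau + RtoC (- INR (S n))) ^ 2)%C).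
  f_equal. apply CSeries_plus.
    * apply (summable_shift INR); auto using spread_pos.
    * apply (summable_shift (fun n => - INR (S n))); auto using spread_neg.
Qed.

(** On this line the nome is a negative real number tending to -1 as y -> 0, so 1 - q stays away
    from 0 and closed forms in q can be evaluated in the limit tau -> 1/2. *)
Definition half_line (y : R) : C := (1 / 2, y).

Lemma nome_half_line (y : R) : nome (half_line y) = (- RtoC (exp (- (2 * PI * y))))%C.
Proof.
replace (half_line y) with (/ 2 + (0, y))%C by (apply C_ext; simpl; field).
rewrite nome_plus, nome_half. replace (nome (0, y)) with (RtoC (exp (- (2 * PI * y)))); [ring|].
unfold nome. rewrite <- Cexp_RtoC. f_equal. apply C_ext; simpl; ring.
Qed.

Lemma one_minus_exp_le (t : R) : 0 <= t -> 0 <= 1 - exp (- t) <= t.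
Proof.
intros Ht. split.
- assert (exp (- t) <= exp 0) by (apply exp_le; lra). rewrite exp_0 in H. lra.
- generalize (exp_ineq1_le (- t)). lra.
Qed.

Lemma half_shift_lower (n : nat) : INR (S n) / 2 <= INR n + 1 / 2 /\ 1 / 2 <= INR n + 1 / 2.
Proof. rewrite S_INR. generalize (pos_INR n). lra. Qed.

(** Both sides have derivative -[Zsum 2], so their difference is constant. On [half_line] both tend
    to 0 with y: the n-th pair is 2iy / ((a + iy)(-a + iy)) with a = n + 1/2, and 1 + q tends to
    0. *)
Lemma cot_formula (tau : C) : 0 < Im tau ->
  cot_series tau = (- (RtoC PI * Ci) * (1 + nome tau) / (1 - nome tau))%C.
Proof.
intros Ht.
set (f := fun t => (cot_series t + RtoC PI * Ci * (1 + nome t) * / (1 - nome t))%C).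
assert (Hc : forall y, 0 < y -> f tau = f (half_line y)).
{ intros y Hy. apply (Cder_0_const (fun t => 0 < Im t) f); auto.
  - intros a b t Ha Hb H. destruct a as [a1 a2], b as [b1 b2]; simpl in *.
    destruct (Rle_dec t (1 / 2)); nra.
  - intros z Hz. pose proof (Cmod_nome_lt_1 z Hz).
    pose proof (one_minus_neq_0 (nome z) ltac:(lra)).
    eapply Cder_eq.
    + apply Cder_plus; [now apply Cder_cot_series|].
      apply Cder_mult.
      * apply Cder_scal, Cder_plus; [apply Cder_const|apply Cder_nome].
      * apply (Cder_comp (fun w => / (1 - w))%C nome); [apply Cder_nome|apply Cder_geom; lra].
    + rewrite Zsum2_csc2 by auto. unfold csc2. cbn beta.
      replace (RtoC (4 * PI ^ 2)) with (4 * RtoC PI * RtoC PI)%C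
        by (rewrite <- !RtoC_mult; f_equal; ring).
      replace (RtoC (2 * PI)) with (2 * RtoC PI)%C by (rewrite <- !RtoC_mult; f_equal; ring).
      set (q := nome z) in *.
      transitivity ((4 * PI * PI * (q / (1 - q) ^ 2)) * (1 + Ci * Ci))%C.
      * simpl. field. auto.
      * rewrite Ci2. ring. }
assert (Hf : f tau = 0%C).
{ apply Cmod_eq_0_eps. intros eps He.
  pose proof PI_RGT_0 as HPI. pose proof inv_sq_total_pos as HT.
  set (M := 8 * inv_sq_total + PI * (2 * PI)).
  assert (HM : 0 < M) by (unfold M; nra).
  (* [M] adds up the two linear error constants, so this height makes the total error exactly
     [eps]. *)
  set (y := eps / M). assert (Hy : 0 < y) by now apply Rdiv_lt_0_compat.
  rewrite (Hc y Hy). unfold f. eapply Rle_trans; [apply Cmod_triangle|].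
  replace eps with (8 * y * inv_sq_total + PI * (2 * PI * y)).
  2:{ unfold y, M. field. unfold M in HM; lra. }
  apply Rplus_le_compat.
  - unfold inv_sq_total. rewrite <- Series_scal_l.
    apply Cmod_CSeries_le; [|apply ex_series_scalR, ex_series_inv_sq].
    intros n. destruct (half_shift_lower n) as [Ha Ha']. set (a := INR n + 1 / 2) in *.
    assert (Hyh : 0 < Im (half_line y)) by exact Hy.
    pose proof (upper_neq_0 (half_line y) (INR n) Hyh) as h1.
    pose proof (upper_neq_0 (half_line y) (- INR (S n)) Hyh) as h2.
    assert (E1 : (half_line y + INR n)%C = (a, y)) by (apply C_ext; simpl; unfold a; ring).
    assert (E2 : (half_line y + RtoC (- INR (S n)))%C = ((- a)%R, y)).
    { unfold a. rewrite S_INR. apply C_ext; simpl; field. }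
    rewrite E1, E2 in *.
    replace (/ (a, y) + / ((- a)%R, y))%C with (2 * RtoC y * Ci * / (a, y) * / ((- a)%R, y))%C.
    2:{ replace (2 * RtoC y * Ci)%C with ((a, y) + ((- a)%R, y))%C by (apply C_ext; simpl; ring).
        field. auto. }
    assert (Hla : a <= Cmod (a, y)) by (generalize (re_le_Cmod (a, y)); simpl; rewrite Rabs_pos_eq; lra).
    assert (Hlb : a <= Cmod ((- a)%R, y)).
    { generalize (re_le_Cmod ((- a)%R, y)); simpl. rewrite Rabs_Ropp, Rabs_pos_eq; lra. }
    rewrite !Cmod_mult, Cmod_Ci, !Cmod_inv, !Cmod_R, !Rabs_pos_eq by (auto; lra).
    assert (HS : 0 < INR (S n)) by (apply lt_0_INR; lia).
    assert (/ Cmod (a, y) <= 2 * / INR (S n)).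
    { replace (2 * / INR (S n)) with (/ (INR (S n) / 2)) by (field; lra). apply Rinv_le_contravar; lra. }
    assert (/ Cmod ((- a)%R, y) <= 2 * / INR (S n)).
    { replace (2 * / INR (S n)) with (/ (INR (S n) / 2)) by (field; lra). apply Rinv_le_contravar; lra. }
    replace (8 * y * / INR (S n) ^ 2) with (2 * y * 1 * (2 * / INR (S n)) * (2 * / INR (S n))) by (field; lra).
    assert (0 < / Cmod (a, y)) by (apply Rinv_0_lt_compat; lra).
    assert (0 < / Cmod ((- a)%R, y)) by (apply Rinv_0_lt_compat; lra).
    apply Rmult_le_compat; try lra; [nra|]. apply Rmult_le_compat; nra.
  - rewrite nome_half_line. set (r := exp (- (2 * PI * y))).
    assert (Hr : 0 <= 1 - r <= 2 * PI * y) by (apply one_minus_exp_le; nra).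
    assert (Hr0 : 0 < r) by apply exp_pos.
    replace (1 - - RtoC r)%C with (RtoC (1 + r)) by (rewrite RtoC_plus; ring).
    replace (1 + - RtoC r)%C with (RtoC (1 - r)) by (rewrite RtoC_minus; ring).
    assert (Hr1 : RtoC (1 + r) <> 0%C) by (intros E; apply RtoC_inj in E; lra).
    rewrite !Cmod_mult, Cmod_Ci, Cmod_inv, !Cmod_R, !Rabs_pos_eq by (auto; lra).
    rewrite Rmult_1_r, Rmult_assoc. apply Rmult_le_compat_l; [lra|].
    assert (/ (1 + r) <= 1) by (rewrite <- Rinv_1; apply Rinv_le_contravar; lra).
    assert (0 < / (1 + r)) by (apply Rinv_0_lt_compat; lra). nra. }
unfold f in Hf.
replace (cot_series tau) with ((cot_series tau + RtoC PI * Ci * (1 + nome tau) * / (1 - nome tau))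
  - RtoC PI * Ci * (1 + nome tau) * / (1 - nome tau))%C by ring.
rewrite Hf. unfold Cdiv. ring.
Qed.

(** * Special zeta values *)

Definition zeta (k : nat) : R := Series (fun n => / INR (S n) ^ k).
(** For even k, twice this number is the lattice sum at tau = 1/2, where a closed form is at hand.
    The value of [zeta k] then follows by separating even and odd integers. *)
Definition half_zeta (k : nat) : R := Series (fun n => / (INR n + 1 / 2) ^ k).

Lemma ex_series_zeta (k : nat) : (2 <= k)%nat -> ex_series (fun n => / INR (S n) ^ k).
Proof.
intros Hk. eapply ex_series_comparison; [|apply ex_series_inv_sq].
intros n. assert (1 <= INR (S n)) by (rewrite S_INR; generalize (pos_INR n); lra).
rewrite Rabs_pos_eq by (apply Rlt_le, Rinv_0_lt_compat, pow_lt; lra).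
apply Rinv_le_contravar; [apply pow_lt; lra|]. now apply Rle_pow.
Qed.

Lemma CSeries_RtoC (a : nat -> R) : CSeries (fun n => RtoC (a n)) = RtoC (Series a).
Proof.
apply C_ext; simpl; auto.
rewrite (Series_ext _ (fun _ => 0 * 0)) by (intros; ring). rewrite Series_scal_l. ring.
Qed.

Lemma half_zeta_zeta (k : nat) : (2 <= k)%nat -> half_zeta k = (2 ^ k - 1) * zeta k.
Proof.
intros Hk. pose proof (ex_series_zeta k Hk) as Hz.
assert (Hs : summable (fun n => RtoC (/ INR (S n) ^ k))).
{ eapply ex_series_ext; [|exact Hz]. intros n. cbn beta. rewrite Cmod_R, Rabs_pos_eq; auto.
  apply Rlt_le, Rinv_0_lt_compat, pow_lt, lt_0_INR; lia. }
pose proof (CSeries_even_odd _ Hs) as E. cbn beta in E.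
assert (H2 : 2 ^ k <> 0) by (apply pow_nonzero; lra).
rewrite (CSeries_ext (fun n => RtoC (/ INR (S (2 * n)) ^ k)) (fun n => RtoC (/ 2 ^ k * / (INR n + 1 / 2) ^ k))) in E.
2:{ intros n. f_equal. rewrite <- Rinv_mult, <- Rpow_mult_distr. do 2 f_equal.
  rewrite S_INR, mult_INR. simpl. field. }
rewrite (CSeries_ext (fun n => RtoC (/ INR (S (2 * n + 1)) ^ k)) (fun n => RtoC (/ 2 ^ k * / INR (S n) ^ k))) in E.
2:{ intros n. f_equal. rewrite <- Rinv_mult, <- Rpow_mult_distr. do 2 f_equal.
  replace (S (2 * n + 1)) with (2 * S n)%nat by lia. now rewrite mult_INR. }
rewrite !CSeries_RtoC, <- RtoC_plus, !Series_scal_l in E. apply RtoC_inj in E.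
fold (zeta k) in E. fold (half_zeta k) in E.
apply Rmult_eq_reg_l with (/ 2 ^ k); [|now apply Rinv_neq_0_compat].
replace (/ 2 ^ k * ((2 ^ k - 1) * zeta k)) with (zeta k - / 2 ^ k * zeta k) by (field; auto).
rewrite E at 1. ring.
Qed.

Lemma Cpow_diff_le (u v : C) (m : R) (k : nat) : Cmod u <= m -> Cmod v <= m ->
  Cmod (u ^ k - v ^ k)%C <= INR k * m ^ pred k * Cmod (u - v)%C.
Proof.
intros Hu Hv. pose proof (Cmod_ge_0 u). pose proof (Cmod_ge_0 v).
induction k.
- simpl. replace (1 - 1)%C with (RtoC 0) by ring. rewrite Cmod_0. lra.
- replace (u ^ S k - v ^ S k)%C with (u * (u ^ k - v ^ k) + (u - v) * v ^ k)%C by (simpl; ring).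
  eapply Rle_trans; [apply Cmod_triangle|]. rewrite !Cmod_mult, Cmod_pow. cbn [pred].
  assert (Cmod v ^ k <= m ^ k) by (apply pow_incr; auto).
  pose proof (Cmod_ge_0 (u - v)%C).
  assert (Cmod u * Cmod (u ^ k - v ^ k)%C <= INR k * m ^ k * Cmod (u - v)%C).
  { destruct k.
    - simpl. replace (1 - 1)%C with (RtoC 0) by ring. rewrite Cmod_0. lra.
    - cbn [pred] in IHk. apply Rle_trans with (m * (INR (S k) * m ^ k * Cmod (u - v)%C)).
      + apply Rmult_le_compat; auto using Cmod_ge_0.
      + right. simpl pow. ring. }
  rewrite S_INR. nra.
Qed.

Lemma Zsum_half_line (k : nat) : (2 <= k)%nat -> Nat.Even k -> exists B, 0 <= B /\
  forall y, 0 < y -> Cmod (Zsum k (half_line y) - RtoC (2 * half_zeta k))%C <= B * y.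
Proof.
intros Hk Hev.
set (B1 := INR k * 2 ^ pred k * 4).
assert (HB1 : 0 <= B1).
{ unfold B1. apply Rmult_le_pos; [|lra]. apply Rmult_le_pos; [apply pos_INR|apply pow_le; lra]. }
exists (2 * (B1 * inv_sq_total)). split.
{ pose proof inv_sq_total_pos. nra. }
intros y Hy.
assert (Hyh : 0 < Im (half_line y)) by exact Hy.
assert (Hhz : ex_series (fun n => / (INR n + 1 / 2) ^ k)).
{ eapply ex_series_comparison; [|apply (ex_series_scalR (2 ^ k)), (ex_series_zeta k Hk)].
  intros n. destruct (half_shift_lower n) as [Ha Ha'].
  assert (HS : 0 < INR (S n)) by (apply lt_0_INR; lia).
  rewrite Rabs_pos_eq by (apply Rlt_le, Rinv_0_lt_compat, pow_lt; lra).
  rewrite <- (Rinv_inv 2) at 2. rewrite pow_inv, <- Rinv_mult, <- Rpow_mult_distr.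
  apply Rinv_le_contravar; [apply pow_lt; lra|]. apply pow_incr. lra. }
assert (Hhs : summable (fun n => RtoC (/ (INR n + 1 / 2) ^ k))).
{ eapply ex_series_ext; [|exact Hhz]. intros n. cbn beta. rewrite Cmod_R, Rabs_pos_eq; auto.
  destruct (half_shift_lower n). apply Rlt_le, Rinv_0_lt_compat, pow_lt; lra. }
(* The sign [e] distinguishes the two halves of Z; as k is even, e^k = 1 and both halves have the
   same limit. *)
assert (P : forall (s : nat -> R), spread s ->
   (forall n, exists e, (e = 1 \/ e = -1) /\ (half_line y + RtoC (s n))%C = (e * (INR n + 1 / 2), y)) ->
   Cmod (shift_sum s k (half_line y) - RtoC (half_zeta k))%C <= B1 * y * inv_sq_total).
{ intros s Hs He. unfold half_zeta, shift_sum, inv_sq_total.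
  rewrite <- CSeries_RtoC, <- CSeries_minus, <- Series_scal_l; auto using summable_shift.
  apply Cmod_CSeries_le; [|apply ex_series_scalR, ex_series_inv_sq].
  intros n. destruct (He n) as (e & He1 & E). rewrite E.
  destruct (half_shift_lower n) as [Ha Ha']. set (a := INR n + 1 / 2) in *.
  assert (Hes : Rabs (e * a) = a).
  { rewrite Rabs_mult, (Rabs_pos_eq a) by lra.
    destruct He1 as [-> | ->]; rewrite ?Rabs_Ropp; unfold Rabs; destruct Rcase_abs; lra. }
  assert (Hen : e * a <> 0) by (intros Z; rewrite Z, Rabs_R0 in Hes; lra).
  assert (Hz : (((e * a)%R, y) : C) <> RtoC 0) by (intros Z; apply (f_equal Re) in Z; simpl in Z; auto).
  assert (Hz2 : RtoC (e * a) <> 0%C) by (intros Z; apply RtoC_inj in Z; auto).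
  assert (Ek : RtoC (/ a ^ k) = ((/ RtoC (e * a)) ^ k)%C).
  { rewrite Cpow_inv, <- RtoC_pow, <- RtoC_inv by (try apply pow_nonzero; auto). f_equal. f_equal.
    rewrite Rpow_mult_distr. destruct Hev as [m ->].
    destruct He1 as [-> | ->]; [rewrite pow1; ring|]. rewrite pow_1_even. ring. }
  rewrite Ek, <- Cpow_inv by auto.
  assert (Hm1 : / a <= 2) by (replace 2 with (/ (1 / 2)) by field; apply Rinv_le_contravar; lra).
  assert (Hc : a <= Cmod ((e * a)%R, y)).
  { generalize (re_le_Cmod ((e * a)%R, y)); simpl. rewrite Hes. auto. }
  assert (Hi : / Cmod ((e * a)%R, y) <= / a) by (apply Rinv_le_contravar; lra).
  eapply Rle_trans; [apply (Cpow_diff_le _ _ 2)|].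
  - rewrite Cmod_inv by auto. lra.
  - rewrite Cmod_inv, Cmod_R, Hes by auto. lra.
  - replace (/ ((e * a)%R, y) - / RtoC (e * a))%C with (- (Ci * RtoC y) * / ((e * a)%R, y) * / RtoC (e * a))%C.
    2:{ replace (- (Ci * RtoC y))%C with (RtoC (e * a) - ((e * a)%R, y))%C by (apply C_ext; simpl; ring).
        field. auto. }
    rewrite !Cmod_mult, Cmod_opp, Cmod_mult, Cmod_Ci, !Cmod_inv, !Cmod_R, Hes, Rabs_pos_eq by (auto; lra).
    unfold B1. rewrite !Rmult_assoc. apply Rmult_le_compat_l; [apply pos_INR|].
    apply Rmult_le_compat_l; [apply pow_le; lra|].
    rewrite Rmult_1_l. replace (4 * (y * / INR (S n) ^ 2)) with (y * ((2 * / INR (S n)) * (2 * / INR (S n)))).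
    2:{ field. apply not_0_INR; lia. }
    apply Rmult_le_compat_l; [lra|].
    assert (HS : 0 < INR (S n)) by (apply lt_0_INR; lia).
    assert (/ a <= 2 * / INR (S n)).
    { replace (2 * / INR (S n)) with (/ (INR (S n) / 2)) by (field; lra). apply Rinv_le_contravar; lra. }
    assert (0 < / Cmod ((e * a)%R, y)) by (apply Rinv_0_lt_compat; lra).
    assert (0 < / a) by (apply Rinv_0_lt_compat; lra).
    apply Rmult_le_compat; lra. }
unfold Zsum.
replace (shift_sum INR k (half_line y) + shift_sum (fun n => - INR (S n))%R k (half_line y)
  - RtoC (2 * half_zeta k))%C with ((shift_sum INR k (half_line y) - RtoC (half_zeta k)) +
   (shift_sum (fun n => - INR (S n))%R k (half_line y) - RtoC (half_zeta k)))%C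
  by (rewrite RtoC_mult; ring).
eapply Rle_trans; [apply Cmod_triangle|].
replace (2 * (B1 * inv_sq_total) * y) with (B1 * y * inv_sq_total + B1 * y * inv_sq_total) by ring.
apply Rplus_le_compat; apply P; auto using spread_pos, spread_neg.
- intros n. exists 1. split; auto. apply C_ext; simpl; ring.
- intros n. exists (-1). split; auto. rewrite S_INR. apply C_ext; simpl; field.
Qed.

Lemma eq_of_linear_bound (a b B : R) : (forall y, 0 < y -> Rabs (a - b) <= B * y) -> a = b.
Proof.
intros H. destruct (Req_dec a b) as [E|E]; auto. exfalso.
assert (0 < Rabs (a - b)) by (apply Rabs_pos_lt; lra).
set (d := Rabs (a - b)) in *.
assert (HB : 0 < B) by (specialize (H 1 ltac:(lra)); lra).
specialize (H (d / (2 * B)) ltac:(apply Rdiv_lt_0_compat; lra)).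
replace (B * (d / (2 * B))) with (d / 2) in H by (field; lra). lra.
Qed.

Lemma half_zeta_limit (k : nat) (v B : R) : (2 <= k)%nat -> Nat.Even k ->
  (forall y, 0 < y -> Cmod (Zsum k (half_line y) - RtoC v)%C <= B * y) -> half_zeta k = v / 2.
Proof.
intros Hk Hev H. destruct (Zsum_half_line k Hk Hev) as (B' & HB' & H').
enough (2 * half_zeta k = v) by lra.
apply (eq_of_linear_bound _ _ (B' + B)). intros y Hy.
rewrite <- Cmod_R, RtoC_minus.
replace (RtoC (2 * half_zeta k) - RtoC v)%C with
  (- (Zsum k (half_line y) - RtoC (2 * half_zeta k)) + (Zsum k (half_line y) - RtoC v))%C by ring.
eapply Rle_trans; [apply Cmod_triangle|]. rewrite Cmod_opp, Rmult_plus_distr_r.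
apply Rplus_le_compat; auto.
Qed.

(** At tau = 1/2 the sum is pi^2 / sin(pi/2)^2 = pi^2, hence 3 zeta(2) = pi^2 / 2. On [half_line]
    the error is exactly -pi^2 ((1-r)/(1+r))^2 with q = -r. *)
Lemma zeta_2 : zeta 2 = PI ^ 2 / 6.
Proof.
pose proof PI_RGT_0 as HPI.
assert (H : half_zeta 2 = PI ^ 2 / 2).
{ apply (half_zeta_limit _ _ (PI ^ 2 * (2 * PI))); auto; [now exists 1%nat|].
  intros y Hy. rewrite Zsum2_csc2 by exact Hy. unfold csc2. rewrite nome_half_line.
  set (r := exp (- (2 * PI * y))).
  assert (Hr : 0 <= 1 - r <= 2 * PI * y) by (apply one_minus_exp_le; nra).
  assert (Hr0 : 0 < r) by apply exp_pos.
  assert (Hr1 : RtoC (1 + r) <> 0%C) by (intros E; apply RtoC_inj in E; lra).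
  replace (- RtoC (4 * PI ^ 2) * (- RtoC r / (1 - - RtoC r) ^ 2) - RtoC (PI ^ 2))%C
    with (RtoC (- (PI ^ 2 * ((1 - r) ^ 2 / (1 + r) ^ 2)))).
  2:{ replace (1 - - RtoC r)%C with (RtoC (1 + r)) by (rewrite RtoC_plus; ring).
      rewrite <- RtoC_pow, <- !RtoC_opp, <- RtoC_div, <- RtoC_mult, <- RtoC_minus
        by (try (apply pow_nonzero); lra).
      f_equal. field. lra. }
  rewrite Cmod_R, Rabs_Ropp, Rabs_pos_eq.
  2:{ apply Rmult_le_pos; [nra|]. apply Rmult_le_pos; [nra|]. apply Rlt_le, Rinv_0_lt_compat, pow_lt; lra. }
  rewrite Rmult_assoc. apply Rmult_le_compat_l; [nra|].
  apply Rle_trans with ((1 - r) ^ 2); [|nra].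
  unfold Rdiv. rewrite <- (Rmult_1_r ((1 - r) ^ 2)) at 2. apply Rmult_le_compat_l; [nra|].
  rewrite <- Rinv_1. apply Rinv_le_contravar; nra. }
rewrite half_zeta_zeta in H by auto. lra.
Qed.

(** At q = -1 the closed form of [npow_series 3] equals 1/8 and the Lipschitz constant is 8 pi^4 /
    3, so the sum at tau = 1/2 is pi^4 / 3 and 15 zeta(4) is half of it. *)
Lemma zeta_4 : zeta 4 = PI ^ 4 / 90.
Proof.
pose proof PI_RGT_0 as HPI. assert (HP4 : 0 < PI ^ 4) by now apply pow_lt.
assert (H : half_zeta 4 = (PI ^ 4 / 3) / 2).
{ apply (half_zeta_limit _ _ (PI ^ 4 * (16 * (2 * PI)))); [lia|now exists 2%nat|].
  intros y Hy. rewrite (Lipschitz_formula 3) by (try lia; exact Hy).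
  rewrite nome_half_line.
  set (r := exp (- (2 * PI * y))).
  assert (Hr : 0 <= 1 - r <= 2 * PI * y) by (apply one_minus_exp_le; nra).
  assert (Hr0 : 0 < r) by apply exp_pos.
  assert (Hr1 : RtoC (1 + r) <> 0%C) by (intros E; apply RtoC_inj in E; lra).
  assert (H14 : 1 <= (1 + r) ^ 4) by (apply pow_R1_Rle; lra).
  rewrite npow_3.
  2:{ rewrite Cmod_opp, Cmod_R, Rabs_pos_eq by lra. unfold r.
      rewrite <- exp_0. apply exp_increasing. nra. }
  replace (lip 3) with (RtoC (8 * PI ^ 4 / 3)).
  2:{ unfold lip. simpl fact. replace (INR 6) with 6 by (simpl; ring).
      replace ((- (RtoC (2 * PI) * Ci)) ^ 4)%C with (RtoC ((2 * PI) ^ 4)).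
      - rewrite <- RtoC_mult. f_equal. field.
      - rewrite RtoC_pow. simpl.
        transitivity ((Ci * Ci) * (Ci * Ci) * (RtoC (2 * PI) * (RtoC (2 * PI) * (RtoC (2 * PI) * (RtoC (2 * PI) * 1)))))%C; [|ring].
        rewrite Ci2. ring. }
  assert (E : (RtoC (8 * PI ^ 4 / 3) * (- RtoC r * (1 + 4 * - RtoC r + - RtoC r * - RtoC r) / (1 - - RtoC r) ^ 4)
     - RtoC (PI ^ 4 / 3))%C = RtoC (- (PI ^ 4 / 3 * ((1 - r) ^ 2 * (1 + 14 * r + r ^ 2) / (1 + r) ^ 4)))).
  { replace (1 - - RtoC r)%C with (RtoC (1 + r)) by (rewrite RtoC_plus; ring).
    replace (- RtoC r * (1 + 4 * - RtoC r + - RtoC r * - RtoC r))%C with (RtoC (- r * (1 - 4 * r + r * r)))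
      by (rewrite RtoC_mult, RtoC_opp, RtoC_plus, RtoC_minus, !RtoC_mult; ring).
    rewrite <- RtoC_pow, <- RtoC_div, <- RtoC_mult, <- RtoC_minus by (try (apply pow_nonzero); lra).
    f_equal. field. lra. }
  rewrite E, Cmod_R, Rabs_Ropp, Rabs_pos_eq.
  2:{ apply Rmult_le_pos; [lra|]. apply Rmult_le_pos; [|apply Rlt_le, Rinv_0_lt_compat; lra].
      apply Rmult_le_pos; nra. }
  assert (HA : 0 <= (1 - r) ^ 2 * (1 + 14 * r + r ^ 2) <= (1 - r) ^ 2 * 16).
  { assert (0 <= (1 - r) ^ 2) by nra. assert (0 <= 1 + 14 * r + r ^ 2 <= 16) by nra.
    split; [apply Rmult_le_pos; lra|apply Rmult_le_compat_l; lra]. }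
  assert (HB : 0 <= / (1 + r) ^ 4 <= 1).
  { split; [apply Rlt_le, Rinv_0_lt_compat; lra|].
    rewrite <- Rinv_1. apply Rinv_le_contravar; lra. }
  set (A := (1 - r) ^ 2 * (1 + 14 * r + r ^ 2)) in *. set (B := / (1 + r) ^ 4) in *.
  change (A / (1 + r) ^ 4) with (A * B).
  assert (HAB : 0 <= A * B <= 16 * (2 * PI * y)).
  { assert ((1 - r) ^ 2 <= 2 * PI * y) by nra. split; [apply Rmult_le_pos; lra|].
    apply Rle_trans with (A * 1); [apply Rmult_le_compat_l; lra|lra]. }
  rewrite Rmult_assoc. apply Rmult_le_compat; lra. }
rewrite half_zeta_zeta in H by lia. lra.
Qed.

(** * Sums over the two-dimensional lattice *)

(** The lattice points (m+1, n+1) and (m+1, -(n+1)) are taken together. Both indices then run over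
    positive integers, and tau -> -1/tau merely exchanges them. *)
Definition quad (k m n : nat) (tau : C) : C :=
  (/ (RtoC (INR (S m)) * tau + RtoC (INR (S n))) ^ k
   + / (RtoC (INR (S m)) * tau + RtoC (- INR (S n))) ^ k)%C.

Lemma Im_scal_pos (x : R) (tau : C) : 0 < x -> 0 < Im tau -> 0 < Im (RtoC x * tau)%C.
Proof. intros. destruct tau; simpl in *. nra. Qed.

Lemma INR_S_ge_1 (n : nat) : 1 <= INR (S n).
Proof. rewrite S_INR. generalize (pos_INR n). lra. Qed.

Lemma lattice_neq_0 (x r : R) (tau : C) : 0 < x -> 0 < Im tau -> (RtoC x * tau + RtoC r)%C <> 0%C.
Proof. intros. apply upper_neq_0. now apply Im_scal_pos. Qed.

Lemma summable_quad (k m : nat) (tau : C) : (2 <= k)%nat -> 0 < Im tau ->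
  summable (fun n => quad k m n tau).
Proof.
intros Hk Ht. pose proof (INR_S_ge_1 m).
assert (Hm : 0 < Im (RtoC (INR (S m)) * tau)%C) by (apply Im_scal_pos; lra).
apply summable_plus.
- apply (summable_incr_1 (fun n => / (RtoC (INR (S m)) * tau + RtoC (INR n)) ^ k)%C).
  now apply (summable_shift INR); auto using spread_pos.
- now apply (summable_shift (fun n => - INR (S n))); auto using spread_neg.
Qed.

Lemma CSeries_quad_row (k m : nat) (tau : C) : (2 <= k)%nat -> 0 < Im tau ->
  CSeries (fun n => quad k m n tau) =
  (Zsum k (RtoC (INR (S m)) * tau) - / (RtoC (INR (S m)) * tau) ^ k)%C.
Proof.
intros Hk Ht. pose proof (INR_S_ge_1 m).
assert (Hm : 0 < Im (RtoC (INR (S m)) * tau)%C) by (apply Im_scal_pos; lra).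
pose proof (summable_shift INR k _ spread_pos Hm Hk) as S1.
pose proof (summable_shift (fun n => - INR (S n)) k _ spread_neg Hm Hk) as S2.
unfold Zsum, shift_sum, quad.
rewrite (CSeries_incr_1 _ S1).
rewrite CSeries_plus; auto.
2:{ now apply (summable_incr_1 (fun n => / (RtoC (INR (S m)) * tau + RtoC (INR n)) ^ k)%C). }
change (INR 0) with 0. rewrite Cplus_0_r. ring.
Qed.

Lemma S_transform_im (tau : C) : 0 < Im tau -> 0 < Im (- / tau)%C /\ tau <> 0%C.
Proof.
intros Ht. destruct tau as [x y]; simpl in *. split.
- replace (- (- y / (x * (x * 1) + y * (y * 1)))) with (y / (x * x + y * y)).
  + apply Rdiv_lt_0_compat; nra.
  + field. nra.
- intros E. apply (f_equal Im) in E. simpl in E. lra.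
Qed.

(** m (-1/tau) + n = (n tau - m)/tau; the other point of the pair carries an additional sign, which
    an even power removes. *)
Lemma quad_S_transform (k m n : nat) (tau : C) : Nat.Even k -> 0 < Im tau ->
  quad k m n (- / tau)%C = (tau ^ k * quad k n m tau)%C.
Proof.
intros [j ->] Ht. destruct (S_transform_im tau Ht) as [Ht' H0].
pose proof (INR_S_ge_1 m). pose proof (INR_S_ge_1 n).
assert (A1 := lattice_neq_0 (INR (S n)) (INR (S m)) tau ltac:(lra) Ht).
assert (A2 := lattice_neq_0 (INR (S n)) (- INR (S m)) tau ltac:(lra) Ht).
unfold quad.
replace (RtoC (INR (S m)) * - / tau + RtoC (INR (S n)))%C with
  ((RtoC (INR (S n)) * tau + RtoC (- INR (S m))) * / tau)%C by (rewrite RtoC_opp; field; auto).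
replace (RtoC (INR (S m)) * - / tau + RtoC (- INR (S n)))%C with
  ((RtoC (INR (S n)) * tau + RtoC (INR (S m))) * (- / tau))%C by (rewrite !RtoC_opp; field; auto).
set (u := (RtoC (INR (S n)) * tau + RtoC (INR (S m)))%C) in *.
set (v := (RtoC (INR (S n)) * tau + RtoC (- INR (S m)))%C) in *.
assert (P : forall w z : C, ((w * z) ^ (2 * j) = w ^ (2 * j) * z ^ (2 * j))%C) by (intros; apply Cpow_mult_l).
assert (Q : ((- / tau) ^ (2 * j))%C = ((/ tau) ^ (2 * j))%C).
{ rewrite !Cpow_mult_r. f_equal. simpl. ring. }
rewrite !P, Q, Cpow_inv by auto.
field. repeat split; apply Cpow_nz; auto.
Qed.

Lemma summable_quad_col (k n : nat) (tau : C) : (2 <= k)%nat -> Nat.Even k -> 0 < Im tau ->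
  summable (fun m => quad k m n tau).
Proof.
intros Hk He Ht. destruct (S_transform_im tau Ht) as [Ht' H0].
eapply summable_ext; [|apply (summable_scal (/ tau ^ k)%C), (summable_quad k n _ Hk Ht')].
intros m. cbn beta. rewrite quad_S_transform by auto. field. now apply Cpow_nz.
Qed.

Lemma CSeries_quad_col (k n : nat) (tau : C) : (2 <= k)%nat -> Nat.Even k -> 0 < Im tau ->
  CSeries (fun m => quad k m n tau) = (/ tau ^ k * CSeries (fun m => quad k n m (- / tau)))%C.
Proof.
intros Hk He Ht. destruct (S_transform_im tau Ht) as [Ht' H0].
rewrite <- CSeries_scal by now apply summable_quad.
apply CSeries_ext. intros m. rewrite quad_S_transform by auto. field. now apply Cpow_nz.
Qed.

Lemma CSeries_exchange_inv_sq (a : nat -> nat -> C) (K : R) :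
  (forall m n, Cmod (a m n) <= K * (/ INR (S m) ^ 2 * / INR (S n) ^ 2)) ->
  (forall n, summable (fun m => a m n)) /\
  summable (fun m => CSeries (a m)) /\
  summable (fun n => CSeries (fun m => a m n)) /\
  CSeries (fun m => CSeries (a m)) = CSeries (fun n => CSeries (fun m => a m n)).
Proof.
intros H. apply (CSeries_exchange_prod a (fun m => K * / INR (S m) ^ 2) (fun n => / INR (S n) ^ 2)).
- apply ex_series_scalR, ex_series_inv_sq.
- apply ex_series_inv_sq.
- intros m n. rewrite Rmult_assoc. apply H.
Qed.

Lemma inv_lattice_bound (B x r c : R) (tau : C) : 0 < B -> 0 < x -> 0 < Im tau -> 0 < c ->
  x + Rabs r <= B * Cmod (RtoC x * tau + RtoC r)%C -> c <= x + Rabs r ->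
  Cmod (/ (RtoC x * tau + RtoC r))%C <= B / c.
Proof.
intros HB Hx Ht Hc H1 H2. rewrite Cmod_inv by now apply lattice_neq_0.
set (m := Cmod (RtoC x * tau + RtoC r)%C) in *.
assert (Hm : 0 < m) by nra.
apply Rmult_le_reg_r with (m * c); [nra|].
replace (/ m * (m * c)) with c by (field; lra).
replace (B / c * (m * c)) with (B * m) by (field; lra). lra.
Qed.

Lemma inv_sum_pow_4_le (x y : R) : 0 < x -> 0 < y -> / (x + y) ^ 4 <= / x ^ 2 * / y ^ 2.
Proof.
intros Hx Hy. rewrite <- Rinv_mult, <- Rpow_mult_distr.
apply Rinv_le_contravar; [apply pow_lt; nra|].
replace ((x + y) ^ 4) with (((x + y) ^ 2) ^ 2) by ring. apply pow_incr. nra.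
Qed.

(** Weight 4 is enough for absolute convergence: |m tau + n|^-4 is at most a constant times m^-2
    n^-2. *)
Lemma quad_4_bound (tau : C) : 0 < Im tau -> exists K, forall m n,
  Cmod (quad 4 m n tau) <= K * (/ INR (S m) ^ 2 * / INR (S n) ^ 2).
Proof.
intros Ht. destruct (lattice_lower_bound tau Ht) as (B & HB & H).
exists (2 * B ^ 4). intros m n. pose proof (INR_S_ge_1 m). pose proof (INR_S_ge_1 n).
set (x := INR (S m)) in *. set (y := INR (S n)) in *.
assert (P : forall r, Rabs r = y -> Cmod (/ (RtoC x * tau + RtoC r) ^ 4)%C
   <= B ^ 4 * (/ x ^ 2 * / y ^ 2)).
{ intros r Hr. rewrite <- Cpow_inv by (apply lattice_neq_0; lra). rewrite Cmod_pow.
  apply Rle_trans with ((B / (x + y)) ^ 4).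
  - apply pow_incr. split; [apply Cmod_ge_0|]. apply inv_lattice_bound; try lra. apply H; lra.
  - unfold Rdiv. rewrite Rpow_mult_distr, pow_inv. apply Rmult_le_compat_l; [apply pow_le; lra|].
    apply inv_sum_pow_4_le; lra. }
unfold quad. fold x y. eapply Rle_trans; [apply Cmod_triangle|].
assert (P1 := P y ltac:(apply Rabs_pos_eq; lra)).
assert (P2 := P (- y) ltac:(rewrite Rabs_Ropp; apply Rabs_pos_eq; lra)). lra.
Qed.

(** The Eisenstein series of even weight k is 2 zeta(k) + 2 [eis k]; the term zeta(k) is the row m =
    0 that is left out here. *)
Definition eis (k : nat) (tau : C) : C :=
  CSeries (fun m => Zsum k (RtoC (INR (S m)) * tau)%C).

Lemma summable_zeta_term (k : nat) (c : C) : (2 <= k)%nat ->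
  summable (fun m => c * RtoC (/ INR (S m) ^ k))%C /\
  CSeries (fun m => c * RtoC (/ INR (S m) ^ k))%C = (c * RtoC (zeta k))%C.
Proof.
intros Hk.
assert (Hs : summable (fun m => RtoC (/ INR (S m) ^ k))).
{ eapply ex_series_ext; [|apply (ex_series_zeta k Hk)]. intros m. cbn beta.
  rewrite Cmod_R, Rabs_pos_eq; auto. apply Rlt_le, Rinv_0_lt_compat, pow_lt, lt_0_INR; lia. }
split; [now apply summable_scal|]. rewrite CSeries_scal by auto. now rewrite CSeries_RtoC.
Qed.

Lemma inv_scal_pow (k m : nat) (tau : C) : tau <> 0%C ->
  (/ (RtoC (INR (S m)) * tau) ^ k)%C = (/ tau ^ k * RtoC (/ INR (S m) ^ k))%C.
Proof.
intros Ht. assert (INR (S m) <> 0) by (apply not_0_INR; lia).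
assert (RtoC (INR (S m)) <> 0%C) by (intros E; apply RtoC_inj in E; auto).
rewrite Cpow_mult_l, RtoC_inv, RtoC_pow by now apply pow_nonzero.
field. split; now apply Cpow_nz.
Qed.

Lemma eis_4_quad (tau : C) : 0 < Im tau ->
  eis 4 tau = (/ tau ^ 4 * RtoC (zeta 4) + CSeries (fun m => CSeries (fun n => quad 4 m n tau)))%C.
Proof.
intros Ht. destruct (S_transform_im tau Ht) as [_ H0].
destruct (quad_4_bound tau Ht) as [K HK].
destruct (CSeries_exchange_inv_sq _ K HK) as (_ & S1 & _ & _).
destruct (summable_zeta_term 4 (/ tau ^ 4)%C) as [Z1 Z2]; [lia|].
rewrite <- Z2, <- CSeries_plus by auto. apply CSeries_ext. intros m.
rewrite CSeries_quad_row by (auto; lia). rewrite inv_scal_pow by auto. ring.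
Qed.

(** Exchanging rows and columns of the quadrant sum also exchanges its two axes: the column n = 0
    contributes tau^-4 zeta(4), the row m = 0 contributes zeta(4). *)
Lemma eis_4_transform (tau : C) : 0 < Im tau ->
  (RtoC (zeta 4) + eis 4 (- / tau))%C = (tau ^ 4 * (RtoC (zeta 4) + eis 4 tau))%C.
Proof.
intros Ht. destruct (S_transform_im tau Ht) as [Ht' H0].
rewrite !eis_4_quad by auto.
destruct (quad_4_bound tau Ht) as [K HK].
destruct (CSeries_exchange_inv_sq _ K HK) as (S0 & S1 & S2 & ->).
assert (Hev : Nat.Even 4) by now exists 2%nat.
rewrite (CSeries_ext (fun m => CSeries (fun n => quad 4 m n (- / tau)%C))
  (fun m => tau ^ 4 * CSeries (fun n => quad 4 n m tau))%C).
2:{ intros m. rewrite <- CSeries_scal by apply S0. apply CSeries_ext. intros n. now apply quad_S_transform. }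
rewrite CSeries_scal by auto.
simpl. field. auto.
Qed.

(** * The quasi-modular transformation of the weight two sum *)

(* Shifting by 1/2 makes both iterated sums of this kernel telescope, while its
   difference with [quad 2] is absolutely summable. *)
Definition tele (m n : nat) (tau : C) : C :=
  (/ ((RtoC (INR (S m)) * tau + RtoC (INR (S n))) ^ 2 - RtoC (1 / 4))
   + / ((RtoC (INR (S m)) * tau + RtoC (- INR (S n))) ^ 2 - RtoC (1 / 4)))%C.

Lemma tele_factor (x r : R) (tau : C) : 0 < x -> 0 < Im tau ->
  (/ ((RtoC x * tau + RtoC r) ^ 2 - RtoC (1 / 4)))%C =
  (/ (RtoC x * tau + RtoC (r - 1 / 2)) - / (RtoC x * tau + RtoC (r + 1 / 2)))%C /\
  ((RtoC x * tau + RtoC r) ^ 2 - RtoC (1 / 4))%C =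
  ((RtoC x * tau + RtoC (r - 1 / 2)) * (RtoC x * tau + RtoC (r + 1 / 2)))%C.
Proof.
intros Hx Ht.
pose proof (lattice_neq_0 x (r - 1 / 2) tau Hx Ht) as H1.
pose proof (lattice_neq_0 x (r + 1 / 2) tau Hx Ht) as H2.
assert (E : ((RtoC x * tau + RtoC r) ^ 2 - RtoC (1 / 4))%C =
  ((RtoC x * tau + RtoC (r - 1 / 2)) * (RtoC x * tau + RtoC (r + 1 / 2)))%C).
{ replace (1 / 4) with (1 / 2 * (1 / 2)) by field.
  rewrite RtoC_minus, RtoC_plus, RtoC_mult. simpl. ring. }
split; auto. rewrite E.
assert (E1 : (RtoC x * tau + RtoC (r + 1 / 2) - (RtoC x * tau + RtoC (r - 1 / 2)))%C = RtoC 1).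
{ replace (r + 1 / 2) with (r - 1 / 2 + 1) by field. rewrite (RtoC_plus (r - 1 / 2)). ring. }
set (u := (RtoC x * tau + RtoC (r - 1 / 2))%C) in *.
set (v := (RtoC x * tau + RtoC (r + 1 / 2))%C) in *.
transitivity (1 * / (u * v))%C; [ring|]. rewrite <- E1. field. auto.
Qed.

(** 1/z^2 - 1/(z^2 - 1/4) = -(1/4) / (z^2 (z^2 - 1/4)) has order 4, so the difference converges like
    a sum of weight 4. The shifts by 1/2 cost at most a factor 2 in each of two lattice bounds. *)
Lemma quad_2_tele_bound (tau : C) : 0 < Im tau -> exists K, forall m n,
  Cmod (quad 2 m n tau - tele m n tau)%C <= K * (/ INR (S m) ^ 2 * / INR (S n) ^ 2).
Proof.
intros Ht. destruct (lattice_lower_bound tau Ht) as (B & HB & H).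
exists (2 * (4 * B ^ 4)). intros m n. pose proof (INR_S_ge_1 m). pose proof (INR_S_ge_1 n).
unfold quad, tele. set (x := INR (S m)) in *. set (y := INR (S n)) in *.
assert (P : forall r, Rabs r = y ->
   Cmod (/ (RtoC x * tau + RtoC r) ^ 2 - / ((RtoC x * tau + RtoC r) ^ 2 - RtoC (1 / 4)))%C
   <= 4 * B ^ 4 * (/ x ^ 2 * / y ^ 2)).
{ intros r Hr. destruct (tele_factor x r tau) as [_ E]; [lra|auto|].
  assert (h0 := lattice_neq_0 x r tau ltac:(lra) Ht).
  assert (h1 := lattice_neq_0 x (r - 1 / 2) tau ltac:(lra) Ht).
  assert (h2 := lattice_neq_0 x (r + 1 / 2) tau ltac:(lra) Ht).
  assert (L1 := inv_lattice_bound B x r (x + y) tau HB ltac:(lra) Ht ltac:(lra) (H x r ltac:(lra)) ltac:(lra)).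
  assert (Q : forall s, Rabs s = 1 / 2 -> (x + y) / 2 <= x + Rabs (r + s)).
  { intros s Hs. generalize (Rabs_triang_inv r (- s)). rewrite Rabs_Ropp.
    replace (r - - s) with (r + s) by ring. lra. }
  assert (L2 := inv_lattice_bound B x (r - 1 / 2) ((x + y) / 2) tau HB ltac:(lra) Ht ltac:(lra) (H x _ ltac:(lra))
     (Q (- (1 / 2)) ltac:(rewrite Rabs_Ropp, Rabs_pos_eq; lra))).
  assert (L3 := inv_lattice_bound B x (r + 1 / 2) ((x + y) / 2) tau HB ltac:(lra) Ht ltac:(lra) (H x _ ltac:(lra))
     (Q (1 / 2) ltac:(rewrite Rabs_pos_eq; lra))).
  assert (E2 : (/ (RtoC x * tau + RtoC r) ^ 2 - / ((RtoC x * tau + RtoC r) ^ 2 - RtoC (1 / 4)))%C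
    = (- RtoC (1 / 4) * (/ (RtoC x * tau + RtoC r) * / (RtoC x * tau + RtoC r))
        * (/ (RtoC x * tau + RtoC (r - 1 / 2)) * / (RtoC x * tau + RtoC (r + 1 / 2))))%C).
  { replace (- RtoC (1 / 4))%C with ((RtoC x * tau + RtoC (r - 1 / 2)) * (RtoC x * tau + RtoC (r + 1 / 2))
      - (RtoC x * tau + RtoC r) ^ 2)%C by (rewrite <- E; ring).
    rewrite E.
    set (u := (RtoC x * tau + RtoC (r - 1 / 2))%C) in *.
    set (v := (RtoC x * tau + RtoC (r + 1 / 2))%C) in *.
    simpl. field. auto. }
  rewrite E2, !Cmod_mult, Cmod_opp, Cmod_R, Rabs_pos_eq by lra.
  set (X := Cmod (/ (RtoC x * tau + RtoC r))%C) in *.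
  set (Y := Cmod (/ (RtoC x * tau + RtoC (r - 1 / 2)))%C) in *.
  set (Z := Cmod (/ (RtoC x * tau + RtoC (r + 1 / 2)))%C) in *.
  assert (0 <= X) by apply Cmod_ge_0. assert (0 <= Y) by apply Cmod_ge_0.
  assert (0 <= Z) by apply Cmod_ge_0.
  assert (Hbc : 0 < B / (x + y)) by (apply Rdiv_lt_0_compat; lra).
  replace (B / ((x + y) / 2)) with (2 * (B / (x + y))) in L2, L3 by (field; lra).
  assert (X * X <= B / (x + y) * (B / (x + y))) by (apply Rmult_le_compat; auto).
  assert (Y * Z <= 2 * (B / (x + y)) * (2 * (B / (x + y)))) by (apply Rmult_le_compat; auto).
  apply Rle_trans with (1 / 4 * ((B / (x + y) * (B / (x + y))) * (2 * (B / (x + y)) * (2 * (B / (x + y)))))).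
  - rewrite Rmult_assoc. apply Rmult_le_compat_l; [lra|].
    apply Rmult_le_compat; auto; now apply Rmult_le_pos.
  - replace (1 / 4 * ((B / (x + y) * (B / (x + y))) * (2 * (B / (x + y)) * (2 * (B / (x + y))))))
      with (B ^ 4 * / (x + y) ^ 4) by (field; lra).
    pose proof (inv_sum_pow_4_le x y ltac:(lra) ltac:(lra)).
    assert (0 < B ^ 4) by now apply pow_lt.
    assert (0 < / (x + y) ^ 4) by (apply Rinv_0_lt_compat, pow_lt; lra). nra. }
match goal with |- Cmod (?a + ?b - (?c + ?d))%C <= _ =>
  replace (a + b - (c + d))%C with ((a - c) + (b - d))%C by ring end.
eapply Rle_trans; [apply Cmod_triangle|].
assert (P1 := P y ltac:(apply Rabs_pos_eq; lra)).
assert (P2 := P (- y) ltac:(rewrite Rabs_Ropp; apply Rabs_pos_eq; lra)). lra.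
Qed.

Lemma inv_shift_eventually_small (z : C) (s : R) (eps : R) : (s = 1 \/ s = -1) -> 0 < eps ->
  exists N, forall n, (N <= n)%nat -> Cmod (/ (z + RtoC (s * (INR n + 1 / 2))))%C <= eps.
Proof.
intros Hs He. pose proof (Cmod_ge_0 z).
destruct (nfloor_ex (Cmod z + / eps)) as [N HN].
{ assert (0 < / eps) by now apply Rinv_0_lt_compat. lra. }
exists (S N). intros n Hn. apply le_INR in Hn. rewrite S_INR in Hn.
assert (H1 : / eps <= Cmod (z + RtoC (s * (INR n + 1 / 2)))%C).
{ generalize (Cmod_triangle_rev (RtoC (s * (INR n + 1 / 2))) z).
  rewrite Cmod_R, Rabs_mult, (Rabs_pos_eq (INR n + 1 / 2)), Cplus_comm by (generalize (pos_INR n); lra).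
  replace (Rabs s) with 1; [lra|]. destruct Hs as [-> | ->]; unfold Rabs; destruct Rcase_abs; lra. }
assert (0 < / eps) by now apply Rinv_0_lt_compat.
rewrite Cmod_inv by (apply Cmod_pos_neq; lra).
rewrite <- (Rinv_inv eps). apply Rinv_le_contravar; auto.
Qed.

(** The boundary term of the telescoping in n. Summed over m at fixed w it becomes a cotangent
    series at -w/tau. *)
Definition col_kernel (w : R) (m : nat) (tau : C) : C :=
  (/ (RtoC (INR (S m)) * tau + RtoC w) - / (RtoC (INR (S m)) * tau + RtoC (- w)))%C.

Lemma tele_col (m n : nat) (tau : C) : 0 < Im tau ->
  tele m n tau = (col_kernel (INR n + 1 / 2) m tau - col_kernel (INR (S n) + 1 / 2) m tau)%C.
Proof.
intros Ht. pose proof (INR_S_ge_1 m). unfold tele, col_kernel.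
destruct (tele_factor (INR (S m)) (INR (S n)) tau) as [-> _]; [lra|auto|].
destruct (tele_factor (INR (S m)) (- INR (S n)) tau) as [-> _]; [lra|auto|].
rewrite (S_INR n).
replace (INR n + 1 - 1 / 2) with (INR n + 1 / 2) by field.
replace (- (INR n + 1) - 1 / 2) with (- (INR n + 1 + 1 / 2)) by field.
replace (- (INR n + 1) + 1 / 2) with (- (INR n + 1 / 2)) by field. ring.
Qed.

Lemma summable_tele_row (m : nat) (tau : C) : 0 < Im tau -> summable (fun n => tele m n tau).
Proof.
intros Ht. destruct (quad_2_tele_bound tau Ht) as [K HK].
eapply summable_ext.
2:{ apply (summable_minus (fun n => quad 2 m n tau) (fun n => quad 2 m n tau - tele m n tau)%C).
    - apply summable_quad; auto.
    - eapply summable_le; [apply HK|]. apply ex_series_scalR, ex_series_scalR, ex_series_inv_sq. }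
intros n. cbn beta. ring.
Qed.

Lemma CSeries_tele_row (m : nat) (tau : C) : 0 < Im tau ->
  CSeries (fun n => tele m n tau) = col_kernel (1 / 2) m tau.
Proof.
intros Ht. pose proof (summable_tele_row m tau Ht) as Hs.
set (u := fun n => col_kernel (INR n + 1 / 2) m tau).
assert (E : forall n, tele m n tau = (u n - u (S n))%C) by (intros n; now apply tele_col).
rewrite (CSeries_ext _ _ E). rewrite CSeries_telescope.
- unfold u. f_equal. simpl. ring.
- intros eps He.
  destruct (inv_shift_eventually_small (RtoC (INR (S m)) * tau)%C 1 (eps / 2)) as [N1 H1]; [auto|lra|].
  destruct (inv_shift_eventually_small (RtoC (INR (S m)) * tau)%C (-1) (eps / 2)) as [N2 H2]; [auto|lra|].
  exists (N1 + N2)%nat. intros n Hn.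
  specialize (H1 n ltac:(lia)). specialize (H2 n ltac:(lia)).
  unfold u, col_kernel. unfold Cminus. eapply Rle_trans; [apply Cmod_triangle|]. rewrite Cmod_opp.
  replace (1 * (INR n + 1 / 2)) with (INR n + 1 / 2) in H1 by ring.
  replace (-1 * (INR n + 1 / 2)) with (- (INR n + 1 / 2)) in H2 by ring. lra.
- eapply summable_ext; [exact E|exact Hs].
Qed.

(** Passes from the pairing of n with -(n+1) to that of n+1 with -(n+1). The correction 1/(u+n) -
    1/(u+n+1) telescopes to 1/u. *)
Lemma cot_series_symmetric (u : C) : 0 < Im u ->
  summable (fun n => / (u + RtoC (INR (S n))) + / (u + RtoC (- INR (S n))))%C /\
  CSeries (fun n => / (u + RtoC (INR (S n))) + / (u + RtoC (- INR (S n))))%C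
  = (cot_series u - / u)%C.
Proof.
intros Hu. pose proof (summable_cot u Hu) as Hs.
set (v := fun n => (/ (u + RtoC (INR n)))%C).
assert (Hv : summable (fun n => v n - v (S n))%C).
{ destruct (shift_lower_bound INR u spread_pos Hu) as (B & HB & H).
  eapply summable_le; [|apply (ex_series_scalR (B * B)), ex_series_inv_sq].
  intros n. unfold v.
  assert (h1 := upper_neq_0 u (INR n) Hu). assert (h2 := upper_neq_0 u (INR (S n)) Hu).
  replace (/ (u + INR n) - / (u + INR (S n)))%C with (/ (u + INR n) * / (u + INR (S n)))%C.
  2:{ rewrite S_INR, RtoC_plus in *. field. auto. }
  rewrite Cmod_mult, !Cmod_inv by auto.
  replace (B * B * / INR (S n) ^ 2) with ((B * / INR (S n)) * (B * / INR (S n))).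
  2:{ field. apply not_0_INR; lia. }
  assert (0 < Cmod (u + INR n)%C) by now apply Cmod_gt_0.
  assert (0 < Cmod (u + INR (S n))%C) by now apply Cmod_gt_0.
  apply Rmult_le_compat; auto; try now apply Rlt_le, Rinv_0_lt_compat.
  eapply Rle_trans; [apply H|]. apply Rmult_le_compat_l; [lra|].
  apply Rinv_le_contravar; [apply lt_0_INR; lia|]. apply le_INR; lia. }
assert (E : forall n, (/ (u + RtoC (INR (S n))) + / (u + RtoC (- INR (S n))))%C
   = ((/ (u + RtoC (INR n)) + / (u + RtoC (- INR (S n)))) - (v n - v (S n)))%C)
  by (intros n; unfold v; ring).
split.
- eapply summable_ext; [intros n; symmetry; apply E|]. now apply summable_minus.
- rewrite (CSeries_ext _ _ E), CSeries_minus by auto. rewrite (CSeries_telescope v); auto.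
  2:{ intros eps He.
    destruct (inv_shift_eventually_small (u - RtoC (1 / 2))%C 1 eps ltac:(auto) He) as [N HN].
    exists N. intros n Hn. specialize (HN n Hn). unfold v.
    replace (u + RtoC (INR n))%C with (u - RtoC (1 / 2) + RtoC (1 * (INR n + 1 / 2)))%C; auto.
    rewrite Rmult_1_l, RtoC_plus. ring. }
  fold (cot_series u). unfold v. change (INR 0) with 0. now rewrite Cplus_0_r.
Qed.

Lemma S_transform_scal (w : R) (tau : C) : 0 < w -> 0 < Im tau -> 0 < Im (RtoC w * - / tau)%C.
Proof. intros. apply Im_scal_pos; auto. now apply S_transform_im. Qed.

Lemma col_kernel_cot (w : R) (m : nat) (tau : C) : 0 < w -> 0 < Im tau ->
  col_kernel w m tau = (- / tau * (/ (RtoC w * - / tau + RtoC (INR (S m)))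
    + / (RtoC w * - / tau + RtoC (- INR (S m)))))%C.
Proof.
intros Hw Ht. destruct (S_transform_im tau Ht) as [Ht' H0].
pose proof (INR_S_ge_1 m).
assert (h1 := lattice_neq_0 (INR (S m)) w tau ltac:(lra) Ht).
assert (h2 := lattice_neq_0 (INR (S m)) (- w) tau ltac:(lra) Ht).
unfold col_kernel.
replace (RtoC w * - / tau + RtoC (INR (S m)))%C with
  ((RtoC (INR (S m)) * tau + RtoC (- w)) * / tau)%C by (rewrite RtoC_opp; field; auto).
replace (RtoC w * - / tau + RtoC (- INR (S m)))%C with
  (- (RtoC (INR (S m)) * tau + RtoC w) * / tau)%C by (rewrite RtoC_opp; field; auto).
set (x := (RtoC (INR (S m)) * tau + RtoC w)%C) in *.
set (y := (RtoC (INR (S m)) * tau + RtoC (- w))%C) in *.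
field. auto.
Qed.

Definition col_sum (w : R) (tau : C) : C := CSeries (fun m => col_kernel w m tau).

Lemma col_sum_cot (w : R) (tau : C) : 0 < w -> 0 < Im tau ->
  summable (fun m => col_kernel w m tau) /\
  col_sum w tau = (- / tau * (cot_series (RtoC w * - / tau) - / (RtoC w * - / tau)))%C.
Proof.
intros Hw Ht. destruct (cot_series_symmetric _ (S_transform_scal w tau Hw Ht)) as [S1 S2].
assert (E : forall m, col_kernel w m tau = (- / tau * (/ (RtoC w * - / tau + RtoC (INR (S m)))
    + / (RtoC w * - / tau + RtoC (- INR (S m)))))%C) by (intros; now apply col_kernel_cot).
split.
- eapply summable_ext; [intros; symmetry; apply E|]. now apply summable_scal.
- unfold col_sum. rewrite (CSeries_ext _ _ E), CSeries_scal, S2 by auto. reflexivity.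
Qed.

(** As w grows, Im(-w/tau) tends to infinity and the cotangent to -i, so -(1/tau) pi cot(-pi w/tau)
    tends to pi i / tau. This nonzero limit is the source of the quasi-modular term. *)
Lemma col_sum_limit (tau : C) (eps : R) : 0 < Im tau -> 0 < eps ->
  exists N, forall n, (N <= n)%nat ->
    Cmod (col_sum (INR n + 1 / 2) tau - RtoC PI * Ci * / tau)%C <= eps.
Proof.
intros Ht He. destruct (S_transform_im tau Ht) as [Ht' H0].
pose proof PI_RGT_0 as HPI. assert (Hm : 0 < Cmod tau) by now apply Cmod_gt_0.
set (th := Im (- / tau)%C) in *.
(* The nome term contributes at most 1/(th |tau| w) and the subtracted pole contributes 1/w. *)
set (K := / th * / Cmod tau + 1).
assert (HK : 0 < K).
{ unfold K. assert (0 < / th * / Cmod tau) by (apply Rmult_lt_0_compat; now apply Rinv_0_lt_compat). lra. }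
destruct (nfloor_ex (K / eps)) as [N HN].
{ apply Rlt_le, Rdiv_lt_0_compat; auto. }
exists (S N). intros n Hn. apply le_INR in Hn. rewrite S_INR in Hn.
set (w := INR n + 1 / 2). assert (Hw : 0 < w) by (unfold w; generalize (pos_INR n); lra).
assert (HKw : K / w <= eps).
{ apply Rmult_le_reg_r with (w / eps); [now apply Rdiv_lt_0_compat|].
  replace (K / w * (w / eps)) with (K / eps) by (field; lra).
  replace (eps * (w / eps)) with w by (field; lra). unfold w; lra. }
apply Rle_trans with (2 := HKw).
destruct (col_sum_cot w tau Hw Ht) as [_ ->].
set (u := (RtoC w * - / tau)%C).
assert (Hu : 0 < Im u) by now apply S_transform_scal.
rewrite cot_formula by auto.
pose proof (Cmod_nome_lt_1 u Hu) as Hq. set (q := nome u) in *.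
assert (Hq1 := one_minus_neq_0 q ltac:(lra)).
assert (Hwc : RtoC w <> 0%C) by (intros E; apply RtoC_inj in E; lra).
replace (- / tau * (- (RtoC PI * Ci) * (1 + q) / (1 - q) - / u) - RtoC PI * Ci * / tau)%C
  with (RtoC (2 * PI) * Ci * / tau * q * / (1 - q) - / RtoC w)%C.
2:{ unfold u. rewrite RtoC_mult. field. auto. }
unfold Cminus at 1. eapply Rle_trans; [apply Cmod_triangle|].
rewrite Cmod_opp, !Cmod_mult, Cmod_Ci, !Cmod_inv, !Cmod_R, !Rabs_pos_eq by (auto; lra).
set (t := 2 * PI * (w * th)).
assert (Htt : 0 < t) by (unfold t; apply Rmult_lt_0_compat; [lra|now apply Rmult_lt_0_compat]).
assert (Hqt : Cmod q * / Cmod (1 - q)%C <= / t).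
{ assert (Hd : 1 - Cmod q <= Cmod (1 - q)%C).
  { generalize (Cmod_triangle_rev 1 (- q)). rewrite Cmod_1, Cmod_opp. auto. }
  assert (Hqe : Cmod q = exp (- t)).
  { unfold q. rewrite Cmod_nome. f_equal. unfold t, u, th. destruct (- / tau)%C; simpl. ring. }
  assert (Hqi : Cmod q * (1 + t) <= 1).
  { rewrite Hqe, exp_Ropp. pose proof (exp_pos t). pose proof (exp_ineq1_le t).
    apply Rle_trans with (/ exp t * exp t); [|right; field; lra].
    apply Rmult_le_compat_l; [apply Rlt_le, Rinv_0_lt_compat; lra|lra]. }
  apply Rmult_le_reg_r with (t * Cmod (1 - q)%C); [apply Rmult_lt_0_compat; lra|].
  replace (Cmod q * / Cmod (1 - q) * (t * Cmod (1 - q))) with (Cmod q * t) by (field; lra).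
  replace (/ t * (t * Cmod (1 - q))) with (Cmod (1 - q)%C) by (field; lra). lra. }
replace (K / w) with (2 * PI * 1 * / Cmod tau * / t + / w).
2:{ unfold K, t. field. lra. }
apply Rplus_le_compat_r. rewrite Rmult_assoc. apply Rmult_le_compat_l; auto.
assert (0 < / Cmod tau) by now apply Rinv_0_lt_compat. nra.
Qed.

(** The two iterated sums of [quad 2] - [tele] agree. In the row order [tele] telescopes down to 0,
    in the column order down to pi i / tau, and the mismatch is the last term of the formula. *)
Lemma eis_2_transform (tau : C) : 0 < Im tau ->
  (/ tau ^ 2 * eis 2 (- / tau) - eis 2 tau)%C =
  (RtoC (zeta 2) * (1 - / tau ^ 2) - RtoC PI * Ci * / tau)%C.
Proof.
intros Ht. destruct (S_transform_im tau Ht) as [Ht' H0].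
assert (Hev : Nat.Even 2) by now exists 1%nat.
destruct (quad_2_tele_bound tau Ht) as [K HK].
destruct (CSeries_exchange_inv_sq (fun m n => quad 2 m n tau - tele m n tau)%C K HK)
  as (C0 & C1 & C2 & C3).
assert (R1 : forall m, CSeries (fun n => quad 2 m n tau - tele m n tau)%C =
  (Zsum 2 (RtoC (INR (S m)) * tau) - / tau ^ 2 * RtoC (/ INR (S m) ^ 2) - col_kernel (1 / 2) m tau)%C).
{ intros m. rewrite CSeries_minus by (auto using summable_tele_row; now apply summable_quad).
  rewrite CSeries_tele_row, CSeries_quad_row, inv_scal_pow by auto. reflexivity. }
destruct (col_sum_cot (1 / 2) tau ltac:(lra) Ht) as [T1 _].
destruct (summable_zeta_term 2 (/ tau ^ 2)%C) as [Z1 Z2]; [lia|].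
assert (L : CSeries (fun m => CSeries (fun n => quad 2 m n tau - tele m n tau)%C) =
  (eis 2 tau - / tau ^ 2 * RtoC (zeta 2) - col_sum (1 / 2) tau)%C).
{ rewrite (CSeries_ext _ _ R1).
  assert (SZ : summable (fun m => Zsum 2 (RtoC (INR (S m)) * tau)%C)).
  { eapply summable_ext; [|apply (summable_plus _ _ C1 (summable_plus _ _ Z1 T1))].
    intros m. cbn beta. rewrite R1. ring. }
  rewrite CSeries_minus, CSeries_minus, Z2; auto. now apply summable_minus. }
rewrite C3 in L.
(* Subtracting the limit makes [v] tend to 0, as [CSeries_telescope] requires. *)
set (v := fun n => (col_sum (INR n + 1 / 2) tau - RtoC PI * Ci * / tau)%C).
assert (Hcol : forall n, summable (fun m => tele m n tau)).
{ intros n. eapply summable_ext.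
  2:{ apply (summable_minus (fun m => quad 2 m n tau) (fun m => quad 2 m n tau - tele m n tau)%C).
    - now apply summable_quad_col.
    - apply C0. }
  intros m. cbn beta. ring. }
assert (R2 : forall n, CSeries (fun m => quad 2 m n tau - tele m n tau)%C =
  (/ tau ^ 2 * Zsum 2 (RtoC (INR (S n)) * (- / tau)) - 1 * RtoC (/ INR (S n) ^ 2) - (v n - v (S n)))%C).
{ intros n. rewrite CSeries_minus by (auto; now apply summable_quad_col).
  rewrite CSeries_quad_col, CSeries_quad_row, inv_scal_pow by (auto; intros E; apply S_transform_im in Ht;
    apply (f_equal Im) in E; change (Im 0) with 0 in E; lra).
  replace (CSeries (fun m => tele m n tau)) with (v n - v (S n))%C.
  - simpl. field. auto.
  - rewrite (CSeries_ext (fun m => tele m n tau) (fun m => col_kernel (INR n + 1 / 2) m tau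
      - col_kernel (INR (S n) + 1 / 2) m tau)%C) by (intros m; now apply tele_col).
    rewrite CSeries_minus.
    + unfold v, col_sum. ring.
    + apply col_sum_cot; auto. generalize (pos_INR n); lra.
    + apply col_sum_cot; auto. generalize (pos_INR (S n)); lra. }
destruct (summable_zeta_term 2 1%C) as [Y1 Y2]; [lia|].
(* The bound is used again at -1/tau, this time only to obtain the summability of the rows of
   [eis 2] at -1/tau. *)
destruct (quad_2_tele_bound (- / tau)%C Ht') as [K' HK'].
destruct (CSeries_exchange_inv_sq (fun m n => quad 2 m n (- / tau) - tele m n (- / tau))%C K' HK')
  as (_ & C1' & _ & _).
destruct (col_sum_cot (1 / 2) (- / tau)%C ltac:(lra) Ht') as [T1' _].
destruct (summable_zeta_term 2 (/ (- / tau) ^ 2)%C) as [Z1' _]; [lia|].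
assert (SZ' : summable (fun n => Zsum 2 (RtoC (INR (S n)) * (- / tau))%C)).
{ eapply summable_ext; [|apply (summable_plus _ _ C1' (summable_plus _ _ Z1' T1'))].
  intros m. cbn beta.
  rewrite CSeries_minus by (auto using summable_tele_row; now apply summable_quad).
  rewrite CSeries_tele_row, CSeries_quad_row, inv_scal_pow by (auto; intros E;
    apply (f_equal Im) in E; change (Im 0) with 0 in E; lra).
  ring. }
assert (SV : summable (fun n => v n - v (S n))%C).
{ eapply summable_ext; [|apply (summable_minus _ _ (summable_minus _ _
     (summable_scal (/ tau ^ 2)%C _ SZ') Y1) C2)].
  intros n. cbn beta. rewrite R2. ring. }
rewrite (CSeries_ext _ _ R2) in L.
rewrite CSeries_minus, CSeries_minus, Y2, CSeries_scal, (CSeries_telescope v) in L;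
  auto using summable_scal, summable_minus.
2:{ intros eps He. exact (col_sum_limit tau eps Ht He). }
fold (eis 2 (- / tau)%C) in L. unfold v in L. change (INR 0) with 0 in L. rewrite Rplus_0_l in L.
set (A := eis 2 (- / tau)%C) in *. set (E := eis 2 tau) in *. set (S0 := col_sum (1 / 2) tau) in *.
transitivity ((/ tau ^ 2 * A - 1 * zeta 2 - (S0 - PI * Ci * / tau)) - (E - / tau ^ 2 * zeta 2 - S0)
  + (RtoC (zeta 2) * (1 - / tau ^ 2) - RtoC PI * Ci * / tau))%C.
- ring.
- rewrite L. ring.
Qed.

(** * The discriminant *)

Lemma pow_le_anti (r : R) (m n : nat) : 0 <= r <= 1 -> (n <= m)%nat -> r ^ m <= r ^ n.
Proof.
intros Hr Hn. replace m with (n + (m - n))%nat by lia. rewrite pow_add.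
assert (0 <= r ^ n) by (apply pow_le; lra).
assert (r ^ (m - n) <= 1) by (rewrite <- (pow1 (m - n)); apply pow_incr; lra). nra.
Qed.

Lemma mlog1m_bound (w : C) (r : R) : Cmod w <= r -> r < 1 -> Cmod (mlog1m w) <= Cmod w * / (1 - r).
Proof.
intros Hw Hr. pose proof (Cmod_ge_0 w).
unfold mlog1m. rewrite CSeries_incr_1 by (apply summable_mlog1m; lra).
change (INR 0) with 0. rewrite Rinv_0, Cmult_0_l, Cplus_0_l.
apply Rle_trans with (Cmod w * / (1 - Cmod w)).
2:{ apply Rmult_le_compat_l; auto. apply Rinv_le_contravar; lra. }
rewrite <- (Series_geom (Cmod w)) by (rewrite Rabs_pos_eq; lra). rewrite <- Series_scal_l.
apply Cmod_CSeries_le.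
- intros n. destruct (Cmod_inv_INR (S n)) as [E Hi]. rewrite Cmod_mult, E, Cmod_pow.
  change (Cmod w ^ S n) with (Cmod w * Cmod w ^ n).
  assert (0 <= Cmod w * Cmod w ^ n) by (apply Rmult_le_pos; auto; now apply pow_le). nra.
- apply ex_series_scalR, ex_series_geom. rewrite Rabs_pos_eq; lra.
Qed.

(** Minus the logarithm of the Euler product of the factors 1 - q^n, n >= 1. *)
Definition eta_log (q : C) : C := CSeries (fun n => mlog1m (q ^ S n)%C).

Lemma pow_S_le (r : R) (n : nat) : 0 <= r < 1 -> 0 <= r ^ S n <= r.
Proof.
intros Hr. split; [apply pow_le; lra|]. simpl. rewrite <- (Rmult_1_r r) at 3.
apply Rmult_le_compat_l; [lra|]. rewrite <- (pow1 n). apply pow_incr; lra.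
Qed.

Lemma Cmod_pow_S (q : C) (n : nat) : Cmod q < 1 -> Cmod (q ^ S n)%C <= Cmod q.
Proof. intros Hq. rewrite Cmod_pow. apply pow_S_le. split; auto using Cmod_ge_0. Qed.

Lemma summable_eta_log (q : C) : Cmod q < 1 -> summable (fun n => mlog1m (q ^ S n)%C).
Proof.
intros Hq. pose proof (Cmod_ge_0 q).
eapply summable_le; [|apply (ex_series_scalR (/ (1 - Cmod q) * Cmod q)), (ex_series_geom (Cmod q))].
- intros n. eapply Rle_trans; [apply (mlog1m_bound _ (Cmod q)); auto using Cmod_pow_S|].
  rewrite Cmod_pow. simpl. right. ring.
- rewrite Rabs_pos_eq; auto.
Qed.

(** [pow_remainder] is applied to every power z^(N j) in the logarithm series. The inequality rho^(N
    j) <= rho^N rho^(j-1) for j >= 1 separates j from N, so the bound can still be summed over N. *)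
Lemma mlog1m_pow_remainder (N : nat) (z h : C) (rho : R) : (1 <= N)%nat -> 0 < rho < 1 ->
  Cmod z <= rho -> Cmod (z + h)%C <= rho ->
  Cmod (mlog1m ((z + h) ^ N) - mlog1m (z ^ N)
     - h * (RtoC (INR N) * z ^ pred N * / (1 - z ^ N)))%C
  <= Series (fun j => INR j ^ 1 * rho ^ j) / rho ^ 3 * (INR N ^ 2 * rho ^ N) * Cmod h ^ 2.
Proof.
intros HN Hr Hz Hzh. destruct N as [|N']; [lia|]. set (N := S N') in *. cbn [pred].
assert (HP : forall w, Cmod w <= rho -> Cmod (w ^ N)%C < 1).
{ intros w Hw. eapply Rle_lt_trans; [apply Cmod_pow_S; lra|]. lra. }
pose proof (HP z Hz) as Hz1. pose proof (HP _ Hzh) as Hzh1.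
assert (Hd : (RtoC (INR N) * z ^ pred N * / (1 - z ^ N))%C =
   CSeries (fun j => RtoC (/ INR j) * (RtoC (INR (N * j)) * z ^ pred (N * j)))%C /\
   summable (fun j => RtoC (/ INR j) * (RtoC (INR (N * j)) * z ^ pred (N * j)))%C).
{ assert (E : forall j, (RtoC (/ INR (S j)) * (RtoC (INR (N * S j)) * z ^ pred (N * S j)))%C
    = (RtoC (INR N) * z ^ pred N * (z ^ N) ^ j)%C).
  { intros j. rewrite <- Cpow_mult_r. replace (pred (N * S j)) with (pred N + N * j)%nat by (unfold N; simpl; lia).
    rewrite Cpow_add_r, mult_INR, RtoC_mult.
    transitivity (RtoC (/ INR (S j)) * RtoC (INR (S j)) * (RtoC (INR N) * (z ^ Init.Nat.pred N * z ^ (N * j))))%C; [ring|].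
    rewrite <- RtoC_mult, Rinv_l by (apply not_0_INR; lia). ring. }
  assert (Hs : summable (fun j => RtoC (/ INR j) * (RtoC (INR (N * j)) * z ^ pred (N * j)))%C).
  { apply summable_incr_1. eapply summable_ext; [intros; symmetry; apply E|].
    apply summable_scal, summable_geom; auto. }
  split; auto. rewrite CSeries_incr_1, (CSeries_ext _ _ E), CSeries_scal, CSeries_geom
    by (auto; now apply summable_geom).
  change (INR 0) with 0. rewrite Rinv_0, Cmult_0_l. ring. }
cbn [pred] in Hd. destruct Hd as [-> Hd].
unfold mlog1m. rewrite <- CSeries_scal by auto.
rewrite <- CSeries_minus by now apply summable_mlog1m.
rewrite <- CSeries_minus by (auto using summable_scal; apply summable_minus; now apply summable_mlog1m).
unfold Rdiv. rewrite !Rmult_assoc, Rmult_comm, <- Series_scal_l.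
apply Cmod_CSeries_le.
2:{ apply ex_series_scalR. apply ex_series_pow_geom; lra. }
intros j. rewrite <- !Cpow_mult_r.
match goal with |- Cmod ?X <= _ => replace X with
  (RtoC (/ INR j) * ((z + h) ^ (N * j) - z ^ (N * j) - h * (RtoC (INR (N * j)) * z ^ pred (N * j))))%C by ring end.
destruct (Cmod_inv_INR j) as [Ei Hi]. rewrite Cmod_mult, Ei.
pose proof (pow_remainder z h rho (N * j) ltac:(lra) Hz Hzh) as H.
apply Rmult_le_compat_l with (r := / INR j) in H; [|lra].
eapply Rle_trans; [exact H|].
destruct j as [|j].
{ simpl. rewrite Rinv_0. lra. }
assert (Hj := INR_S_ge_1 j).
assert (Hpow : rho ^ (N * S j) <= rho ^ N * rho ^ j).
{ rewrite <- pow_add. apply pow_le_anti; [lra|]. unfold N. simpl. nia. }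
rewrite mult_INR.
replace (/ INR (S j) * ((INR N * INR (S j)) ^ 2 * rho ^ (N * S j) / rho ^ 2 * Cmod h ^ 2))
  with (INR (S j) * INR N ^ 2 * Cmod h ^ 2 * / rho ^ 2 * rho ^ (N * S j)) by (field; lra).
replace (/ rho ^ 3 * (INR N ^ 2 * (rho ^ N * Cmod h ^ 2)) * (INR (S j) ^ 1 * rho ^ S j))
  with (INR (S j) * INR N ^ 2 * Cmod h ^ 2 * / rho ^ 2 * (rho ^ N * rho ^ j))
  by (simpl (rho ^ S j); field; lra).
apply Rmult_le_compat_l; auto.
assert (0 <= / rho ^ 2) by (apply Rlt_le, Rinv_0_lt_compat, pow_lt; lra).
assert (0 <= INR N ^ 2) by apply pow_le, pos_INR.
assert (0 <= Cmod h ^ 2) by apply pow_le, Cmod_ge_0.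
apply Rmult_le_pos; auto. apply Rmult_le_pos; auto. apply Rmult_le_pos; auto; lra.
Qed.

Definition eta_log_der (q : C) : C :=
  CSeries (fun n => RtoC (INR (S n)) * q ^ n * / (1 - q ^ S n))%C.

Lemma inv_one_minus_pow_bound (q : C) (n : nat) : Cmod q < 1 ->
  Cmod (/ (1 - q ^ S n))%C <= / (1 - Cmod q).
Proof.
intros Hq. pose proof (Cmod_pow_S q n Hq).
assert (1 - Cmod q <= Cmod (1 - q ^ S n)%C).
{ generalize (Cmod_triangle_rev 1 (- q ^ S n)). rewrite Cmod_1, Cmod_opp. unfold Cminus. lra. }
rewrite Cmod_inv by (apply one_minus_neq_0; lra). apply Rinv_le_contravar; lra.
Qed.

Lemma summable_eta_log_der (q : C) : Cmod q < 1 ->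
  summable (fun n => RtoC (INR (S n)) * q ^ n * / (1 - q ^ S n))%C.
Proof.
intros Hq. pose proof (Cmod_ge_0 q).
eapply summable_le.
2:{ apply (ex_series_scalR (/ (1 - Cmod q))).
    apply (@ex_series_plus R_AbsRing R_NormedModule).
    - apply (ex_series_pow_geom 1 (Cmod q)); lra.
    - apply (ex_series_pow_geom 0 (Cmod q)); lra. }
intros n. rewrite !Cmod_mult, Cmod_R, Cmod_pow, Rabs_pos_eq, S_INR by apply pos_INR.
pose proof (inv_one_minus_pow_bound q n Hq) as Hb.
unfold plus; simpl.
assert (0 <= Cmod q ^ n) by now apply pow_le. pose proof (pos_INR n).
replace (/ (1 - Cmod q) * (INR n * 1 * Cmod q ^ n + 1 * Cmod q ^ n))
  with ((INR n + 1) * Cmod q ^ n * / (1 - Cmod q)) by ring.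
apply Rmult_le_compat_l; auto. apply Rmult_le_pos; lra.
Qed.

Lemma Cder_eta_log (q : C) : Cmod q < 1 -> Cder eta_log q (eta_log_der q).
Proof.
intros Hq. pose proof (Cmod_ge_0 q). set (rho := (1 + Cmod q) / 2).
assert (Hr : 0 < rho < 1) by (unfold rho; lra).
apply (Cder_CSeries (fun n w => mlog1m (w ^ S n)%C) _ q (rho - Cmod q)
  (fun n => Series (fun j => INR j ^ 1 * rho ^ j) / rho ^ 3 * (INR (S n) ^ 2 * rho ^ S n))).
- unfold rho; lra.
- apply ex_series_scalR. apply (ex_series_incr_1 (fun n => INR n ^ 2 * rho ^ n)).
  apply ex_series_pow_geom; lra.
- intros n h Hh. apply (mlog1m_pow_remainder (S n)); auto; [lia|unfold rho; lra|].
  eapply Rle_trans; [apply Cmod_triangle|]. lra.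
- intros h Hh. apply summable_eta_log. eapply Rle_lt_trans; [apply Cmod_triangle|]. lra.
- now apply summable_eta_log_der.
Qed.

Lemma ex_series_geom_nonneg (r : R) : 0 <= r < 1 -> ex_series (fun n => r ^ n).
Proof. intros. apply ex_series_geom. rewrite Rabs_pos_eq; lra. Qed.

(** Both sides sum n^(k+1) q^(m n) over m, n >= 1: the left one over n first, the right one over m
    first, where the inner sum is geometric. *)
Lemma lambert_exchange (k : nat) (q : C) : Cmod q < 1 ->
  summable (fun m => npow_series (S k) (q ^ S m)%C) /\
  summable (fun n => RtoC (INR (S n) ^ S k) * q ^ S n * / (1 - q ^ S n))%C /\
  CSeries (fun m => npow_series (S k) (q ^ S m)%C) =
  CSeries (fun n => RtoC (INR (S n) ^ S k) * q ^ S n * / (1 - q ^ S n))%C.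
Proof.
intros Hq. pose proof (Cmod_ge_0 q).
destruct (CSeries_exchange_prod
  (fun m n => RtoC (INR (S n) ^ S k) * (q ^ S m) ^ S n)%C
  (fun m => Cmod q ^ m) (fun n => INR (S n) ^ S k * Cmod q ^ S n)) as (S1 & S2 & S3 & S4 & S5).
- now apply ex_series_geom_nonneg.
- apply (ex_series_incr_1 (fun n => INR n ^ S k * Cmod q ^ n)). apply ex_series_pow_geom; lra.
- intros m n. rewrite Cmod_mult, Cmod_R, !Cmod_pow, Rabs_pos_eq by apply pow_le, pos_INR.
  rewrite <- pow_mult.
  replace (Cmod q ^ m * (INR (S n) ^ S k * Cmod q ^ S n)) with (INR (S n) ^ S k * Cmod q ^ (m + S n))
    by (rewrite pow_add; ring).
  (* The domination by a product rests on m + (n+1) <= (m+1)(n+1). *)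
  apply Rmult_le_compat_l; [apply pow_le, pos_INR|]. apply pow_le_anti; [lra|]. nia.
- assert (E1 : forall m, CSeries (fun n => RtoC (INR (S n) ^ S k) * (q ^ S m) ^ S n)%C
    = npow_series (S k) (q ^ S m)%C).
  { intros m. unfold npow_series. rewrite (CSeries_incr_1 (fun n => RtoC (INR n ^ S k) * (q ^ S m) ^ n)%C).
    - change (INR 0) with 0. rewrite pow_i by lia. rewrite Cmult_0_l, Cplus_0_l. reflexivity.
    - apply summable_npow. eapply Rle_lt_trans; [now apply Cmod_pow_S|auto]. }
  assert (E2 : forall n, CSeries (fun m => RtoC (INR (S n) ^ S k) * (q ^ S m) ^ S n)%C
    = (RtoC (INR (S n) ^ S k) * q ^ S n * / (1 - q ^ S n))%C).
  { intros n. assert (Hn : Cmod (q ^ S n)%C < 1) by (eapply Rle_lt_trans; [now apply Cmod_pow_S|auto]).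
    rewrite (CSeries_ext _ (fun m => RtoC (INR (S n) ^ S k) * q ^ S n * (q ^ S n) ^ m)%C).
    - rewrite CSeries_scal, CSeries_geom; auto. now apply summable_geom.
    - intros m. rewrite <- !Cpow_mult_r, <- Cmult_assoc, <- Cpow_add_r. do 2 f_equal. lia. }
  rewrite (CSeries_ext _ _ E1), (CSeries_ext _ _ E2) in S5. repeat split; auto.
  + eapply summable_ext; [apply E1|exact S3].
  + eapply summable_ext; [apply E2|exact S4].
Qed.

Lemma nome_scal (m : nat) (tau : C) : nome (RtoC (INR m) * tau)%C = (nome tau ^ m)%C.
Proof. rewrite !nome_Cexp, Cexp_nat. f_equal. ring. Qed.

Lemma eis_npow (k : nat) (tau : C) : 0 < Im tau ->
  eis (S (S k)) tau = (lip (S k) * CSeries (fun m => npow_series (S k) (nome tau ^ S m)%C))%C.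
Proof.
intros Ht. pose proof (Cmod_nome_lt_1 tau Ht).
rewrite <- CSeries_scal by (apply lambert_exchange; lra).
apply CSeries_ext. intros m. rewrite Lipschitz_formula.
- now rewrite nome_scal.
- lia.
- apply Im_scal_pos; auto. apply lt_0_INR; lia.
Qed.

(** The logarithmic derivative of the Euler product is a Lambert series, which the Lipschitz formula
    turns into the lattice sum of weight 2. *)
Lemma eta_log_der_eis (tau : C) : 0 < Im tau ->
  (RtoC (- (4 * PI ^ 2)) * (nome tau * eta_log_der (nome tau)))%C = eis 2 tau.
Proof.
intros Ht. pose proof (Cmod_nome_lt_1 tau Ht).
rewrite eis_npow by auto. destruct (lambert_exchange 0 (nome tau)) as (_ & _ & ->); [lra|].
f_equal.
- unfold lip. simpl fact. change (INR 1) with 1. rewrite Rinv_1.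
  replace (- (4 * PI ^ 2)) with (2 * PI * (2 * PI) * - (1)) by ring.
  rewrite !RtoC_mult, RtoC_opp. simpl.
  transitivity (RtoC 2 * PI * (RtoC 2 * PI) * (Ci * Ci))%C; [rewrite Ci2; ring|]. ring.
- unfold eta_log_der. rewrite <- CSeries_scal by (apply summable_eta_log_der; lra).
  apply CSeries_ext. intros n. rewrite pow_1. cbn [Cpow]. ring.
Qed.

(** A logarithm of 1/Delta, where Delta is the discriminant, q times the 24th power of the Euler
    product. *)
Definition disc_exponent (tau : C) : C :=
  (24 * eta_log (nome tau) - RtoC (2 * PI) * Ci * tau)%C.

Lemma Cder_disc_exponent (tau : C) : 0 < Im tau ->
  Cder disc_exponent tau
    (RtoC (2 * PI) * Ci * (24 * (nome tau * eta_log_der (nome tau)) - 1))%C.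
Proof.
intros Ht. pose proof (Cmod_nome_lt_1 tau Ht). eapply Cder_eq.
- apply Cder_minus.
  + apply Cder_scal. apply (Cder_comp eta_log nome); [apply Cder_nome|apply Cder_eta_log; lra].
  + apply Cder_scal, Cder_id.
- ring.
Qed.

Lemma Cder_S_transform (tau : C) : tau <> 0%C -> Cder (fun t => - / t)%C tau (/ tau ^ 2)%C.
Proof.
intros H. eapply Cder_eq; [apply Cder_opp, Cder_inv; auto|]. simpl. field. auto.
Qed.

Lemma Cder_pow (n : nat) (z : C) : Cder (fun w => w ^ n)%C z (RtoC (INR n) * z ^ pred n)%C.
Proof.
induction n.
- eapply Cder_eq; [exact (Cder_const 1 z)|]. simpl. ring.
- eapply Cder_eq; [apply (Cder_mult (fun w => w) (fun w => w ^ n)%C); [apply Cder_id|exact IHn]|].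
  cbn beta. rewrite S_INR, RtoC_plus. destruct n as [|n]; [simpl; ring|].
  change (pred (S (S n))) with (S n). change (pred (S n)) with n. rewrite !Cpow_S. ring.
Qed.

(** [Psi] is t^12 Delta(t) / Delta(-1/t). It has zero derivative, and at the fixed point i of t ->
    -1/t its value is i^12 = 1. *)
Lemma disc_transform (tau : C) : 0 < Im tau ->
  (tau ^ 12 * Cexp (disc_exponent (- / tau)))%C = Cexp (disc_exponent tau).
Proof.
intros Ht.
set (Psi := fun t => (t ^ 12 * Cexp (disc_exponent (- / t) - disc_exponent t))%C).
assert (HC : Psi tau = Psi Ci).
{ apply (Cder_0_const (fun t => 0 < Im t) Psi); auto.
  - intros a b t Ha Hb H. destruct a as [a1 a2], b as [b1 b2]; simpl in *.
    destruct (Rle_dec t (1 / 2)); nra.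
  - intros z Hz. destruct (S_transform_im z Hz) as [Hz' H0].
    (* [W] is the logarithmic derivative of Delta(t) / Delta(-1/t). The terms with zeta(2) cancel,
       and the quasi-modular term leaves -12/z, which offsets the factor t^12. *)
    set (W := (RtoC (2 * PI) * Ci * (24 * (nome (- / z) * eta_log_der (nome (- / z))) - 1) * / z ^ 2
      - RtoC (2 * PI) * Ci * (24 * (nome z * eta_log_der (nome z)) - 1))%C).
    assert (HW : W = (- (12 * / z))%C).
    { pose proof (eis_2_transform z Hz) as E. rewrite <- !eta_log_der_eis, zeta_2 in E by auto.
      set (A := (nome (- / z) * eta_log_der (nome (- / z)))%C) in *.
      set (B := (nome z * eta_log_der (nome z))%C) in *.
      pose proof PI_RGT_0 as HPI.
      assert (Hpi : RtoC PI <> 0%C) by (intros EE; apply RtoC_inj in EE; lra).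
      replace (RtoC (- (4 * PI ^ 2))) with (- (4 * RtoC PI * RtoC PI))%C in E
        by (rewrite RtoC_opp; simpl; rewrite !RtoC_mult; ring).
      replace (RtoC (PI ^ 2 / 6)) with (RtoC PI * RtoC PI / 6)%C in E
        by (rewrite <- !RtoC_mult, <- RtoC_div by lra; f_equal; field).
      assert (E2 : (/ z ^ 2 * A - B)%C = (- / (4 * RtoC PI * RtoC PI) *
        (RtoC PI * RtoC PI / 6 * (1 - / z ^ 2) - RtoC PI * Ci * / z))%C).
      { rewrite <- E. field. repeat split; auto. }
      unfold W. rewrite RtoC_mult.
      transitivity (2 * RtoC PI * Ci * (24 * (/ z ^ 2 * A - B) + 1 - / z ^ 2))%C; [ring|].
      rewrite E2.
      transitivity (12 * / z * (Ci * Ci))%C; [|rewrite Ci2; ring].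
      simpl. field. auto. }
    eapply Cder_eq.
    + apply Cder_mult; [apply Cder_pow|].
      apply (Cder_comp Cexp (fun t => disc_exponent (- / t) - disc_exponent t)%C); [|apply Cder_Cexp].
      apply Cder_minus; [|now apply Cder_disc_exponent].
      apply (Cder_comp disc_exponent (fun t => - / t)%C); [now apply Cder_S_transform|].
      now apply Cder_disc_exponent.
    + fold W. rewrite HW. replace (INR 12) with 12 by (simpl; ring). simpl. field. auto.
  - simpl. lra. }
assert (H1 : Psi Ci = 1%C).
{ unfold Psi. replace (- / Ci)%C with Ci.
  - replace (disc_exponent Ci - disc_exponent Ci)%C with (RtoC 0) by ring. rewrite Cexp_0.
    transitivity ((Ci * Ci) * (Ci * Ci) * (Ci * Ci) * (Ci * Ci) * (Ci * Ci) * (Ci * Ci))%C; [simpl; ring|].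
    rewrite Ci2. ring.
  - apply C_ext; simpl; field. }
rewrite H1 in HC. unfold Psi in HC.
replace (disc_exponent (- / tau)) with ((disc_exponent (- / tau) - disc_exponent tau) + disc_exponent tau)%C by ring.
rewrite Cexp_plus, Cmult_assoc, HC. ring.
Qed.

(** * The modular invariant *)

Lemma Cprod_n_eta (q : C) (n : nat) : Cmod q < 1 ->
  Cprod_n (fun k => (RtoC 1 - q ^ S k) ^ 24)%C n =
  Cexp (- 24 * psum (fun k => mlog1m (q ^ S k)%C) (S n))%C.
Proof.
intros Hq.
assert (H : forall k, ((RtoC 1 - q ^ S k) ^ 24)%C = Cexp (- 24 * mlog1m (q ^ S k))%C).
{ intros k. rewrite <- Cexp_mlog1m by (eapply Rle_lt_trans; [now apply Cmod_pow_S|auto]).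
  rewrite Cexp_nat. f_equal. replace (INR 24) with 24 by (simpl; ring). ring. }
induction n; cbn [Cprod_n].
- rewrite H. f_equal. cbn [psum]. ring.
- rewrite IHn, H, <- Cexp_plus. f_equal. cbn [psum]. ring.
Qed.

(** Partial products are exponentials of partial sums of -24 [eta_log]. Continuity of [Cexp] gives
    genuine convergence, so the componentwise limits in [CProd] have their intended value. *)
Lemma CProd_eta (q : C) : Cmod q < 1 ->
  CProd (fun k => (RtoC 1 - q ^ S k) ^ 24)%C = Cexp (- 24 * eta_log q)%C.
Proof.
intros Hq. pose proof (summable_eta_log q Hq) as Hs.
set (z := (- 24 * eta_log q)%C).
assert (HL : forall eps : posreal, exists N, forall n, (N <= n)%nat ->
  Cmod (Cprod_n (fun k => (RtoC 1 - q ^ S k) ^ 24)%C n - Cexp z)%C < eps).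
{ intros eps. destruct (Cder_cont _ _ _ (Cder_Cexp z)) as (B & d & HB & Hd & Hc).
  set (e := Rmin d (eps / (B + 1))).
  assert (0 < eps / (B + 1)) by (apply Rdiv_lt_0_compat; [apply cond_pos|lra]).
  assert (He : 0 < e) by (apply Rmin_glb_lt; auto).
  destruct (psum_lim _ (e / 24) Hs) as [N HN]; [lra|].
  exists N. intros n Hn. rewrite Cprod_n_eta by auto.
  specialize (HN (S n) ltac:(lia)).
  set (h := (24 * (eta_log q - psum (fun k => mlog1m (q ^ S k)%C) (S n)))%C).
  assert (Hh : Cmod h < e).
  { unfold h. rewrite Cmod_mult, Cmod_R, Rabs_pos_eq by lra. fold (eta_log q) in HN. lra. }
  replace (- 24 * psum (fun k => mlog1m (q ^ S k)%C) (S n))%C with (z + h)%C by (unfold z, h; ring).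
  assert (H1 : Cmod h < d) by (eapply Rlt_le_trans; [exact Hh|apply Rmin_l]).
  assert (H2 : Cmod h < eps / (B + 1)) by (eapply Rlt_le_trans; [exact Hh|apply Rmin_r]).
  eapply Rle_lt_trans; [now apply Hc|].
  apply Rmult_lt_compat_r with (r := B + 1) in H2; [|lra].
  replace (eps / (B + 1) * (B + 1)) with (pos eps) in H2 by (field; lra).
  pose proof (Cmod_ge_0 h). nra. }
assert (HR : forall p : C -> R, (forall w, Rabs (p w) <= Cmod w) ->
   (forall v w, p (v - w)%C = p v - p w) ->
   is_lim_seq (fun n => p (Cprod_n (fun k => (RtoC 1 - q ^ S k) ^ 24)%C n)) (p (Cexp z))).
{ intros p Hp Hpm. apply is_lim_seq_spec. intros eps. destruct (HL eps) as [N HN].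
  exists N. intros n Hn. rewrite <- Hpm. eapply Rle_lt_trans; [apply Hp|auto]. }
unfold CProd.
rewrite (is_lim_seq_unique _ _ (HR Re re_le_Cmod ltac:(reflexivity))).
rewrite (is_lim_seq_unique _ _ (HR Im im_le_Cmod ltac:(reflexivity))).
symmetry. apply surjective_pairing.
Qed.

Lemma psum_0 (a : nat -> C) (N : nat) : (forall k, (k < N)%nat -> a k = 0%C) -> psum a N = 0%C.
Proof.
induction N; intros H; cbn [psum]; auto. rewrite IHN, H by (auto; lia). ring.
Qed.

Lemma psum_ext (a b : nat -> C) (N : nat) : (forall k, (k < N)%nat -> a k = b k) -> psum a N = psum b N.
Proof.
induction N; intros H; cbn [psum]; auto. rewrite IHN, H by (auto; lia). reflexivity.
Qed.

(** Divisibility of n+1 by d+1, in the shifted indexing of the series. *)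
Definition divides_term (d n : nat) : bool := Nat.eqb (Nat.modulo (S n) (S d)) 0.

Lemma divides_term_le (d n : nat) : divides_term d n = true -> (d <= n)%nat.
Proof.
unfold divides_term. intros H. apply Nat.eqb_eq in H.
destruct (Nat.le_gt_cases d n); auto. rewrite Nat.mod_small in H; lia.
Qed.

(** With x = q^(d+1), the first d+1 terms contribute only x and the sequence then repeats itself
    multiplied by x, so the sum y satisfies y = x + x y. *)
Lemma CSeries_multiples (d : nat) (q : C) : Cmod q < 1 ->
  CSeries (fun n => if divides_term d n then q ^ S n else 0)%C = (q ^ S d * / (1 - q ^ S d))%C.
Proof.
intros Hq. set (a := fun n => (if divides_term d n then q ^ S n else 0)%C).
assert (Hs : summable a).
{ eapply summable_le; [|apply (ex_series_geom_nonneg (Cmod q)); split; auto using Cmod_ge_0].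
  intros n. unfold a. pose proof (Cmod_ge_0 q). destruct (divides_term d n).
  - rewrite Cmod_pow. apply pow_le_anti; [lra|lia].
  - rewrite Cmod_0. now apply pow_le. }
pose proof (CSeries_psum a (S d) Hs) as E.
assert (E1 : psum a (S d) = (q ^ S d)%C).
{ cbn [psum]. rewrite psum_0.
  - unfold a, divides_term. rewrite Nat.Div0.mod_same. rewrite Nat.eqb_refl. ring.
  - intros k Hk. unfold a. destruct (divides_term d k) eqn:Ed; auto.
    apply divides_term_le in Ed. lia. }
assert (E2 : forall n, a (S d + n)%nat = (q ^ S d * a n)%C).
{ intros n. unfold a, divides_term. replace (S (S d + n)) with (S n + 1 * S d)%nat by lia.
  rewrite Nat.Div0.mod_add. destruct (Nat.eqb (S n mod S d) 0); [|ring].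
  replace (S n + 1 * S d)%nat with (S d + S n)%nat by lia. apply Cpow_add_r. }
rewrite E1, (CSeries_ext _ _ E2), CSeries_scal in E by auto.
assert (Hn : (1 - q ^ S d)%C <> 0%C).
{ apply one_minus_neq_0. eapply Rle_lt_trans; [now apply Cmod_pow_S|auto]. }
set (x := (q ^ S d)%C) in *. set (y := CSeries a) in *.
assert (E3 : ((1 - x) * y)%C = x).
{ transitivity (y - x * y)%C; [ring|]. rewrite E at 1. ring. }
replace y with (/ (1 - x) * ((1 - x) * y))%C by (field; auto). rewrite E3. ring.
Qed.

Lemma psum_sigma (n N : nat) :
  psum (fun d => if divides_term d n then RtoC (INR (S d) ^ 3) else 0)%C N =
  RtoC (INR (list_sum (map (fun d => Nat.pow d 3)
    (filter (fun d => Nat.eqb (Nat.modulo (S n) d) 0) (seq 1 N))))).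
Proof.
induction N; [reflexivity|].
rewrite seq_S, filter_app, map_app, list_sum_app, plus_INR, RtoC_plus, <- IHN.
cbn [psum]. f_equal. change (1 + N)%nat with (S N). cbn [filter].
unfold divides_term. destruct (Nat.eqb (S n mod S N) 0).
- cbn [map list_sum fold_right]. rewrite Nat.add_0_r, pow_INR. reflexivity.
- reflexivity.
Qed.

Lemma CSeries_sigma_3 (q : C) : Cmod q < 1 ->
  CSeries (fun n => RtoC (INR (Defs.sigma 3 (S n))) * q ^ S n)%C =
  CSeries (fun m => npow_series 3 (q ^ S m)%C).
Proof.
intros Hq. pose proof (Cmod_ge_0 q).
destruct (lambert_exchange 2 q Hq) as (_ & _ & ->).
(* |q|^n = r^n r^n, and a divisor d of n satisfies d <= n. So the array is dominated by the product
   of d^3 r^d and r^n. *)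
set (r := sqrt (Cmod q)).
assert (Hr : 0 <= r < 1).
{ split; [apply sqrt_pos|]. unfold r. rewrite <- sqrt_1. apply sqrt_lt_1; lra. }
assert (Hrq : Cmod q = r * r) by (unfold r; now rewrite sqrt_sqrt).
set (a := fun d n => (if divides_term d n then RtoC (INR (S d) ^ 3) * q ^ S n else 0)%C).
destruct (CSeries_exchange_prod a (fun d => INR (S d) ^ 3 * r ^ S d) (fun n => r ^ S n))
  as (S1 & S2 & S3 & S4 & S5).
- apply (ex_series_incr_1 (fun n => INR n ^ 3 * r ^ n)). now apply ex_series_pow_geom.
- apply (ex_series_incr_1 (fun n => r ^ n)). now apply ex_series_geom_nonneg.
- intros d n. unfold a. assert (0 <= INR (S d) ^ 3) by apply pow_le, pos_INR.
  assert (0 <= r ^ S d) by now apply pow_le. assert (0 <= r ^ S n) by now apply pow_le.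
  destruct (divides_term d n) eqn:E.
  + apply divides_term_le in E.
    rewrite Cmod_mult, Cmod_R, Cmod_pow, Rabs_pos_eq, Hrq, Rpow_mult_distr by auto.
    rewrite Rmult_assoc. apply Rmult_le_compat_l; auto. apply Rmult_le_compat_r; auto.
    apply pow_le_anti; [lra|lia].
  + rewrite Cmod_0. apply Rmult_le_pos; auto. now apply Rmult_le_pos.
- transitivity (CSeries (fun n => CSeries (fun d => a d n))).
  + apply CSeries_ext. intros n. rewrite (CSeries_psum _ (S n) (S2 n)).
    rewrite (CSeries_ext (fun k => a (S n + k)%nat n) (fun _ => RtoC 0)).
    2:{ intros k. unfold a. destruct (divides_term (S n + k) n) eqn:E; auto.
        apply divides_term_le in E. lia. }
    rewrite CSeries_0, Cplus_0_r. unfold Defs.sigma. rewrite <- psum_sigma.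
    assert (E : forall N, psum (fun d => a d n) N =
      (psum (fun d => if divides_term d n then RtoC (INR (S d) ^ 3) else 0) N * q ^ S n)%C).
    { induction N; [cbn [psum]; ring|].
      change (psum (fun d => a d n) (S N)) with (psum (fun d => a d n) N + a N n)%C.
      rewrite IHN. unfold a at 1. cbn [psum]. destruct (divides_term N n); ring. }
    now rewrite E.
  + rewrite <- S5. apply CSeries_ext. intros d.
    rewrite (CSeries_ext (a d) (fun n => RtoC (INR (S d) ^ 3) * (if divides_term d n then q ^ S n else 0))%C).
    2:{ intros n. unfold a. destruct (divides_term d n); ring. }
    rewrite CSeries_scal, CSeries_multiples; auto; [ring|].
    eapply summable_le; [|apply (ex_series_geom_nonneg (Cmod q)); split; auto].
    intros n. cbn beta. destruct (divides_term d n).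
    * rewrite Cmod_pow. apply pow_le_anti; [lra|lia].
    * rewrite Cmod_0. now apply pow_le.
Qed.

Definition eisenstein_4 (q : C) : C := (1 + 240 * CSeries (fun m => npow_series 3 (q ^ S m)))%C.

Lemma j_formula (tau : C) : 0 < Im tau ->
  j_invariant tau = (eisenstein_4 (nome tau) ^ 3 * Cexp (disc_exponent tau))%C.
Proof.
intros Ht. pose proof (Cmod_nome_lt_1 tau Ht). unfold j_invariant. cbn zeta.
rewrite CSeries_sigma_3, CProd_eta by lra. fold (eisenstein_4 (nome tau)).
assert (Hq0 : nome tau <> 0%C) by (apply Cmod_pos_neq; lra).
replace (- 24 * eta_log (nome tau))%C with (- (24 * eta_log (nome tau)))%C by ring.
unfold disc_exponent, Cminus. rewrite Cexp_plus, !Cexp_opp, <- nome_Cexp. field. split; auto using Cexp_neq_0.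
Qed.

Lemma eisenstein_4_eis (tau : C) : 0 < Im tau ->
  (RtoC (zeta 4) * eisenstein_4 (nome tau))%C = (RtoC (zeta 4) + eis 4 tau)%C.
Proof.
intros Ht. rewrite eis_npow by auto. unfold eisenstein_4.
(* (2 pi)^4 / 6 = 240 pi^4 / 90: this is where the coefficient 240 of the definition of j meets
   zeta(4). *)
replace (lip 3) with (RtoC (240 * zeta 4)).
- rewrite RtoC_mult. ring.
- rewrite zeta_4. unfold lip. simpl fact. replace (INR 6) with 6 by (simpl; ring).
  replace ((- (RtoC (2 * PI) * Ci)) ^ 4)%C with (RtoC ((2 * PI) ^ 4)).
  + rewrite <- RtoC_mult. f_equal. field.
  + rewrite RtoC_pow. simpl.
    transitivity ((Ci * Ci) * (Ci * Ci) * (RtoC (2 * PI) * (RtoC (2 * PI) * (RtoC (2 * PI) * (RtoC (2 * PI) * 1)))))%C; [|ring].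
    rewrite Ci2. ring.
Qed.

Lemma eisenstein_4_transform (tau : C) : 0 < Im tau ->
  eisenstein_4 (nome (- / tau)) = (tau ^ 4 * eisenstein_4 (nome tau))%C.
Proof.
intros Ht. destruct (S_transform_im tau Ht) as [Ht' H0].
pose proof (eis_4_transform tau Ht) as E. rewrite <- !eisenstein_4_eis in E by auto.
assert (Hz : RtoC (zeta 4) <> 0%C).
{ intros EE. apply RtoC_inj in EE. rewrite zeta_4 in EE.
  assert (0 < PI ^ 4) by apply pow_lt, PI_RGT_0. lra. }
replace (eisenstein_4 (nome (- / tau))) with (/ RtoC (zeta 4) * (RtoC (zeta 4) * eisenstein_4 (nome (- / tau))))%C
  by (field; auto).
rewrite E. field. auto.
Qed.

Lemma j_S_invariant (tau : C) : 0 < Im tau -> j_invariant (- / tau)%C = j_invariant tau.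
Proof.
intros Ht. destruct (S_transform_im tau Ht) as [Ht' H0].
rewrite !j_formula, eisenstein_4_transform, <- (disc_transform tau) by auto.
rewrite Cpow_mult_l, <- Cpow_mult_r. simpl Nat.mul. ring.
Qed.

(** * Bounds for the modular invariant *)

Definition real_eis (r : R) : R :=
  Series (fun m => Series (fun n => INR n ^ 3 * (r ^ S m) ^ n)).
Definition real_eta (r : R) : R :=
  Series (fun m => Series (fun n => / INR n * (r ^ S m) ^ n)).
(** The value of q j at real q = r. Its two factors have nonnegative coefficients as power series in
    r, so it dominates |q j| on the circle |q| = r. *)
Definition real_jq (r : R) : R := (1 + 240 * real_eis r) ^ 3 * exp (24 * real_eta r).

Lemma eis_of_real (r : R) : CSeries (fun m => npow_series 3 (RtoC r ^ S m)%C) = RtoC (real_eis r).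
Proof.
unfold real_eis. rewrite <- CSeries_RtoC. apply CSeries_ext. intros m.
rewrite <- CSeries_RtoC. apply CSeries_ext. intros n.
now rewrite RtoC_mult, !RtoC_pow.
Qed.

Lemma eta_of_real (r : R) : eta_log (RtoC r) = RtoC (real_eta r).
Proof.
unfold real_eta. rewrite <- CSeries_RtoC. apply CSeries_ext. intros m.
unfold mlog1m. rewrite <- CSeries_RtoC. apply CSeries_ext. intros n.
now rewrite RtoC_mult, !RtoC_pow.
Qed.

Lemma real_double_nonneg (a : nat -> R) (r : R) : (forall n, 0 <= a n) -> 0 <= r ->
  0 <= Series (fun m => Series (fun n => a n * (r ^ S m) ^ n)).
Proof.
intros Ha Hr. apply Series_nonneg. intros m. apply Series_nonneg. intros n.
apply Rmult_le_pos; auto. apply pow_le, pow_le, Hr.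
Qed.

Lemma real_eis_nonneg (r : R) : 0 <= r -> 0 <= real_eis r.
Proof. apply real_double_nonneg. intros; apply pow_le, pos_INR. Qed.

Lemma real_eta_nonneg (r : R) : 0 <= r -> 0 <= real_eta r.
Proof. apply real_double_nonneg. intros n. apply (Cmod_inv_INR n). Qed.

Lemma ex_series_of_RtoC (a : nat -> R) : summable (fun n => RtoC (a n)) -> ex_series a.
Proof. intros H. apply summable_Re in H. exact H. Qed.

Lemma Cmod_eis_le (q : C) : Cmod q < 1 ->
  Cmod (CSeries (fun m => npow_series 3 (q ^ S m)%C)) <= real_eis (Cmod q).
Proof.
intros Hq. pose proof (Cmod_ge_0 q).
apply Cmod_CSeries_le.
- intros m. assert (Cmod (q ^ S m)%C < 1) by (eapply Rle_lt_trans; [now apply Cmod_pow_S|auto]).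
  eapply Rle_trans; [apply Cmod_CSeries, summable_npow; auto|].
  right. apply Series_ext. intros n.
  rewrite Cmod_mult, Cmod_R, !Cmod_pow, Rabs_pos_eq; auto. apply pow_le, pos_INR.
- apply ex_series_of_RtoC. destruct (lambert_exchange 2 (RtoC (Cmod q))) as (Hs & _ & _).
  { rewrite Cmod_R, Rabs_pos_eq; auto. }
  eapply summable_ext; [|exact Hs]. intros m. cbn beta. rewrite <- CSeries_RtoC.
  apply CSeries_ext. intros n. now rewrite RtoC_mult, !RtoC_pow.
Qed.

Lemma Cmod_eta_le (q : C) : Cmod q < 1 -> Cmod (eta_log q) <= real_eta (Cmod q).
Proof.
intros Hq. pose proof (Cmod_ge_0 q).
apply Cmod_CSeries_le.
- intros m. assert (Cmod (q ^ S m)%C < 1) by (eapply Rle_lt_trans; [now apply Cmod_pow_S|auto]).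
  eapply Rle_trans; [apply Cmod_CSeries, summable_mlog1m; auto|].
  right. apply Series_ext. intros n. destruct (Cmod_inv_INR n) as [E _].
  now rewrite Cmod_mult, E, !Cmod_pow.
- apply ex_series_of_RtoC. pose proof (summable_eta_log (RtoC (Cmod q))) as Hs.
  rewrite Cmod_R, Rabs_pos_eq in Hs by auto.
  eapply summable_ext; [|apply Hs; auto]. intros m. cbn beta. rewrite <- CSeries_RtoC.
  apply CSeries_ext. intros n. now rewrite RtoC_mult, !RtoC_pow.
Qed.

(** a b - 1 = (a-1)(b-1) + (a-1) + (b-1), and likewise for A B - 1. Majorants with constant term 1
    can therefore be multiplied while the 1 stays split off. *)
Lemma Cmod_product_minus_1 (a b : C) (A B : R) :
  Cmod (a - 1)%C <= A - 1 -> Cmod (b - 1)%C <= B - 1 -> Cmod (a * b - 1)%C <= A * B - 1.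
Proof.
intros Ha Hb.
replace (a * b - 1)%C with ((a - 1) * (b - 1) + ((a - 1) + (b - 1)))%C by ring.
eapply Rle_trans; [apply Cmod_triangle|].
eapply Rle_trans; [apply Rplus_le_compat_l, Cmod_triangle|]. rewrite Cmod_mult.
pose proof (Cmod_ge_0 (a - 1)%C). pose proof (Cmod_ge_0 (b - 1)%C).
assert (Cmod (a - 1)%C * Cmod (b - 1)%C <= (A - 1) * (B - 1)) by (apply Rmult_le_compat; auto).
lra.
Qed.

Lemma Cmod_Cexp_minus_1 (w : C) : Cmod (Cexp w - 1)%C <= exp (Cmod w) - 1.
Proof.
rewrite Cexp_series, CSeries_incr_1 by apply summable_exp.
assert (Hex : ex_series (fun n => Cmod w ^ n / INR (fact n))) by (eexists; apply is_series_exp).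
rewrite <- (is_series_unique _ _ (is_series_exp (Cmod w))), (Series_incr_1 _ Hex).
change (fact 0) with 1%nat. change (INR 1) with 1. rewrite Rinv_1.
replace (RtoC 1 * w ^ 0 + CSeries (fun n => RtoC (/ INR (fact (S n))) * w ^ S n) - 1)%C
  with (CSeries (fun n => RtoC (/ INR (fact (S n))) * w ^ S n)%C) by (simpl; ring).
replace (Cmod w ^ 0 / 1 + Series (fun k => Cmod w ^ S k / INR (fact (S k))) - 1)
  with (Series (fun k => Cmod w ^ S k / INR (fact (S k)))) by (simpl; field).
apply Cmod_CSeries_le.
- intros n. rewrite Cmod_mult, Cmod_R, Cmod_pow, Rabs_pos_eq.
  + unfold Rdiv. lra.
  + apply Rlt_le, Rinv_0_lt_compat, lt_0_INR, lt_O_fact.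
- now apply ex_series_incr_1 in Hex.
Qed.

Lemma j_nome (tau : C) : 0 < Im tau ->
  (j_invariant tau * nome tau)%C = (eisenstein_4 (nome tau) ^ 3 * Cexp (24 * eta_log (nome tau)))%C.
Proof.
intros Ht. rewrite j_formula by auto. unfold disc_exponent, Cminus.
rewrite Cexp_plus, Cexp_opp, <- nome_Cexp. field.
apply Cmod_pos_neq. generalize (Cmod_nome_lt_1 tau Ht). lra.
Qed.

Lemma Cmod_j_minus_pole (tau : C) : 0 < Im tau ->
  Cmod (j_invariant tau - / nome tau)%C <= (real_jq (Cmod (nome tau)) - 1) / Cmod (nome tau).
Proof.
intros Ht. pose proof (Cmod_nome_lt_1 tau Ht) as Hq.
assert (Hq0 : nome tau <> 0%C) by (apply Cmod_pos_neq; lra).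
replace (j_invariant tau - / nome tau)%C with ((j_invariant tau * nome tau - 1) / nome tau)%C by (field; auto).
rewrite Cmod_div by auto. apply Rmult_le_compat_r; [apply Rlt_le, Rinv_0_lt_compat; lra|].
rewrite j_nome by auto. set (q := nome tau) in *. pose proof (Cmod_ge_0 q).
unfold real_jq. apply Cmod_product_minus_1.
- assert (H1 : Cmod (eisenstein_4 q - 1)%C <= (1 + 240 * real_eis (Cmod q)) - 1).
  { unfold eisenstein_4.
    replace (1 + 240 * CSeries (fun m => npow_series 3 (q ^ S m)) - 1)%C
      with (240 * CSeries (fun m => npow_series 3 (q ^ S m)%C))%C by ring.
    rewrite Cmod_mult, Cmod_R, Rabs_pos_eq by lra.
    pose proof (Cmod_eis_le q ltac:(lra)). lra. }
  simpl. rewrite !Rmult_1_r, Cmult_1_r.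
  apply Cmod_product_minus_1; auto. now apply Cmod_product_minus_1.
- eapply Rle_trans; [apply Cmod_Cexp_minus_1|].
  apply Rplus_le_compat_r, exp_le. rewrite Cmod_mult, Cmod_R, Rabs_pos_eq by lra.
  pose proof (Cmod_eta_le q ltac:(lra)). lra.
Qed.

Lemma Cmod_j_le (tau : C) : 0 < Im tau ->
  Cmod (j_invariant tau) <= real_jq (Cmod (nome tau)) / Cmod (nome tau).
Proof.
intros Ht. pose proof (Cmod_nome_lt_1 tau Ht) as Hq.
pose proof (Cmod_j_minus_pole tau Ht) as H.
replace (j_invariant tau) with ((j_invariant tau - / nome tau) + / nome tau)%C by ring.
eapply Rle_trans; [apply Cmod_triangle|].
rewrite Cmod_inv by (apply Cmod_pos_neq; lra). unfold Rdiv in *. lra.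
Qed.

Lemma nome_imaginary (y : R) : nome (0, y) = RtoC (exp (- (2 * PI * y))).
Proof. unfold nome. rewrite <- Cexp_RtoC. f_equal. apply C_ext; simpl; ring. Qed.

Lemma j_imaginary (y : R) : 0 < y ->
  j_invariant (0, y) = RtoC (real_jq (exp (- (2 * PI * y))) / exp (- (2 * PI * y))).
Proof.
intros Hy. set (r := exp (- (2 * PI * y))). assert (Hr : 0 < r) by apply exp_pos.
assert (Hrc : RtoC r <> 0%C) by (intros E; apply RtoC_inj in E; lra).
pose proof (j_nome (0, y) Hy) as E. rewrite nome_imaginary in E. fold r in E.
replace (j_invariant (0, y)) with (j_invariant (0, y) * RtoC r / RtoC r)%C by (field; auto).
rewrite E, RtoC_div by lra. f_equal. unfold real_jq, eisenstein_4.
rewrite eis_of_real, eta_of_real, <- !RtoC_mult, Cexp_RtoC, <- RtoC_plus, <- RtoC_pow, <- RtoC_mult.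
reflexivity.
Qed.

Lemma Cmod_j_le_imaginary (tau : C) : 0 < Im tau ->
  Cmod (j_invariant tau) <= Cmod (j_invariant (0, Im tau)).
Proof.
intros Ht. eapply Rle_trans; [now apply Cmod_j_le|].
rewrite j_imaginary, Cmod_R, <- Cmod_nome by auto. apply Rle_abs.
Qed.

Lemma real_eis_small (r : R) : 0 <= r <= 1 / 100 -> real_eis r <= 2 * r.
Proof.
intros Hr. pose proof (real_eis_nonneg r ltac:(lra)).
rewrite <- (Rabs_pos_eq (real_eis r)), <- Cmod_R, <- eis_of_real by auto.
assert (Hc : Cmod (RtoC r) = r) by (rewrite Cmod_R, Rabs_pos_eq; lra).
destruct (lambert_exchange 2 (RtoC r)) as (_ & _ & ->); [lra|].
(* (n+1)^3 <= 8^n because n+1 <= 2^n, which gives a geometric series of ratio 8r <= 8/100. *)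
apply Rle_trans with (Series (fun n => (r * / (1 - r)) * (8 * r) ^ n)).
- apply Cmod_CSeries_le.
  2:{ apply ex_series_scalR, ex_series_geom_nonneg. lra. }
  intros n. rewrite !Cmod_mult, Cmod_R, Cmod_pow, Hc, Rabs_pos_eq by apply pow_le, pos_INR.
  pose proof (inv_one_minus_pow_bound (RtoC r) n ltac:(lra)) as Hb. rewrite Hc in Hb.
  assert (H8 : INR (S n) ^ 3 <= 8 ^ n).
  { replace (8 ^ n) with ((2 ^ n) ^ 3) by (rewrite <- !pow_mult, Nat.mul_comm, pow_mult; f_equal; ring).
    apply pow_incr. split; [apply pos_INR|]. clear. induction n; [simpl; lra|].
    rewrite S_INR. simpl (2 ^ S n). assert (1 <= 2 ^ n) by (apply pow_R1_Rle; lra). lra. }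
  rewrite Rpow_mult_distr. simpl (r ^ S n).
  assert (0 <= r ^ n) by (apply pow_le; lra). assert (0 <= INR (S n) ^ 3) by apply pow_le, pos_INR.
  replace (r * / (1 - r) * (8 ^ n * r ^ n)) with (8 ^ n * (r * r ^ n) * / (1 - r)) by ring.
  assert (0 <= r * r ^ n) by (apply Rmult_le_pos; lra).
  apply Rmult_le_compat; auto using Cmod_ge_0.
  + now apply Rmult_le_pos.
  + now apply Rmult_le_compat_r.
- rewrite Series_scal_l, Series_geom by (rewrite Rabs_pos_eq; lra).
  replace (r * / (1 - r) * / (1 - 8 * r)) with (r * (/ (1 - r) * / (1 - 8 * r))) by ring.
  assert (/ (1 - r) * / (1 - 8 * r) <= 2).
  { rewrite <- Rinv_mult. replace 2 with (/ (1 / 2)) by field. apply Rinv_le_contravar; nra. }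
  nra.
Qed.

Lemma real_eta_small (r : R) : 0 <= r <= 1 / 100 -> real_eta r <= 2 * r.
Proof.
intros Hr. pose proof (real_eta_nonneg r ltac:(lra)).
rewrite <- (Rabs_pos_eq (real_eta r)), <- Cmod_R, <- eta_of_real by auto.
assert (Hc : Cmod (RtoC r) = r) by (rewrite Cmod_R, Rabs_pos_eq; lra).
apply Rle_trans with (Series (fun n => (r * / (1 - r)) * r ^ n)).
- apply Cmod_CSeries_le.
  2:{ apply ex_series_scalR, ex_series_geom_nonneg. lra. }
  intros n. eapply Rle_trans; [apply (mlog1m_bound _ r); [|lra]|].
  + rewrite <- Hc at 2. apply Cmod_pow_S. lra.
  + rewrite Cmod_pow, Hc. simpl. right. ring.
- rewrite Series_scal_l, Series_geom by (rewrite Rabs_pos_eq; lra).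
  replace (r * / (1 - r) * / (1 - r)) with (r * (/ (1 - r) * / (1 - r))) by ring.
  assert (/ (1 - r) * / (1 - r) <= 2).
  { rewrite <- Rinv_mult. replace 2 with (/ (1 / 2)) by field. apply Rinv_le_contravar; nra. }
  nra.
Qed.

(** 1 + 480 r <= e^(480 r) yields the bound e^(1488 r), where 1488 = 3 * 480 + 48. Then e^x - 1 <= x
    e^x is used with x = 1488 r <= 15. *)
Lemma real_jq_small (r : R) : 0 <= r <= 1 / 100 -> real_jq r - 1 <= 1488 * exp 15 * r.
Proof.
intros Hr. pose proof (real_eis_small r Hr). pose proof (real_eta_small r Hr).
pose proof (real_eis_nonneg r ltac:(lra)).
assert (H2 : real_jq r <= exp (1488 * r)).
{ unfold real_jq. replace (1488 * r) with (480 * r + (480 * r + 480 * r) + 24 * (2 * r)) by ring.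
  rewrite exp_plus. apply Rmult_le_compat.
  - apply pow_le. lra.
  - apply Rlt_le, exp_pos.
  - rewrite !exp_plus.
    replace (exp (480 * r) * (exp (480 * r) * exp (480 * r))) with (exp (480 * r) ^ 3) by ring.
    apply pow_incr. pose proof (exp_ineq1_le (480 * r)). lra.
  - apply exp_le. lra. }
assert (H3 : exp (1488 * r) <= exp 15) by (apply exp_le; lra).
assert (H4 : exp (1488 * r) - 1 <= 1488 * r * exp (1488 * r)).
{ pose proof (exp_ineq1_le (- (1488 * r))) as H4. rewrite exp_Ropp in H4.
  pose proof (exp_pos (1488 * r)). apply Rmult_le_compat_l with (r := exp (1488 * r)) in H4; [|lra].
  rewrite Rinv_r in H4 by lra. lra. }
nra.
Qed.

Lemma exp_INR_mult (x : R) (n : nat) : exp (INR n * x) = exp x ^ n.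
Proof.
induction n; [simpl; now rewrite Rmult_0_l, exp_0|].
rewrite S_INR, Rmult_plus_distr_r, Rmult_1_l, exp_plus, IHn. simpl. ring.
Qed.

(** Guarantees |q| <= 1/100 as soon as Im tau >= 1. *)
Lemma exp_2PI_ge_100 : 100 <= exp (2 * PI).
Proof.
apply Rle_trans with (exp 6).
- replace 6 with (INR 12 * (1 / 2)) by (simpl; field).
  rewrite exp_INR_mult.
  pose proof (exp_ineq1_le (1 / 2)).
  apply Rle_trans with ((3 / 2) ^ 12); [lra|]. apply pow_incr. lra.
- apply exp_le. generalize PI2_3_2. unfold PI2. lra.
Qed.

Definition j_const : R := 1488 * exp 15.

Lemma Cmod_j_minus_pole_high (tau : C) : 1 <= Im tau ->
  Cmod (j_invariant tau - / nome tau)%C <= j_const.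
Proof.
intros Ht. assert (Ht0 : 0 < Im tau) by lra.
eapply Rle_trans; [now apply Cmod_j_minus_pole|].
pose proof (Cmod_nome_lt_1 tau Ht0) as Hq.
assert (Hr : Cmod (nome tau) <= 1 / 100).
{ rewrite Cmod_nome, exp_Ropp. pose proof exp_2PI_ge_100. pose proof PI_RGT_0.
  replace (1 / 100) with (/ 100) by field. apply Rinv_le_contravar; [lra|].
  eapply Rle_trans; [exact H|]. apply exp_le. nra. }
pose proof (real_jq_small (Cmod (nome tau)) ltac:(lra)).
apply Rmult_le_reg_r with (Cmod (nome tau)); [lra|].
unfold Rdiv, j_const. rewrite Rmult_assoc, Rinv_l by lra. lra.
Qed.

Lemma S_transform_im_value (tau : C) : 0 < Im tau ->
  Im (- / tau)%C = Im tau / (Re tau ^ 2 + Im tau ^ 2).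
Proof. intros Ht. destruct tau as [x y]; simpl in *. field. nra. Qed.

Lemma S_transform_imaginary (y : R) : 0 < y -> (- / ((0, y) : C))%C = (0, / y).
Proof.
intros Hy. apply C_ext; unfold Copp, Cinv; simpl.
- unfold Rdiv. ring.
- field. lra.
Qed.

Lemma nome_S_transform (tau : C) : tau <> 0%C ->
  (/ nome (- / tau))%C = Cexp (RtoC (2 * PI) * Ci * / tau)%C.
Proof. intros H. rewrite nome_Cexp, <- Cexp_opp. f_equal. field. auto. Qed.

Lemma j_near_cusp (tau : C) : 0 < Im tau <= 1 -> Rabs (Re tau) <= 1 / 2 ->
  Cmod (j_invariant tau - Cexp (RtoC (2 * PI) * Ci * / tau))%C <=
  exp (2 * PI * (/ (4 * Im tau) + Im tau)) + (j_const + exp (2 * PI)).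
Proof.
intros Ht Hx. destruct (S_transform_im tau ltac:(lra)) as [Ht' H0].
pose proof PI_RGT_0 as HPI.
assert (HJ : 0 < j_const) by (unfold j_const; generalize (exp_pos 15); lra).
rewrite <- j_S_invariant, <- nome_S_transform by (auto; lra).
pose proof (exp_pos (2 * PI * (/ (4 * Im tau) + Im tau))) as P1. pose proof (exp_pos (2 * PI)) as P2.
destruct (Rle_dec 1 (Im (- / tau)%C)) as [Hy|Hy].
- eapply Rle_trans; [now apply Cmod_j_minus_pole_high|]. lra.
- unfold Cminus. eapply Rle_trans; [apply Cmod_triangle|]. rewrite Cmod_opp.
  set (t' := (- / tau)%C) in *.
  assert (H1 : Cmod (/ nome t')%C <= exp (2 * PI)).
  { pose proof (Cmod_nome_lt_1 t' Ht'). rewrite Cmod_inv by (apply Cmod_pos_neq; lra).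
    rewrite Cmod_nome, <- exp_Ropp. apply exp_le. nra. }
  (* A second inversion on the imaginary axis: |j(t')| <= j(i Im t') = j(i / Im t'), and 1 / Im t'
     >= 1 lies in the range of [Cmod_j_minus_pole_high]. *)
  assert (H2j : Cmod (j_invariant t') <= exp (2 * PI * / Im t') + j_const).
  { eapply Rle_trans; [now apply Cmod_j_le_imaginary|].
    assert (Hi : 0 < / Im t') by now apply Rinv_0_lt_compat.
    assert (Hi1 : 1 <= / Im t') by (rewrite <- Rinv_1; apply Rinv_le_contravar; lra).
    rewrite <- j_S_invariant by auto.
    rewrite S_transform_imaginary by auto.
    pose proof (Cmod_j_minus_pole_high (0, / Im t') Hi1) as H2.
    set (z := (0, / Im t') : C) in *.
    replace (j_invariant z) with ((j_invariant z - / nome z) + / nome z)%C by ring.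
    eapply Rle_trans; [apply Cmod_triangle|].
    pose proof (Cmod_nome_lt_1 z Hi). rewrite Cmod_inv by (apply Cmod_pos_neq; lra).
    rewrite Cmod_nome, <- exp_Ropp, Ropp_involutive. change (Im z) with (/ Im t'). lra. }
  (* 1 / Im t' = (Re tau)^2 / Im tau + Im tau, with (Re tau)^2 <= 1/4 in the strip. *)
  assert (H3 : / Im t' <= / (4 * Im tau) + Im tau).
  { unfold t'. rewrite S_transform_im_value by lra.
    replace (/ (Im tau / (Re tau ^ 2 + Im tau ^ 2))) with (Re tau ^ 2 / Im tau + Im tau).
    2:{ field. split; [|lra]. nra. }
    apply Rplus_le_compat_r.
    assert (Re tau ^ 2 <= 1 / 4).
    { rewrite <- pow2_abs. pose proof (Rabs_pos (Re tau)). nra. }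
    rewrite Rinv_mult. apply Rmult_le_compat_r; [apply Rlt_le, Rinv_0_lt_compat; lra|lra]. }
  assert (exp (2 * PI * / Im t') <= exp (2 * PI * (/ (4 * Im tau) + Im tau))) by (apply exp_le; nra).
  lra.
Qed.

(** * The principal part as a power series *)

Definition main_coef (k : nat) : R := (4 * PI ^ 2) ^ S k / (INR (fact k) * INR (fact (S k))).

Definition main_term (n : nat) : R := Series (fun k => main_coef k * INR n ^ k).

Lemma main_coef_pos (k : nat) : 0 < main_coef k.
Proof.
unfold main_coef. apply Rdiv_lt_0_compat.
- apply pow_lt. generalize PI_RGT_0. nra.
- apply Rmult_lt_0_compat; apply lt_0_INR, lt_O_fact.
Qed.

Lemma pow_over_fact_le (x : R) (k : nat) : 0 <= x -> x ^ k / INR (fact k) <= exp x.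
Proof.
intros Hx. rewrite <- (is_series_unique _ _ (is_series_exp x)).
apply (term_le_Series (fun n => x ^ n / INR (fact n))).
- intros n. apply Rmult_le_pos; [now apply pow_le|]. apply Rlt_le, Rinv_0_lt_compat, lt_0_INR, lt_O_fact.
- eexists; apply is_series_exp.
Qed.

(** Separates k from n: one factorial absorbs (e n)^k into exp(e n), the other is kept for
    convergence in k. *)
Lemma main_coef_term_le (e : R) (k n : nat) : 0 < e ->
  main_coef k * INR n ^ k <= (4 * PI ^ 2 * ((4 * PI ^ 2 / e) ^ k / INR (fact k))) * exp (e * INR n).
Proof.
intros He. pose proof (pos_INR n). pose proof PI_RGT_0.
pose proof (pow_over_fact_le (e * INR n) k ltac:(nra)) as H1.
assert (F : 0 < INR (fact k)) by apply lt_0_INR, lt_O_fact.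
assert (F' : 0 < INR (fact (S k))) by apply lt_0_INR, lt_O_fact.
assert (FF : / INR (fact (S k)) <= / INR (fact k)).
{ apply Rinv_le_contravar; auto. apply le_INR, fact_le. lia. }
unfold main_coef.
replace ((4 * PI ^ 2) ^ S k / (INR (fact k) * INR (fact (S k))) * INR n ^ k)
  with ((4 * PI ^ 2 * ((4 * PI ^ 2 / e) ^ k * / INR (fact (S k)))) * ((e * INR n) ^ k / INR (fact k))).
2:{ set (A := 4 * PI ^ 2).
    assert (HA : (A / e) ^ k * (e * INR n) ^ k = A ^ k * INR n ^ k).
    { rewrite <- !Rpow_mult_distr. f_equal. field. lra. }
    transitivity (A * (A ^ k * INR n ^ k) / (INR (fact k) * INR (fact (S k)))).
    - rewrite <- HA. field. lra.
    - change (A ^ S k) with (A * A ^ k). field. lra. }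
assert (0 <= (4 * PI ^ 2 / e) ^ k).
{ apply pow_le. apply Rlt_le, Rdiv_lt_0_compat; nra. }
assert (0 < / INR (fact (S k))) by now apply Rinv_0_lt_compat.
apply Rmult_le_compat; auto.
- apply Rmult_le_pos; [nra|]. apply Rmult_le_pos; lra.
- apply Rmult_le_pos; [apply pow_le; nra|]. apply Rlt_le, Rinv_0_lt_compat; auto.
- apply Rmult_le_compat_l; [nra|]. now apply Rmult_le_compat_l.
Qed.

Lemma main_term_series (q : C) : 0 < Cmod q < 1 ->
  summable (fun n => RtoC (main_term n) * q ^ n)%C /\
  summable (fun k => RtoC (main_coef k) * npow_series k q)%C /\
  CSeries (fun n => RtoC (main_term n) * q ^ n)%C =
  CSeries (fun k => RtoC (main_coef k) * npow_series k q)%C.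
Proof.
intros Hq.
(* This choice makes exp(e) |q| = sqrt |q| < 1, so convergence in n survives the factor exp(e n). *)
set (e := - ln (Cmod q) / 2).
assert (He : 0 < e).
{ unfold e. assert (ln (Cmod q) < 0) by (rewrite <- ln_1; apply ln_increasing; lra). lra. }
assert (Hs : exp e * Cmod q < 1).
{ rewrite <- (exp_ln (Cmod q)) at 1 by lra. rewrite <- exp_plus, <- exp_0.
  apply exp_increasing. unfold e in *. lra. }
pose proof (exp_pos e) as Hep.
destruct (CSeries_exchange_prod (fun k n => RtoC (main_coef k * INR n ^ k) * q ^ n)%C
  (fun k => 4 * PI ^ 2 * ((4 * PI ^ 2 / e) ^ k / INR (fact k)))
  (fun n => (exp e * Cmod q) ^ n)) as (S1 & S2 & S3 & S4 & S5).
- apply ex_series_scalR. eexists; apply is_series_exp.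
- apply ex_series_geom_nonneg. split; auto. apply Rmult_le_pos; lra.
- intros k n. rewrite Cmod_mult, Cmod_R, Cmod_pow, Rabs_pos_eq.
  2:{ apply Rmult_le_pos; [apply Rlt_le, main_coef_pos|apply pow_le, pos_INR]. }
  rewrite Rpow_mult_distr, <- exp_INR_mult, <- Rmult_assoc.
  apply Rmult_le_compat_r; [apply pow_le; lra|].
  rewrite (Rmult_comm (INR n)). now apply main_coef_term_le.
- assert (E1 : forall k, CSeries (fun n => RtoC (main_coef k * INR n ^ k) * q ^ n)%C =
     (RtoC (main_coef k) * npow_series k q)%C).
  { intros k. unfold npow_series. rewrite <- CSeries_scal by (apply summable_npow; lra).
    apply CSeries_ext. intros n. rewrite RtoC_mult. ring. }
  assert (E2 : forall n, CSeries (fun k => RtoC (main_coef k * INR n ^ k) * q ^ n)%C =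
     (RtoC (main_term n) * q ^ n)%C).
  { intros n. unfold main_term. rewrite <- CSeries_RtoC, Cmult_comm, <- CSeries_scal.
    - apply CSeries_ext. intros k. ring.
    - eapply summable_ext; [|apply (summable_scal (/ q ^ n)), (S2 n)]. intros k. cbn beta. field.
      apply Cpow_nz, Cmod_pos_neq; lra. }
  rewrite (CSeries_ext _ _ E1), (CSeries_ext _ _ E2) in S5. repeat split; auto.
  + eapply summable_ext; [apply E2|exact S4].
  + eapply summable_ext; [apply E1|exact S3].
Qed.

(** Since 4 pi^2 = (2 pi i)(-2 pi i), the Lipschitz constant cancels and leaves (2 pi i)^(k+1) /
    (k+1)!, the coefficient of 1/tau^(k+1) in exp(2 pi i / tau). *)
Lemma main_coef_lip (k : nat) (tau : C) : (1 <= k)%nat -> 0 < Im tau ->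
  (RtoC (main_coef k) * npow_series k (nome tau))%C =
  (RtoC (/ INR (fact (S k))) * (RtoC (2 * PI) * Ci) ^ S k * Zsum (S k) tau)%C.
Proof.
intros Hk Ht. rewrite Lipschitz_formula by auto. unfold lip, main_coef, Rdiv.
rewrite Rinv_mult, !RtoC_mult, RtoC_pow.
replace (RtoC (4 * PI ^ 2)) with ((RtoC (2 * PI) * Ci) * (- (RtoC (2 * PI) * Ci)))%C.
- rewrite !RtoC_mult, Cpow_mult_l. ring.
- transitivity (- (RtoC (2 * PI) * RtoC (2 * PI)) * (Ci * Ci))%C; [ring|].
  rewrite Ci2, <- RtoC_mult. replace (4 * PI ^ 2) with (2 * PI * (2 * PI)) by ring. ring.
Qed.

Definition main_const : R := 2 * PI ^ 2 + 2 * PI * (12 * inv_sq_total) + 1 + 2 * inv_sq_total * exp (4 * PI).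

(** For k >= 1 the k-th term is compared with the exponential term of index k+1; by [Zsum_near_pole]
    the errors add up to part of the series of exp(4 pi). The index k = 0 lies outside the Lipschitz
    formula, as the terms 1/(tau + n) are not absolutely summable, and goes through the
    cotangent. *)
Lemma main_term_near_cusp (tau : C) : 0 < Im tau <= 1 -> Rabs (Re tau) <= 1 / 2 ->
  Cmod (CSeries (fun n => RtoC (main_term n) * nome tau ^ n)
    - Cexp (RtoC (2 * PI) * Ci * / tau))%C <= main_const.
Proof.
intros Ht Hx. assert (Ht0 : 0 < Im tau) by lra. pose proof PI_RGT_0 as HPI.
destruct (S_transform_im tau Ht0) as [_ H0].
pose proof (Cmod_nome_lt_1 tau Ht0) as Hq.
destruct (main_term_series (nome tau) Hq) as (_ & Hs & ->).
rewrite CSeries_incr_1 by auto.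
set (b := (RtoC (2 * PI) * Ci)%C).
pose proof (summable_exp (b * / tau)) as He.
rewrite Cexp_series, (CSeries_psum _ 2 He). cbn [psum].
assert (He2 : summable (fun n => RtoC (/ INR (fact (2 + n))) * (b * / tau) ^ (2 + n))%C)
  by exact (summable_incr_n (fun n => RtoC (/ INR (fact n)) * (b * / tau) ^ n)%C 2 He).
assert (Hs1 : summable (fun k => RtoC (main_coef (S k)) * npow_series (S k) (nome tau))%C)
  by now apply (summable_incr_1 (fun k => RtoC (main_coef k) * npow_series k (nome tau))%C).
assert (HA : Cmod (CSeries (fun k => RtoC (main_coef (S k)) * npow_series (S k) (nome tau))
   - CSeries (fun n => RtoC (/ INR (fact (2 + n))) * (b * / tau) ^ (2 + n)))%C
   <= 2 * inv_sq_total * exp (4 * PI)).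
{ rewrite <- CSeries_minus by auto.
  assert (Hex : ex_series (fun k => (4 * PI) ^ k / INR (fact k))) by (eexists; apply is_series_exp).
  pose proof inv_sq_total_pos as HT.
  apply Rle_trans with (Series (fun k => 2 * inv_sq_total * ((4 * PI) ^ (2 + k) / INR (fact (2 + k))))).
  - apply Cmod_CSeries_le.
    2:{ apply ex_series_scalR. apply (ex_series_incr_n (fun k => (4 * PI) ^ k / INR (fact k)) 2). exact Hex. }
    intros k. rewrite main_coef_lip by (auto; lia). fold b.
    replace (RtoC (/ INR (fact (S (S k)))) * b ^ S (S k) * Zsum (S (S k)) tau
      - RtoC (/ INR (fact (2 + k))) * (b * / tau) ^ (2 + k))%C with
      (RtoC (/ INR (fact (2 + k))) * b ^ (2 + k) * (Zsum (2 + k) tau - / tau ^ (2 + k)))%C.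
    2:{ rewrite Cpow_mult_l, Cpow_inv by auto. change (S (S k)) with (2 + k)%nat. ring. }
    pose proof (Zsum_near_pole (2 + k) tau ltac:(lia) Ht0 Hx) as HZ.
    assert (F : 0 < / INR (fact (2 + k))) by apply Rinv_0_lt_compat, lt_0_INR, lt_O_fact.
    rewrite !Cmod_mult, Cmod_R, Cmod_pow, Rabs_pos_eq by lra.
    unfold b. rewrite Cmod_mult, Cmod_R, Cmod_Ci, Rmult_1_r, Rabs_pos_eq by lra.
    set (p := 2 * PI). replace (4 * PI) with (2 * p) by (unfold p; ring).
    rewrite (Rpow_mult_distr 2 p).
    replace (2 * inv_sq_total * (2 ^ (2 + k) * p ^ (2 + k) / INR (fact (2 + k))))
     with (/ INR (fact (2 + k)) * p ^ (2 + k) * (2 * 2 ^ (2 + k) * inv_sq_total)) by (unfold Rdiv; ring).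
    apply Rmult_le_compat_l; auto. apply Rmult_le_pos; [lra|]. apply pow_le; unfold p; lra.
  - rewrite Series_scal_l. apply Rmult_le_compat_l; [lra|].
    rewrite <- (is_series_unique _ _ (is_series_exp (4 * PI))).
    rewrite (Series_incr_n (fun k => (4 * PI) ^ k / INR (fact k)) 2) by (auto; lia).
    simpl sum_f_R0. assert (0 <= 4 * PI * 1 / 1) by lra. lra. }
(* The terms of index 0: 1/(1-q) is an affine function of the cotangent series. *)
assert (HB : Cmod (RtoC (main_coef 0) * npow_series 0 (nome tau)
   - (0 + RtoC (/ INR (fact 0)) * (b * / tau) ^ 0 + RtoC (/ INR (fact 1)) * (b * / tau) ^ 1))%C
   <= 2 * PI ^ 2 + 2 * PI * (12 * inv_sq_total) + 1).
{ destruct (cot_series_symmetric tau Ht0) as [C1 C2].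
  pose proof (cot_formula tau Ht0) as C3.
  assert (Hq1 := one_minus_neq_0 (nome tau) ltac:(lra)).
  rewrite npow_0 by lra.
  replace (main_coef 0) with (4 * PI ^ 2) by (unfold main_coef; simpl; field).
  simpl fact. change (INR 1) with 1. rewrite Rinv_1.
  replace (RtoC (4 * PI ^ 2) * / (1 - nome tau) - (0 + RtoC 1 * (b * / tau) ^ 0 + RtoC 1 * (b * / tau) ^ 1))%C
    with (RtoC (2 * PI ^ 2 - 1) + b * (cot_series tau - / tau))%C.
  2:{ rewrite C3. unfold b.
      replace (RtoC (2 * PI ^ 2 - 1)) with (2 * RtoC PI * RtoC PI - 1)%C
        by (rewrite RtoC_minus; simpl; rewrite !RtoC_mult; ring).
      replace (RtoC (4 * PI ^ 2)) with (4 * RtoC PI * RtoC PI)%C by (simpl; rewrite !RtoC_mult; ring).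
      rewrite RtoC_mult. set (q := nome tau) in *.
      transitivity (2 * RtoC PI * RtoC PI - 1 - (Ci * Ci) * (2 * RtoC PI * RtoC PI * (1 + q) / (1 - q))
         - 2 * RtoC PI * Ci * / tau)%C.
      - unfold Cdiv. ring.
      - rewrite Ci2. simpl. field. auto. }
  rewrite <- C2. eapply Rle_trans; [apply Cmod_triangle|]. rewrite Cmod_mult, Cmod_R.
  unfold b. rewrite Cmod_mult, Cmod_R, Cmod_Ci, Rmult_1_r, (Rabs_pos_eq (2 * PI)) by lra.
  (* A pair equals 2 tau / ((tau + N)(tau - N)) with N = n+1. As |tau| <= 3/2 and both factors have
     modulus at least N/2, it is at most 12 / N^2. *)
  assert (HC : Cmod (CSeries (fun n => / (tau + RtoC (INR (S n))) + / (tau + RtoC (- INR (S n))))%C) <= 12 * inv_sq_total).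
  { unfold inv_sq_total. rewrite <- Series_scal_l.
    apply Cmod_CSeries_le; [|apply ex_series_scalR, ex_series_inv_sq].
    intros n. pose proof (INR_S_ge_1 n).
    assert (h1 := upper_neq_0 tau (INR (S n)) Ht0). assert (h2 := upper_neq_0 tau (- INR (S n)) Ht0).
    replace (/ (tau + RtoC (INR (S n))) + / (tau + RtoC (- INR (S n))))%C with
      (2 * tau * / (tau + RtoC (INR (S n))) * / (tau + RtoC (- INR (S n))))%C
      by (rewrite RtoC_opp in *; field; auto).
    rewrite !Cmod_mult, !Cmod_inv, Cmod_R, Rabs_pos_eq by (auto; lra).
    assert (Cmod tau <= 3 / 2).
    { eapply Rle_trans; [apply Cmod_le_Re_Im|]. rewrite (Rabs_pos_eq (Im tau)); lra. }
    pose proof (shift_lower_bound_strip tau n (INR (S n)) Hx ltac:(apply Rabs_pos_eq; lra)).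
    pose proof (shift_lower_bound_strip tau n (- INR (S n)) Hx ltac:(rewrite Rabs_Ropp; apply Rabs_pos_eq; lra)).
    replace (12 * / INR (S n) ^ 2) with (2 * (3 / 2) * / (INR (S n) / 2) * / (INR (S n) / 2)) by (field; lra).
    pose proof (Cmod_ge_0 tau).
    assert (/ Cmod (tau + RtoC (INR (S n)))%C <= / (INR (S n) / 2)) by (apply Rinv_le_contravar; lra).
    assert (/ Cmod (tau + RtoC (- INR (S n)))%C <= / (INR (S n) / 2)) by (apply Rinv_le_contravar; lra).
    assert (0 < / Cmod (tau + RtoC (INR (S n)))%C) by (apply Rinv_0_lt_compat; lra).
    assert (0 < / Cmod (tau + RtoC (- INR (S n)))%C) by (apply Rinv_0_lt_compat; lra).
    apply Rmult_le_compat; try lra; [apply Rmult_le_pos; lra|]. apply Rmult_le_compat; lra. }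
  assert (Rabs (2 * PI ^ 2 - 1) <= 2 * PI ^ 2 + 1) by (apply Rabs_le; nra).
  assert (2 * PI * Cmod (CSeries (fun n => / (tau + RtoC (INR (S n))) + / (tau + RtoC (- INR (S n))))%C)
     <= 2 * PI * (12 * inv_sq_total)) by (apply Rmult_le_compat_l; lra).
  lra. }
match type of HA with Cmod (?a1 - ?a2)%C <= _ => match type of HB with Cmod (?b1 - ?b2)%C <= _ =>
  match goal with |- Cmod ?X <= _ => replace X with ((a1 - a2) + (b1 - b2))%C by ring end end end.
eapply Rle_trans; [apply Cmod_triangle|]. unfold main_const. lra.
Qed.

(** * Fourier coefficients *)

Lemma psum_plus (a b : nat -> C) (N : nat) :
  psum (fun k => a k + b k)%C N = (psum a N + psum b N)%C.
Proof. induction N; cbn [psum]; [ring|rewrite IHN; ring]. Qed.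

Lemma psum_scal (c : C) (a : nat -> C) (N : nat) :
  psum (fun k => c * a k)%C N = (c * psum a N)%C.
Proof. induction N; cbn [psum]; [ring|rewrite IHN; ring]. Qed.

Lemma psum_exchange (f : nat -> nat -> C) (M N : nat) :
  psum (fun j => psum (f j) N) M = psum (fun k => psum (fun j => f j k) M) N.
Proof.
induction M; cbn [psum].
- symmetry. now apply psum_0.
- rewrite IHM. now rewrite <- psum_plus.
Qed.

Lemma psum_geom (v : C) (N : nat) : ((1 - v) * psum (fun j => v ^ j) N)%C = (1 - v ^ N)%C.
Proof. induction N; cbn [psum]; [simpl; ring|]. rewrite Cmult_plus_distr_l, IHN, Cpow_S. ring. Qed.

Lemma psum_single (a : nat -> C) (n N : nat) : (n < N)%nat ->
  (forall k, (k < N)%nat -> k <> n -> a k = 0%C) -> psum a N = a n.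
Proof.
intros Hn. induction N; intros H; [lia|]. cbn [psum].
destruct (Nat.eq_dec n N) as [->|Hne].
- rewrite psum_0; [ring|]. intros k Hk. apply H; lia.
- rewrite IHN by (try lia; intros; apply H; lia). rewrite (H N) by lia. ring.
Qed.

Lemma Cmod_psum_le (a : nat -> C) (B : R) (N : nat) :
  (forall k, Cmod (a k) <= B) -> Cmod (psum a N) <= INR N * B.
Proof.
intros H. induction N; cbn [psum]; [rewrite Cmod_0; simpl; lra|].
eapply Rle_trans; [apply Cmod_triangle|]. rewrite S_INR. specialize (H N). lra.
Qed.

Lemma nome_nat (n : nat) : nome (RtoC (INR n)) = 1%C.
Proof.
replace (RtoC (INR n)) with (RtoC (INR n) * 1)%C by ring.
rewrite nome_scal, nome_1. apply Cpow_1_l.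
Qed.

Lemma nome_opp (t : C) : nome (- t)%C = (/ nome t)%C.
Proof. rewrite !nome_Cexp, <- Cexp_opp. f_equal. ring. Qed.

Lemma nome_real_neq_1 (t : R) : 0 < Rabs t < 1 -> nome (RtoC t) <> 1%C.
Proof.
intros Ht E. apply (f_equal Re) in E. unfold nome, Cexp in E. simpl in E.
replace ((2 * PI * 0 - 0 * 1) * t - (2 * PI * 1 + 0 * 0) * 0) with 0 in E by ring.
replace ((2 * PI * 0 - 0 * 1) * 0 + (2 * PI * 1 + 0 * 0) * t) with (2 * (PI * t)) in E by ring.
rewrite exp_0, cos_2a_sin in E. pose proof PI_RGT_0.
assert (Hs : sin (PI * t) = 0) by nra.
destruct (Rle_dec 0 t) as [H0|H0].
- rewrite Rabs_pos_eq in Ht by auto.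
  assert (0 < sin (PI * t)) by (apply sin_gt_0; nra). lra.
- rewrite Rabs_left in Ht by lra.
  assert (0 < sin (PI * - t)) by (apply sin_gt_0; nra).
  rewrite <- Ropp_mult_distr_r, sin_neg in H1. lra.
Qed.

(** Cauchy's estimate by a finite average: a truncation of the series to N terms is averaged over N
    equally spaced points of the circle, which isolates the coefficient exactly. The truncation
    costs at most [eps]. *)
Lemma power_coef_bound (a : nat -> C) (y B : R) (n : nat) : 0 < y ->
  ex_series (fun k => Cmod (a k) * exp (- (2 * PI * y)) ^ k) ->
  (forall x : R, Cmod (CSeries (fun k => a k * nome (x, y) ^ k))%C <= B) ->
  Cmod (a n) * exp (- (2 * PI * y)) ^ n <= B.
Proof.
intros Hy Ha HB. set (r := exp (- (2 * PI * y))) in *.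
assert (Hr : 0 < r) by apply exp_pos.
assert (Hmod : forall x, Cmod (nome (x, y)) = r) by (intros x; now rewrite Cmod_nome).
assert (Hsx : forall x, summable (fun k => a k * nome (x, y) ^ k)%C).
{ intros x. eapply ex_series_ext; [|exact Ha]. intros k. cbn beta.
  now rewrite Cmod_mult, Cmod_pow, Hmod. }
apply le_epsilon. intros eps Heps.
pose proof (Series_tail_lim _ Ha) as HT. apply is_lim_seq_spec in HT.
destruct (HT (mkposreal eps Heps)) as [N0 HN0]. simpl in HN0.
(* N exceeds n and is large enough for the tail to be below [eps]. *)
set (N := (S (N0 + n))). specialize (HN0 N ltac:(unfold N; lia)).
rewrite Rminus_0_r in HN0.
assert (HNp : 0 < INR N) by (apply lt_0_INR; unfold N; lia).
set (z := fun j : nat => nome (INR j / INR N, y)).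
assert (Hps : forall j, Cmod (psum (fun k => a k * z j ^ k)%C N) <= B + eps).
{ intros j. pose proof (CSeries_psum _ N (Hsx (INR j / INR N))) as E. cbn beta in E. fold (z j) in E.
  replace (psum (fun k => a k * z j ^ k)%C N) with
    (CSeries (fun k => a k * z j ^ k) - CSeries (fun k => a (N + k)%nat * z j ^ (N + k)))%C
    by (rewrite E; ring).
  eapply Rle_trans; [apply Cmod_triangle|]. rewrite Cmod_opp. apply Rplus_le_compat; [apply HB|].
  apply Rle_trans with (2 := Rlt_le _ _ HN0). eapply Rle_trans; [|apply Rle_abs].
  apply Cmod_CSeries_le.
  - intros k. unfold z. rewrite Cmod_mult, Cmod_pow, Hmod. lra.
  - apply (ex_series_incr_n (fun k => Cmod (a k) * r ^ k) N). exact Ha. }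
(* The twist [u j] brings index n to 0, and [v k] is the N-th root of unity of exponent k - n. It
   equals 1 only for k = n because k and n are both below N, so there is no aliasing. *)
set (u := fun j : nat => nome (RtoC (- (INR j * INR n / INR N)))).
set (v := fun k : nat => nome (RtoC ((INR k - INR n) / INR N))).
assert (Huz : forall j k, (u j * z j ^ k)%C = (nome (0, y) ^ k * v k ^ j)%C).
{ intros j k. unfold u, z, v. rewrite <- !nome_scal, <- !nome_plus. f_equal.
  generalize (INR N), HNp. intros M HM. apply C_ext; simpl; field; lra. }
assert (Hv : forall k, (k < N)%nat -> k <> n -> psum (fun j => v k ^ j)%C N = 0%C).
{ intros k Hk Hkn.
  assert (Hv1 : (1 - v k)%C <> 0%C).
  { intros E. apply (nome_real_neq_1 ((INR k - INR n) / INR N)).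
    - assert (Hkl : INR k < INR N) by now apply lt_INR.
      assert (Hnl : INR n < INR N) by (apply lt_INR; unfold N; lia).
      assert (Hd : INR k - INR n <> 0) by (intros E'; apply Hkn, INR_eq; lra).
      pose proof (pos_INR k). pose proof (pos_INR n).
      unfold Rdiv. rewrite Rabs_mult, (Rabs_pos_eq (/ INR N)) by (apply Rlt_le, Rinv_0_lt_compat; lra).
      split.
      + apply Rmult_lt_0_compat; [now apply Rabs_pos_lt|now apply Rinv_0_lt_compat].
      + apply Rmult_lt_reg_r with (INR N); auto. rewrite Rmult_assoc, Rinv_l by lra.
        rewrite Rmult_1_r, Rmult_1_l. apply Rabs_def1; lra.
    - fold (v k). replace (v k) with (1 - (1 - v k))%C by ring. rewrite E. ring. }
  assert (HvN : (v k ^ N)%C = 1%C).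
  { unfold v. rewrite <- nome_scal.
    replace (RtoC (INR N) * RtoC ((INR k - INR n) / INR N))%C with (RtoC (INR k) + - RtoC (INR n))%C.
    - rewrite nome_plus, nome_opp, !nome_nat. field.
    - rewrite <- RtoC_mult, <- RtoC_opp, <- RtoC_plus. f_equal. field. lra. }
  pose proof (psum_geom (v k) N) as E. rewrite HvN in E.
  transitivity (/ (1 - v k) * ((1 - v k) * psum (fun j => v k ^ j) N))%C; [field; auto|].
  rewrite E. ring. }
assert (Hvn : psum (fun j => v n ^ j)%C N = RtoC (INR N)).
{ assert (v n = 1%C).
  { unfold v. replace ((INR n - INR n) / INR N) with 0 by (field; lra). apply (nome_nat 0). }
  rewrite H. clear. induction N; [reflexivity|]. cbn [psum]. rewrite IHN, Cpow_1_l, S_INR, RtoC_plus. reflexivity. }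
assert (E : psum (fun j => u j * psum (fun k => a k * z j ^ k) N)%C N =
   (RtoC (INR N) * (a n * nome (0, y) ^ n))%C).
{ rewrite (psum_ext _ (fun j => psum (fun k => (a k * nome (0, y) ^ k) * v k ^ j) N)%C).
  2:{ intros j _. rewrite <- psum_scal. apply psum_ext. intros k _.
      transitivity (a k * (u j * z j ^ k))%C; [ring|]. rewrite Huz. ring. }
  rewrite (psum_exchange (fun j k => (a k * nome (0, y) ^ k) * v k ^ j)%C).
  rewrite (psum_single _ n).
  - rewrite (psum_scal (a n * nome (0, y) ^ n)%C (fun j => v n ^ j)%C), Hvn. ring.
  - unfold N; lia.
  - intros k Hk Hkn. rewrite (psum_scal (a k * nome (0, y) ^ k)%C (fun j => v k ^ j)%C), Hv by auto. ring. }
assert (HF : Cmod (psum (fun j => u j * psum (fun k => a k * z j ^ k) N)%C N) <= INR N * (B + eps)).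
{ apply Cmod_psum_le. intros j. rewrite Cmod_mult.
  replace (Cmod (u j)) with 1; [rewrite Rmult_1_l; auto|].
  unfold u. rewrite Cmod_nome. simpl. replace (- (2 * PI * 0)) with 0 by ring. now rewrite exp_0. }
rewrite E, !Cmod_mult, Cmod_R, Cmod_pow, Hmod, Rabs_pos_eq in HF by lra.
now apply Rmult_le_reg_l in HF.
Qed.

Lemma C_is_series_components (a : nat -> C) (l : C) :
  is_series (V := C_NormedModule) a l ->
  is_series (fun n => Re (a n)) (Re l) /\ is_series (fun n => Im (a n)) (Im l).
Proof.
intros H.
assert (Hs : forall n, sum_n a n = (sum_n (fun k => Re (a k)) n, sum_n (fun k => Im (a k)) n)).
{ induction n; [rewrite !sum_O; apply surjective_pairing|].
  rewrite !sum_Sn, IHn. reflexivity. }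
split; apply filterlim_locally; intros eps;
  destruct (proj1 (filterlim_locally (sum_n a) l) H eps) as [N HN]; exists N; intros n Hn;
  specialize (HN n Hn); rewrite Hs in HN; apply HN.
Qed.

(** The hypothesis gives convergence without absolute values. At a larger radius rho < 1 the terms
    tend to 0, hence are eventually bounded by 1, and a geometric series of ratio r/rho
    dominates. *)
Lemma j_coef_ex_series (c : nat -> Z) (hc : j_fourier_coefficients c) (r : R) : 0 <= r < 1 -> ex_series (fun n => Cmod (RtoC (IZR (c n))) * r ^ n).
Proof.
intros Hr. set (rho := (1 + r) / 2). assert (Hrho : 0 < rho < 1) by (unfold rho; lra).
set (y := - ln rho / (2 * PI)). pose proof PI_RGT_0.
assert (Hy : 0 < y).
{ assert (ln rho < 0) by (rewrite <- ln_1; apply ln_increasing; lra).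
  apply Rdiv_lt_0_compat; lra. }
destruct (C_is_series_components _ _ (hc (0, y) Hy)) as [H1 _].
rewrite nome_imaginary in H1.
replace (exp (- (2 * PI * y))) with rho in H1.
2:{ unfold y. replace (- (2 * PI * (- ln rho / (2 * PI)))) with (ln rho) by (field; lra). now rewrite exp_ln. }
assert (H2 : ex_series (fun n => IZR (c n) * rho ^ n)).
{ eexists. eapply is_series_ext; [|exact H1]. intros n. cbn beta.
  rewrite <- RtoC_pow, <- RtoC_mult. reflexivity. }
apply ex_series_lim_0 in H2. apply is_lim_seq_spec in H2.
destruct (H2 (mkposreal 1 Rlt_0_1)) as [N HN]. simpl in HN.
apply (ex_series_incr_n _ N).
eapply ex_series_comparison; [|apply (ex_series_scalR ((r / rho) ^ N)), (ex_series_geom_nonneg (r / rho))].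
- intros n. specialize (HN (N + n)%nat ltac:(lia)).
  rewrite Rminus_0_r, Rabs_mult, (Rabs_pos_eq (rho ^ (N + n))) in HN by (apply pow_le; lra).
  rewrite Rabs_pos_eq by (apply Rmult_le_pos; [apply Cmod_ge_0|apply pow_le; lra]).
  rewrite Cmod_R, <- pow_add. unfold Rdiv. rewrite Rpow_mult_distr, pow_inv.
  assert (0 < rho ^ (N + n)) by (apply pow_lt; lra).
  replace (Rabs (IZR (c (N + n)%nat)) * r ^ (N + n)) with
    ((Rabs (IZR (c (N + n)%nat)) * rho ^ (N + n)) * (r ^ (N + n) * / rho ^ (N + n))) by (field; lra).
  rewrite <- (Rmult_1_l (r ^ (N + n) * / rho ^ (N + n))) at 2.
  apply Rmult_le_compat_r; [|lra].
  apply Rmult_le_pos; [apply pow_le; lra|apply Rlt_le, Rinv_0_lt_compat; auto].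
- split; [apply Rmult_le_pos; [lra|apply Rlt_le, Rinv_0_lt_compat; lra]|].
  apply Rmult_lt_reg_r with rho; [lra|]. unfold Rdiv. rewrite Rmult_assoc, Rinv_l by lra. unfold rho; lra.
Qed.

Lemma j_coef_summable (c : nat -> Z) (hc : j_fourier_coefficients c) (q : C) : Cmod q < 1 -> summable (fun n => RtoC (IZR (c n)) * q ^ n)%C.
Proof.
intros Hq. eapply ex_series_ext; [|apply (j_coef_ex_series c hc (Cmod q))].
- intros n. cbn beta. now rewrite Cmod_mult, Cmod_pow.
- split; auto using Cmod_ge_0.
Qed.

Lemma j_coef_CSeries (c : nat -> Z) (hc : j_fourier_coefficients c) (tau : C) : 0 < Im tau ->
  CSeries (fun n => RtoC (IZR (c n)) * nome tau ^ n)%C = (j_invariant tau - / nome tau)%C.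
Proof.
intros Ht. destruct (C_is_series_components _ _ (hc tau Ht)) as [H1 H2].
apply C_ext; [exact (is_series_unique _ _ H1)|exact (is_series_unique _ _ H2)].
Qed.

(** [j_const] and one exp(2 pi) come from [j_near_cusp], the other exp(2 pi) bounds the polar term
    1/q for Im tau <= 1, and [main_const] comes from the principal part. *)
Definition error_const : R := j_const + 2 * exp (2 * PI) + main_const.

Lemma coef_minus_main_term (c : nat -> Z) (hc : j_fourier_coefficients c) (n : nat) (y : R) : 0 < y <= 1 ->
  Rabs (IZR (c n) - main_term n) <=
  exp (2 * PI * (INR n * y)) * (exp (2 * PI * (/ (4 * y) + y)) + error_const).
Proof.
intros Hy. set (a := fun k => RtoC (IZR (c k) - main_term k)).
assert (Hy0 : 0 < y) by lra. pose proof PI_RGT_0 as HPI.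
set (B := exp (2 * PI * (/ (4 * y) + y)) + error_const).
set (r := exp (- (2 * PI * y))).
assert (Hr : 0 < r < 1).
{ split; [apply exp_pos|]. rewrite <- exp_0. apply exp_increasing. nra. }
assert (Hrc : Cmod (RtoC r) = r) by (rewrite Cmod_R, Rabs_pos_eq; lra).
assert (Hab : forall (q : C), 0 < Cmod q < 1 ->
   summable (fun k => a k * q ^ k)%C /\
   CSeries (fun k => a k * q ^ k)%C = (CSeries (fun n => RtoC (IZR (c n)) * q ^ n)
      - CSeries (fun n => RtoC (main_term n) * q ^ n))%C).
{ intros q Hq. destruct (main_term_series q Hq) as (S1 & _ & _).
  pose proof (j_coef_summable c hc q ltac:(lra)) as S2.
  assert (E : forall k, (RtoC (IZR (c k)) * q ^ k - RtoC (main_term k) * q ^ k)%C = (a k * q ^ k)%C)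
    by (intros k; unfold a; rewrite RtoC_minus; ring).
  split; [eapply summable_ext; [exact E|now apply summable_minus]|].
  rewrite <- CSeries_minus by auto. apply CSeries_ext. intros k. now rewrite E. }
assert (HB : forall tau, 0 < Im tau -> Im tau = y -> Cmod (CSeries (fun k => a k * nome tau ^ k)%C) <= B).
(* Translation by 1 keeps both the height and the nome, so it suffices to bound the series in the
   strip. *)
{ apply (upper_periodic_reduction (fun tau => Im tau = y -> Cmod (CSeries (fun k => a k * nome tau ^ k)%C) <= B)).
  - intros tau Ht. rewrite Im_RtoC_plus, nome_plus, nome_1, Cmult_1_r. tauto.
  - intros tau Ht Hx Hiy. pose proof (Cmod_nome_lt_1 tau Ht) as Hq.
    destruct (Hab (nome tau) Hq) as [_ ->]. rewrite (j_coef_CSeries c hc) by auto.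
    pose proof (j_near_cusp tau ltac:(lra) Hx) as H1.
    pose proof (main_term_near_cusp tau ltac:(lra) Hx) as H2. rewrite Hiy in H1.
    set (J := j_invariant tau) in *. set (P := CSeries (fun n => RtoC (main_term n) * nome tau ^ n)%C) in *.
    set (X := Cexp (RtoC (2 * PI) * Ci * / tau)%C) in *.
    replace (J - / nome tau - P)%C with ((J - X) + (- (P - X) + - / nome tau))%C by ring.
    eapply Rle_trans; [apply Cmod_triangle|].
    eapply Rle_trans; [apply Rplus_le_compat_l, Cmod_triangle|]. rewrite !Cmod_opp.
    assert (Cmod (/ nome tau)%C <= exp (2 * PI)).
    { rewrite Cmod_inv by (apply Cmod_pos_neq; lra). rewrite Cmod_nome, <- exp_Ropp.
      apply exp_le. rewrite Hiy. nra. }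
    unfold B, error_const. lra. }
pose proof (power_coef_bound a y B n Hy0) as H. fold r in H.
assert (Hex : ex_series (fun k => Cmod (a k) * r ^ k)).
{ destruct (Hab (RtoC r)) as [S _]; [lra|]. eapply ex_series_ext; [|exact S].
  intros k. cbn beta. now rewrite Cmod_mult, Cmod_pow, Hrc. }
specialize (H Hex). assert (H2 : Cmod (a n) * r ^ n <= B).
{ apply H. intros x. apply HB; auto. }
unfold a in H2. rewrite Cmod_R in H2.
assert (Hrn : r ^ n * exp (2 * PI * (INR n * y)) = 1).
{ unfold r. rewrite <- exp_INR_mult, <- exp_plus, <- exp_0. f_equal. ring. }
pose proof (exp_pos (2 * PI * (INR n * y))).
apply Rmult_le_compat_r with (r := exp (2 * PI * (INR n * y))) in H2; [|lra].
rewrite Rmult_assoc, Hrn, Rmult_1_r in H2. lra.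
Qed.

(** * The main term *)

Definition main_fun : R -> R := PSeries main_coef.
Definition main_fun' : R -> R := PSeries (PS_derive main_coef).
Definition main_fun'' : R -> R := PSeries (PS_derive (PS_derive main_coef)).

Lemma main_coef_succ (k : nat) :
  main_coef (S k) = 4 * PI ^ 2 * main_coef k / (INR (S k) * INR (S (S k))).
Proof.
unfold main_coef.
rewrite (fact_simpl (S k)), (fact_simpl k), !mult_INR.
assert (INR (fact k) <> 0) by apply INR_fact_neq_0.
assert (INR (S k) <> 0) by (apply not_0_INR; lia).
assert (INR (S (S k)) <> 0) by (apply not_0_INR; lia).
set (A := 4 * PI ^ 2). change (A ^ S (S k)) with (A * A ^ S k). field. auto.
Qed.

Lemma main_coef_radius : CV_radius main_coef = p_infty.
Proof.
apply CV_radius_infinite_DAlembert.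
- intros n. apply Rgt_not_eq, main_coef_pos.
- pose proof PI_RGT_0.
  apply (is_lim_seq_le_le (fun _ => 0) _ (fun n => 4 * PI ^ 2 * / INR (S n))).
  + intros n. rewrite main_coef_succ. pose proof (main_coef_pos n).
    pose proof (INR_S_ge_1 n). pose proof (INR_S_ge_1 (S n)).
    replace (4 * PI ^ 2 * main_coef n / (INR (S n) * INR (S (S n))) / main_coef n)
      with (4 * PI ^ 2 * / INR (S n) * / INR (S (S n))) by (field; lra).
    assert (0 < / INR (S n)) by (apply Rinv_0_lt_compat; lra).
    assert (0 < / INR (S (S n)) <= 1).
    { split; [apply Rinv_0_lt_compat; lra|]. rewrite <- Rinv_1. apply Rinv_le_contravar; lra. }
    assert (0 < 4 * PI ^ 2 * / INR (S n)) by (apply Rmult_lt_0_compat; nra).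
    rewrite Rabs_pos_eq by (apply Rmult_le_pos; lra). split; [apply Rmult_le_pos; lra|]. nra.
  + apply is_lim_seq_const.
  + replace (Finite 0) with (Rbar_mult (4 * PI ^ 2) 0) by (simpl; f_equal; ring).
    apply is_lim_seq_scal_l. apply (is_lim_seq_incr_1 (fun n => / INR n)).
    replace (Finite 0) with (Rbar_inv p_infty) by reflexivity.
    apply is_lim_seq_inv; [apply is_lim_seq_INR|discriminate].
Qed.

Lemma is_derive_main_fun (x : R) : is_derive main_fun x (main_fun' x).
Proof. apply is_derive_PSeries. now rewrite main_coef_radius. Qed.

Lemma is_derive_main_fun' (x : R) : is_derive main_fun' x (main_fun'' x).
Proof. apply is_derive_PSeries. now rewrite CV_radius_derive, main_coef_radius. Qed.

Lemma ex_series_PSeries (a : nat -> R) (x : R) : CV_radius a = p_infty ->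
  ex_series (fun n => a n * x ^ n).
Proof. intros H. apply ex_pseries_R. apply CV_radius_inside. now rewrite H. Qed.

(** Comparison of coefficients: (k+1)(k+2) a_(k+1) = 4 pi^2 a_k, which is [main_coef_succ]. *)
Lemma main_fun_ode (x : R) : x * main_fun'' x + 2 * main_fun' x = 4 * PI ^ 2 * main_fun x.
Proof.
unfold main_fun, main_fun', main_fun'', PSeries.
pose proof main_coef_radius as H0.
assert (H1 : CV_radius (PS_derive main_coef) = p_infty) by now rewrite CV_radius_derive.
assert (H2 : CV_radius (PS_derive (PS_derive main_coef)) = p_infty) by now rewrite CV_radius_derive.
pose proof (ex_series_PSeries _ x H0) as S0. pose proof (ex_series_PSeries _ x H1) as S1.
pose proof (ex_series_PSeries _ x H2) as S2.
rewrite (Series_incr_1 _ S1).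
assert (S1' := proj1 (ex_series_incr_1 (fun n => PS_derive main_coef n * x ^ n)) S1).
rewrite (Series_incr_1 _ S0).
assert (S0' := proj1 (ex_series_incr_1 (fun n => main_coef n * x ^ n)) S0).
rewrite Rmult_plus_distr_l, Rmult_plus_distr_l, <- !Series_scal_l, (Rplus_comm (2 * _)), <- Rplus_assoc.
rewrite <- Series_plus.
- rewrite Rplus_comm. f_equal.
  + unfold PS_derive. simpl pow. rewrite (main_coef_succ 0). simpl INR. field.
  + apply Series_ext. intros k. unfold PS_derive. rewrite (main_coef_succ (S k)).
    simpl pow. rewrite !S_INR. field. generalize (pos_INR k). lra.
- now apply ex_series_scalR.
- now apply ex_series_scalR.
Qed.

Lemma PSeries_nonneg (a : nat -> R) (x : R) : (forall n, 0 <= a n) -> 0 <= x -> 0 <= PSeries a x.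
Proof. intros Ha Hx. apply Series_nonneg. intros n. apply Rmult_le_pos; auto. now apply pow_le. Qed.

Lemma main_fun'_nonneg (x : R) : 0 <= x -> 0 <= main_fun' x.
Proof.
intros Hx. apply PSeries_nonneg; auto. intros n. unfold PS_derive.
apply Rmult_le_pos; [apply pos_INR|apply Rlt_le, main_coef_pos].
Qed.

Lemma main_fun_lower (x : R) : 0 <= x -> 4 * PI ^ 2 <= main_fun x.
Proof.
intros Hx. replace (4 * PI ^ 2) with (main_coef 0 * x ^ 0) by (unfold main_coef; simpl; field).
apply (term_le_Series (fun n => main_coef n * x ^ n)).
- intros k. apply Rmult_le_pos; [apply Rlt_le, main_coef_pos|now apply pow_le].
- apply ex_series_PSeries, main_coef_radius.
Qed.

Lemma main_fun_pos (x : R) : 0 <= x -> 0 < main_fun x.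
Proof.
intros Hx. eapply Rlt_le_trans; [|now apply main_fun_lower]. generalize PI_RGT_0. nra.
Qed.

Lemma main_term_fun (n : nat) : main_term n = main_fun (INR n).
Proof. reflexivity. Qed.

(** * A lower barrier for the logarithmic derivative *)

(** The logarithmic derivative of x^(-3/4) exp(4 pi sqrt x), which is the leading asymptotic form of
    M up to a constant factor. *)
Definition barrier (x : R) : R := 2 * PI / sqrt x - 3 / (4 * x).

(** With b the barrier, w = M' - b M satisfies w' + (b + 2/x) w = 3/(16 x^2) M by the differential
    equation, and the exponential weight is an integrating factor for b + 2/x. The positive
    right-hand side shows that b is a subsolution of the Riccati equation. *)
Lemma barrier_weight_derive (x : R) : 0 < x ->
  is_derive (fun t => (main_fun' t - barrier t * main_fun t) * exp (4 * PI * sqrt t + 5 / 4 * ln t)) x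
    (3 / (16 * x ^ 2) * main_fun x * exp (4 * PI * sqrt x + 5 / 4 * ln x)).
Proof.
intros Hx. assert (Hs : 0 < sqrt x) by now apply sqrt_lt_R0.
assert (Hss : x = sqrt x * sqrt x) by (symmetry; apply sqrt_sqrt; lra).
pose proof (is_derive_main_fun x) as D0. pose proof (is_derive_main_fun' x) as D1.
pose proof (main_fun_ode x) as HO.
assert (Db : is_derive barrier x (- PI / (x * sqrt x) + 3 / (4 * x ^ 2))).
{ unfold barrier. auto_derive; [repeat split; lra|].
  set (s := sqrt x) in *. rewrite Hss. field. lra. }
assert (De : is_derive (fun t => exp (4 * PI * sqrt t + 5 / 4 * ln t)) x
   ((2 * PI / sqrt x + 5 / (4 * x)) * exp (4 * PI * sqrt x + 5 / 4 * ln x))).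
{ auto_derive; [repeat split; lra|]. field. lra. }
evar_last.
{ apply (is_derive_mult _ _ x _ _
    (is_derive_minus _ _ x _ _ D1 (is_derive_mult _ _ x _ _ Db D0 Rmult_comm)) De Rmult_comm). }
unfold minus, plus, opp, mult; simpl.
set (E := exp (4 * PI * sqrt x + 5 / 4 * ln x)).
assert (H2 : main_fun'' x = (4 * PI ^ 2 * main_fun x - 2 * main_fun' x) / x).
{ rewrite <- HO. field. lra. }
rewrite H2. unfold barrier. set (s := sqrt x) in *. rewrite Hss. field. lra.
Qed.

Lemma mean_value (f f' : R -> R) (a b : R) : a < b ->
  (forall t, a <= t <= b -> is_derive f t (f' t)) ->
  exists c, a <= c <= b /\ f b - f a = f' c * (b - a).
Proof.
intros Hab H. destruct (MVT_gen f a b f') as (c & Hc & E).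
- intros t Ht. rewrite Rmin_left, Rmax_right in Ht by lra. apply H; lra.
- intros t Ht. rewrite Rmin_left, Rmax_right in Ht by lra.
  apply derivable_continuous_pt. exists (f' t). apply is_derive_Reals, H; lra.
- rewrite Rmin_left, Rmax_right in Hc by lra. now exists c.
Qed.

(* At x0 = (3/(8 pi))^2 the barrier vanishes and below it is negative, so no
   boundary behaviour at 0 has to be discussed. *)
Lemma log_derivative_ge_barrier (x : R) : 0 < x -> barrier x * main_fun x <= main_fun' x.
Proof.
intros Hx. pose proof PI_RGT_0 as HPI.
set (s0 := 3 / (8 * PI)). assert (Hs0 : 0 < s0) by (apply Rdiv_lt_0_compat; lra).
assert (Hb : forall t, 0 < t -> barrier t = (sqrt t - s0) * (2 * PI / t)).
{ intros t Ht. assert (Hs : 0 < sqrt t) by now apply sqrt_lt_R0.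
  unfold barrier, s0. rewrite <- (sqrt_sqrt t) at 2 4 by lra. field. lra. }
assert (Hneg : forall t, 0 < t -> sqrt t <= s0 -> 0 <= main_fun' t - barrier t * main_fun t).
{ intros t Ht Hts. pose proof (main_fun'_nonneg t ltac:(lra)). pose proof (main_fun_pos t ltac:(lra)).
  assert (barrier t <= 0).
  { rewrite Hb by auto. assert (0 < 2 * PI / t) by (apply Rdiv_lt_0_compat; lra). nra. }
  nra. }
destruct (Rle_dec (sqrt x) s0) as [H|H]; [specialize (Hneg x Hx H); lra|].
set (x0 := s0 * s0). assert (Hx0 : 0 < x0) by (unfold x0; nra).
assert (Hsx0 : sqrt x0 = s0) by (apply sqrt_square; lra).
assert (Hlt : x0 < x).
{ apply sqrt_lt_0_alt. rewrite Hsx0. lra. }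
destruct (mean_value _ _ x0 x Hlt (fun t Ht => barrier_weight_derive t ltac:(lra))) as (c & Hc & E).
specialize (Hneg x0 Hx0 ltac:(lra)).
set (E1 := exp (4 * PI * sqrt x + 5 / 4 * ln x)) in *.
set (E0 := exp (4 * PI * sqrt x0 + 5 / 4 * ln x0)) in *.
assert (P1 : 0 < E1) by apply exp_pos. assert (P0 : 0 < E0) by apply exp_pos.
assert (Pc : 0 <= 3 / (16 * c ^ 2) * main_fun c * exp (4 * PI * sqrt c + 5 / 4 * ln c)).
{ apply Rmult_le_pos; [|apply Rlt_le, exp_pos].
  apply Rmult_le_pos; [|apply Rlt_le, main_fun_pos; lra].
  apply Rlt_le, Rdiv_lt_0_compat; [lra|]. assert (0 < c ^ 2) by (apply pow_lt; lra). lra. }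
assert (0 <= (main_fun' x - barrier x * main_fun x) * E1).
{ assert (0 <= (main_fun' x0 - barrier x0 * main_fun x0) * E0) by (apply Rmult_le_pos; lra).
  assert (0 <= 3 / (16 * c ^ 2) * main_fun c * exp (4 * PI * sqrt c + 5 / 4 * ln c) * (x - x0))
    by (apply Rmult_le_pos; lra). lra. }
destruct (Rle_dec (barrier x * main_fun x) (main_fun' x)); auto. exfalso. nra.
Qed.

Definition logd (x : R) : R := main_fun' x / main_fun x.
(** The second derivative of M is eliminated by the differential equation, so only [logd x] and x
    remain. *)
Definition logd' (x : R) : R := (4 * PI ^ 2 - 2 * logd x) / x - logd x ^ 2.
Definition logd'' (x : R) : R :=
  2 * logd x ^ 3 + 6 / x * logd x ^ 2 + (6 / x ^ 2 - 8 * PI ^ 2 / x) * logd x - 12 * PI ^ 2 / x ^ 2.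

Lemma is_derive_ln_main (x : R) : 0 < x -> is_derive (fun t => ln (main_fun t)) x (logd x).
Proof.
intros Hx. pose proof (main_fun_pos x ltac:(lra)).
evar_last.
{ apply (is_derive_comp ln main_fun); [apply is_derive_ln; auto|apply is_derive_main_fun]. }
unfold scal; simpl; unfold mult; simpl. unfold logd. field. lra.
Qed.

Lemma is_derive_logd (x : R) : 0 < x -> is_derive logd x (logd' x).
Proof.
intros Hx. pose proof (main_fun_pos x ltac:(lra)). pose proof (main_fun_ode x) as HO.
evar_last.
{ apply (is_derive_div _ _ x _ _ (is_derive_main_fun' x) (is_derive_main_fun x)). lra. }
assert (H2 : main_fun'' x = (4 * PI ^ 2 * main_fun x - 2 * main_fun' x) / x) by (rewrite <- HO; field; lra).
rewrite H2. unfold logd', logd. field. lra.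
Qed.

Lemma is_derive_logd' (x : R) : 0 < x -> is_derive logd' x (logd'' x).
Proof.
intros Hx. pose proof (is_derive_logd x Hx) as D.
assert (De : ex_derive logd x) by (eexists; exact D).
unfold logd' at 1. auto_derive; [repeat split; auto; lra|].
replace (Derive (fun y => logd y) x) with (logd' x) by (symmetry; apply is_derive_unique; exact D).
unfold logd', logd''. field. lra.
Qed.

Lemma logd_barrier (x : R) : 0 < x -> barrier x <= logd x.
Proof.
intros Hx. pose proof (main_fun_pos x ltac:(lra)). pose proof (log_derivative_ge_barrier x Hx).
apply Rmult_le_reg_r with (main_fun x); auto. unfold logd, Rdiv. rewrite Rmult_assoc, Rinv_l; lra.
Qed.

Lemma PI_ge_3 : 3 <= PI.
Proof. generalize PI2_3_2. unfold PI2. lra. Qed.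

(** Here a = 2 pi, t = 1/sqrt x and g is the logarithmic derivative. Both polynomials are monotone
    for g >= u, and at g = u they equal -(a/2) t^3 + (15/16) t^4 and (3/8) a t^5 - (63/32) t^6; then
    a >= 6 and t <= 1 suffice. *)
Lemma logd_polynomial_bounds (a t g : R) : 6 <= a -> 0 < t <= 1 -> a * t - 3 / 4 * t ^ 2 <= g ->
  a ^ 2 * t ^ 2 - 2 * t ^ 2 * g - g ^ 2 <= - 2 * t ^ 4 /\
  t ^ 6 / 4 <= 2 * g ^ 3 + 6 * t ^ 2 * g ^ 2 + (6 * t ^ 4 - 2 * a ^ 2 * t ^ 2) * g - 3 * a ^ 2 * t ^ 4.
Proof.
intros Ha Ht Hg. set (u := a * t - 3 / 4 * t ^ 2) in *.
assert (Ht2 : 0 < t ^ 2) by nra. assert (Htt : t ^ 2 <= t) by nra.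
assert (Hu : 0 < u) by (unfold u; nra).
assert (Ht3 : 0 < t ^ 3) by (apply pow_lt; lra). assert (Ht5 : 0 < t ^ 5) by (apply pow_lt; lra).
assert (H43 : t ^ 4 <= t ^ 3) by (replace (t ^ 4) with (t * t ^ 3) by ring; nra).
assert (H65 : t ^ 6 <= t ^ 5) by (replace (t ^ 6) with (t * t ^ 5) by ring; nra).
split.
- apply Rle_trans with (a ^ 2 * t ^ 2 - 2 * t ^ 2 * u - u ^ 2); [nra|].
  replace (a ^ 2 * t ^ 2 - 2 * t ^ 2 * u - u ^ 2) with (- (a / 2) * t ^ 3 + 15 / 16 * t ^ 4)
    by (unfold u; field).
  nra.
- set (Q := fun v => 2 * v ^ 3 + 6 * t ^ 2 * v ^ 2 + (6 * t ^ 4 - 2 * a ^ 2 * t ^ 2) * v - 3 * a ^ 2 * t ^ 4).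
  change (t ^ 6 / 4 <= Q g). apply Rle_trans with (Q u).
  + replace (Q u) with (3 / 8 * a * t ^ 5 - 63 / 32 * t ^ 6) by (unfold Q, u; field). nra.
  + assert (E : Q g - Q u = (g - u) * (2 * (g ^ 2 + g * u + u ^ 2) + 6 * t ^ 2 * (g + u) + 6 * t ^ 4 - 2 * a ^ 2 * t ^ 2))
      by (unfold Q; ring).
    (* a t = u + (3/4) t^2, so the only negative term -2 a^2 t^2 of the second factor is at least -2
       (u + t^2)^2, while the other terms sum to at least 6 (u + t^2)^2. *)
    assert (H1 : (a * t) ^ 2 <= (u + t ^ 2) ^ 2) by (apply pow_incr; unfold u; nra).
    assert (0 <= 2 * (g ^ 2 + g * u + u ^ 2) + 6 * t ^ 2 * (g + u) + 6 * t ^ 4 - 2 * a ^ 2 * t ^ 2).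
    { assert (u ^ 2 <= g ^ 2) by (apply pow_incr; lra). assert (u ^ 2 <= g * u) by nra.
      assert (t ^ 2 * u <= t ^ 2 * g) by nra.
      replace ((a * t) ^ 2) with (a ^ 2 * t ^ 2) in H1 by ring.
      replace ((u + t ^ 2) ^ 2) with (u ^ 2 + 2 * (t ^ 2 * u) + t ^ 4) in H1 by ring. nra. }
    assert (0 <= (g - u) * (2 * (g ^ 2 + g * u + u ^ 2) + 6 * t ^ 2 * (g + u) + 6 * t ^ 4 - 2 * a ^ 2 * t ^ 2))
      by (apply Rmult_le_pos; lra).
    lra.
Qed.

Lemma logd_bounds (x : R) : 1 <= x -> logd' x <= - (2 / x ^ 2) /\ / (4 * x ^ 3) <= logd'' x.
Proof.
intros Hx. pose proof PI_ge_3. pose proof (logd_barrier x ltac:(lra)) as Hb.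
set (t := / sqrt x). set (s := sqrt x) in *.
assert (Hs : 1 <= s) by (unfold s; rewrite <- sqrt_1; apply sqrt_le_1; lra).
assert (Hss : x = s * s) by (unfold s; rewrite sqrt_sqrt; lra).
assert (Ht : 0 < t <= 1).
{ unfold t. split; [apply Rinv_0_lt_compat; lra|]. rewrite <- Rinv_1. apply Rinv_le_contravar; lra. }
destruct (logd_polynomial_bounds (2 * PI) t (logd x)) as [B1 B2]; [lra|auto| |].
- eapply Rle_trans; [|exact Hb]. unfold barrier. fold s. right. unfold t. rewrite Hss. field. lra.
- assert (Et : t ^ 2 = / x) by (unfold t; rewrite Hss; field; lra).
  assert (Et4 : t ^ 4 = / x ^ 2) by (unfold t; rewrite Hss; field; lra).
  assert (Et6 : t ^ 6 = / x ^ 3) by (unfold t; rewrite Hss; field; lra).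
  rewrite Et, Et4 in B1. rewrite Et, Et4, Et6 in B2. split.
  + unfold logd'. eapply Rle_trans; [|eapply Rle_trans; [exact B1|]]; right; field; lra.
  + unfold logd''. eapply Rle_trans; [|eapply Rle_trans; [exact B2|]]; right; field; lra.
Qed.

Lemma is_derive_shift (f : R -> R) (x l : R) : is_derive f (x + 1) l -> is_derive (fun t => f (t + 1)) x l.
Proof.
intros H. evar_last.
{ apply (is_derive_comp f (fun t => t + 1)); [exact H|].
  apply (is_derive_plus (fun t => t) (fun _ => 1)); [apply is_derive_id|apply is_derive_const]. }
unfold scal, plus, one, zero; simpl. unfold mult; simpl. ring.
Qed.

(** * Finite differences of log M and growth of M *)

Lemma second_difference (f f1 f2 : R -> R) (x : R) :
  (forall t, x <= t -> is_derive f t (f1 t)) -> (forall t, x <= t -> is_derive f1 t (f2 t)) ->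
  exists c, x <= c <= x + 2 /\ f (x + 2) - 2 * f (x + 1) + f x = f2 c.
Proof.
intros H1 H2.
destruct (mean_value (fun t => f (t + 1) - f t) (fun t => f1 (t + 1) - f1 t) x (x + 1)) as (c & Hc & E).
- lra.
- intros t Ht. apply (is_derive_minus (fun t => f (t + 1)) f).
  + apply is_derive_shift, H1; lra.
  + apply H1; lra.
- destruct (mean_value f1 f2 c (c + 1)) as (d & Hd & E2); [lra|intros t Ht; apply H2; lra|].
  exists d. split; [lra|]. replace (x + 1 + 1) with (x + 2) in E by ring. lra.
Qed.

Lemma third_difference (f f1 f2 f3 : R -> R) (x : R) :
  (forall t, x <= t -> is_derive f t (f1 t)) -> (forall t, x <= t -> is_derive f1 t (f2 t)) ->
  (forall t, x <= t -> is_derive f2 t (f3 t)) ->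
  exists c, x <= c <= x + 3 /\ f (x + 3) - 3 * f (x + 2) + 3 * f (x + 1) - f x = f3 c.
Proof.
intros H1 H2 H3.
destruct (second_difference (fun t => f (t + 1) - f t) (fun t => f1 (t + 1) - f1 t)
  (fun t => f2 (t + 1) - f2 t) x) as (c & Hc & E).
- intros t Ht. apply (is_derive_minus (fun t => f (t + 1)) f); [apply is_derive_shift|]; apply H1; lra.
- intros t Ht. apply (is_derive_minus (fun t => f1 (t + 1)) f1); [apply is_derive_shift|]; apply H2; lra.
- destruct (mean_value f2 f3 c (c + 1)) as (d & Hd & E2); [lra|intros t Ht; apply H3; lra|].
  exists d. split; [lra|].
  replace (x + 2 + 1) with (x + 3) in E by ring. replace (x + 1 + 1) with (x + 2) in E by ring. lra.
Qed.

Lemma ln_main_differences (x : R) : 1 <= x ->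
  ln (main_fun (x + 2)) - 2 * ln (main_fun (x + 1)) + ln (main_fun x) <= - (2 / (x + 2) ^ 2) /\
  / (4 * (x + 3) ^ 3) <=
  ln (main_fun (x + 3)) - 3 * ln (main_fun (x + 2)) + 3 * ln (main_fun (x + 1)) - ln (main_fun x).
Proof.
intros Hx. split.
- destruct (second_difference (fun t => ln (main_fun t)) logd logd' x) as (c & Hc & ->).
  + intros t Ht. apply is_derive_ln_main; lra.
  + intros t Ht. apply is_derive_logd; lra.
  + destruct (logd_bounds c) as [H _]; [lra|]. eapply Rle_trans; [exact H|].
    apply Ropp_le_contravar, Rmult_le_compat_l; [lra|].
    apply Rinv_le_contravar; [apply pow_lt; lra|]. apply pow_incr; lra.
- destruct (third_difference (fun t => ln (main_fun t)) logd logd' logd'' x) as (c & Hc & ->).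
  + intros t Ht. apply is_derive_ln_main; lra.
  + intros t Ht. apply is_derive_logd; lra.
  + intros t Ht. apply is_derive_logd'; lra.
  + destruct (logd_bounds c) as [_ H]; [lra|]. eapply Rle_trans; [|exact H].
    assert (0 < c ^ 3) by (apply pow_lt; lra).
    apply Rinv_le_contravar; [lra|]. apply Rmult_le_compat_l; [lra|]. apply pow_incr; lra.
Qed.

(** By the barrier, ln M(x) - 4 pi sqrt x + (3/4) ln x is nondecreasing, and M(1) >= 4 pi^2 starts
    it at x = 1. The exponent -3/4 of x is weakened to -1 to avoid fractional powers. *)
Lemma main_fun_growth (x : R) : 1 <= x ->
  4 * PI ^ 2 * exp (4 * PI * sqrt x - 4 * PI) / x <= main_fun x.
Proof.
intros Hx. pose proof PI_ge_3.
assert (HA : 0 < 4 * PI ^ 2) by nra.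
assert (H1 : ln (4 * PI ^ 2) + (4 * PI * sqrt x - 4 * PI) - 3 / 4 * ln x <= ln (main_fun x)).
{ assert (H1 : ln (4 * PI ^ 2) <= ln (main_fun 1)) by (apply ln_le; auto; apply main_fun_lower; lra).
  destruct (Req_dec x 1) as [->|Hne]; [rewrite sqrt_1, ln_1; lra|].
  destruct (mean_value (fun t => ln (main_fun t) - (4 * PI * sqrt t - 3 / 4 * ln t))
    (fun t => logd t - barrier t) 1 x) as (c & Hc & E).
  - lra.
  - intros t Ht. apply (is_derive_minus (fun t => ln (main_fun t))); [apply is_derive_ln_main; lra|].
    assert (0 < sqrt t) by (apply sqrt_lt_R0; lra).
    unfold barrier. auto_derive; [repeat split; lra|]. field. lra.
  - pose proof (logd_barrier c ltac:(lra)). rewrite sqrt_1, ln_1 in E.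
    assert (0 <= (logd c - barrier c) * (x - 1)) by (apply Rmult_le_pos; lra). lra. }
assert (H2 : 0 <= ln x) by (rewrite <- ln_1; apply ln_le; lra).
rewrite <- (exp_ln (main_fun x)) by (apply main_fun_pos; lra).
eapply Rle_trans; [|apply exp_le; exact H1].
apply Rle_trans with (exp (ln (4 * PI ^ 2) + (4 * PI * sqrt x - 4 * PI) - ln x)).
- right. unfold Rminus at 2. rewrite !exp_plus, exp_Ropp, !exp_ln by lra. reflexivity.
- apply exp_le. lra.
Qed.

(** * Large indices *)

(** The dominant term is [j_const] = 1488 e^15; all terms together stay below 3000 e^15, and e^10 >=
    3000. *)
Lemma error_const_le : error_const <= exp 25.
Proof.
pose proof PI_ge_3. pose proof PI_4.
assert (HT : 0 <= inv_sq_total <= 3).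
{ split; [apply inv_sq_total_pos|]. change inv_sq_total with (zeta 2). rewrite zeta_2. nra. }
assert (H1 : exp 1 <= 3) by apply exp_le_3.
assert (HE : 1 <= exp 15) by (rewrite <- exp_0; apply exp_le; lra).
assert (H16 : exp 16 = exp 1 * exp 15) by (rewrite <- exp_plus; f_equal; ring).
assert (H25 : exp 25 = exp 10 * exp 15) by (rewrite <- exp_plus; f_equal; ring).
assert (H10 : 3000 <= exp 10).
{ replace 10 with (INR 20 * (1 / 2)) by (simpl; field). rewrite exp_INR_mult.
  pose proof (exp_ineq1_le (1 / 2)).
  apply Rle_trans with ((3 / 2) ^ 20); [lra|]. apply pow_incr. lra. }
assert (HP1 : exp (2 * PI) <= exp 15) by (apply exp_le; lra).
assert (HP2 : exp (4 * PI) <= exp 16) by (apply exp_le; lra).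
assert (HP3 : 2 * inv_sq_total * exp (4 * PI) <= 6 * exp 16).
{ apply Rmult_le_compat; try lra. apply Rlt_le, exp_pos. }
assert (HP4 : 2 * PI * (12 * inv_sq_total) <= 8 * 36) by (apply Rmult_le_compat; lra).
unfold error_const, j_const, main_const. rewrite H25. nra.
Qed.

(** s/8 <= exp(s/8 - 1) gives s^8 <= 8^8 exp(s - 8). Moreover 32 * 8^8 = 2^29 <= e^29, and 5s - 7 >=
    33. *)
Lemma pow_8_le_exp (s : R) : 8 <= s -> 32 * s ^ 8 <= exp (6 * s - 15).
Proof.
intros Hs.
assert (H1 : s ^ 8 <= 8 ^ 8 * exp (s - 8)).
{ replace (s - 8) with (INR 8 * (s / 8 - 1)) by (simpl; field). rewrite exp_INR_mult, <- Rpow_mult_distr.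
  apply pow_incr. pose proof (exp_ineq1_le (s / 8 - 1)). lra. }
assert (H2 : 2 ^ 29 <= exp (5 * s - 7)).
{ apply Rle_trans with (exp (INR 29 * 1)).
  - rewrite exp_INR_mult. apply pow_incr. pose proof (exp_ineq1_le 1). lra.
  - apply exp_le. rewrite INR_IZR_INZ. simpl. lra. }
replace (6 * s - 15) with ((5 * s - 7) + (s - 8)) by ring. rewrite exp_plus.
pose proof (exp_pos (s - 8)). nra.
Qed.

(** The precision is dictated by the third difference: the constant 64 becomes 32 after taking
    logarithms, and eight such errors exactly fill the margin 1/(4 (n+3)^3). *)
Lemma coef_relative_error (c : nat -> Z) (hc : j_fourier_coefficients c) (n : nat) : (64 <= n)%nat ->
  Rabs (IZR (c n) - main_fun (INR n)) <= main_fun (INR n) * / (64 * (INR n + 3) ^ 3).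
Proof.
intros Hn. pose proof PI_ge_3 as HPI.
assert (Hx : 64 <= INR n) by (apply le_INR in Hn; rewrite INR_IZR_INZ in Hn at 1; exact Hn).
set (x := INR n) in *. set (s := sqrt x).
assert (Hs : 8 <= s).
{ unfold s. replace 8 with (sqrt 64) by (replace 64 with (8 * 8) by ring; apply sqrt_square; lra).
  apply sqrt_le_1; lra. }
assert (Hss : x = s * s) by (unfold s; rewrite sqrt_sqrt; lra).
assert (Hy : 0 < / (2 * s) <= 1).
{ split; [apply Rinv_0_lt_compat; lra|]. rewrite <- Rinv_1. apply Rinv_le_contravar; lra. }
assert (Hys : / s <= 1) by (rewrite <- Rinv_1; apply Rinv_le_contravar; lra).
(* This height balances exp(2 pi n y) against exp(2 pi / (4 y)): both become exp(pi s). *)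
pose proof (coef_minus_main_term c hc n (/ (2 * s)) Hy) as H. fold x in H.
rewrite main_term_fun in H. fold x in H.
replace (2 * PI * (x * / (2 * s))) with (PI * s) in H by (rewrite Hss; field; lra).
replace (2 * PI * (/ (4 * / (2 * s)) + / (2 * s))) with (PI * s + PI * / s) in H by (field; lra).
assert (H1 : exp (PI * s + PI * / s) <= exp (PI * s + PI)) by (apply exp_le; nra).
assert (H2 : error_const <= exp (PI * s + PI)).
{ eapply Rle_trans; [apply error_const_le|]. apply exp_le.
  assert (3 * 8 <= PI * s) by (apply Rmult_le_compat; lra). lra. }
assert (H3 : Rabs (IZR (c n) - main_fun x) <= 2 * exp (2 * PI * s + PI)).
{ eapply Rle_trans; [exact H|]. replace (2 * PI * s + PI) with (PI * s + (PI * s + PI)) by ring.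
  rewrite (exp_plus (PI * s) (PI * s + PI)). pose proof (exp_pos (PI * s)).
  replace (2 * (exp (PI * s) * exp (PI * s + PI))) with (exp (PI * s) * (2 * exp (PI * s + PI))) by ring.
  apply Rmult_le_compat_l; lra. }
eapply Rle_trans; [exact H3|].
pose proof (main_fun_growth x ltac:(lra)) as HG. fold s in HG.
set (D := 64 * (x + 3) ^ 3).
assert (HD : 0 < D) by (unfold D; assert (0 < (x + 3) ^ 3) by (apply pow_lt; lra); lra).
apply Rmult_le_reg_r with D; auto.
replace (main_fun x * / D * D) with (main_fun x) by (field; lra).
eapply Rle_trans; [|exact HG].
(* The main term exceeds the error by the factor exp(pi (2s - 5)), which has to beat a polynomial of
   degree 8 in s. *)
assert (Hexp : exp (4 * PI * s - 4 * PI) = exp (2 * PI * s + PI) * exp (PI * (2 * s - 5))).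
{ rewrite <- exp_plus. f_equal. ring. }
rewrite Hexp.
assert (H4 : exp (6 * s - 15) <= exp (PI * (2 * s - 5))).
{ apply exp_le. assert (3 * (2 * s - 5) <= PI * (2 * s - 5)) by (apply Rmult_le_compat_r; lra). lra. }
pose proof (pow_8_le_exp s Hs) as H5.
apply Rmult_le_reg_r with x; [lra|].
replace (4 * PI ^ 2 * (exp (2 * PI * s + PI) * exp (PI * (2 * s - 5))) / x * x)
  with (exp (2 * PI * s + PI) * (4 * PI ^ 2 * exp (PI * (2 * s - 5)))) by (field; lra).
replace (2 * exp (2 * PI * s + PI) * D * x) with (exp (2 * PI * s + PI) * (2 * D * x)) by ring.
apply Rmult_le_compat_l; [apply Rlt_le, exp_pos|].
(* x + 3 <= 2x, and 64 (2x)^3 x = 512 s^8 = 16 * 32 s^8; the remaining factor 2 * 16 = 32 is covered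
   by 4 pi^2 >= 36. *)
assert (H6 : D * x <= 64 * (2 * x) ^ 3 * x).
{ unfold D. apply Rmult_le_compat_r; [lra|]. apply Rmult_le_compat_l; [lra|]. apply pow_incr; lra. }
replace (64 * (2 * x) ^ 3 * x) with (16 * (32 * s ^ 8)) in H6 by (rewrite Hss; ring).
assert (36 <= 4 * PI ^ 2) by nra.
assert (0 <= 32 * s ^ 8) by (assert (0 < s ^ 8) by (apply pow_lt; lra); lra).
nra.
Qed.

(** ln t <= t - 1 is applied to r = a/m for the upper bound and to 1/r for the lower one. *)
Lemma ln_relative_error (a m e : R) : 0 < m -> 0 <= e <= 1 / 2 -> Rabs (a - m) <= m * e ->
  0 < a /\ Rabs (ln a - ln m) <= 2 * e.
Proof.
intros Hm He H. apply Rabs_le_between in H. assert (Ha : 0 < a) by nra. split; auto.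
rewrite <- ln_div by auto. set (r := a / m).
assert (Hr : 1 - e <= r <= 1 + e).
{ unfold r. split; apply Rmult_le_reg_r with m; auto; unfold Rdiv; rewrite Rmult_assoc, Rinv_l; lra. }
assert (Hl : forall t, 0 < t -> ln t <= t - 1).
{ intros t Ht. pose proof (exp_ineq1_le (ln t)). rewrite exp_ln in H0 by auto. lra. }
apply Rabs_le. split.
- pose proof (Hl (/ r) ltac:(apply Rinv_0_lt_compat; lra)) as H1. rewrite ln_Rinv in H1 by lra.
  assert (/ r <= / (1 - e)) by (apply Rinv_le_contravar; lra).
  assert (/ (1 - e) - 1 <= 2 * e).
  { replace (/ (1 - e) - 1) with (e * / (1 - e)) by (field; lra).
    assert (/ (1 - e) <= 2) by (replace 2 with (/ (1 / 2)) by field; apply Rinv_le_contravar; lra).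
    nra. }
  lra.
- pose proof (Hl r ltac:(lra)). lra.
Qed.

(** The bound is expressed through n alone, so that the same number serves for the indices n to n+3
    of a difference. *)
Lemma ln_coef_error (c : nat -> Z) (hc : j_fourier_coefficients c) (n k : nat) : (64 <= n)%nat -> (n <= k)%nat ->
  0 < IZR (c k) /\ Rabs (ln (IZR (c k)) - ln (main_fun (INR k))) <= / (32 * (INR n + 3) ^ 3).
Proof.
intros Hn Hk.
assert (Hx : 64 <= INR n) by (apply le_INR in Hn; rewrite INR_IZR_INZ in Hn at 1; exact Hn).
apply le_INR in Hk as Hkx.
assert (H1 : 64 <= (INR k + 3) ^ 3) by (apply Rle_trans with (INR k + 3); [lra|]; simpl; nra).
destruct (ln_relative_error (IZR (c k)) (main_fun (INR k)) (/ (64 * (INR k + 3) ^ 3))) as [H2 H3].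
- apply main_fun_pos; lra.
- split; [apply Rlt_le, Rinv_0_lt_compat; lra|].
  replace (1 / 2) with (/ 2) by field. apply Rinv_le_contravar; lra.
- apply coef_relative_error; auto; lia.
- split; auto. eapply Rle_trans; [exact H3|].
  replace (2 * / (64 * (INR k + 3) ^ 3)) with (/ (32 * (INR k + 3) ^ 3)) by (field; lra).
  apply Rinv_le_contravar.
  + assert (0 < (INR n + 3) ^ 3) by (apply pow_lt; lra). lra.
  + apply Rmult_le_compat_l; [lra|]. apply pow_incr; lra.
Qed.

Lemma ln_le_inv (x y : R) : 0 < x -> 0 < y -> ln x <= ln y -> x <= y.
Proof. intros Hx Hy H. rewrite <- (exp_ln x), <- (exp_ln y) by auto. now apply exp_le. Qed.

Lemma large_log_concave (c : nat -> Z) (hc : j_fourier_coefficients c) (n : nat) : (64 <= n)%nat ->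
  IZR (c n) * IZR (c (n + 2)%nat) - IZR (c (n + 1)%nat) ^ 2 <= 0.
Proof.
intros Hn.
assert (Hx : 64 <= INR n) by (apply le_INR in Hn; rewrite INR_IZR_INZ in Hn at 1; exact Hn).
destruct (ln_coef_error c hc n n) as [P0 E0]; try lia.
destruct (ln_coef_error c hc n (n + 1)) as [P1 E1]; try lia.
destruct (ln_coef_error c hc n (n + 2)) as [P2 E2]; try lia.
destruct (ln_main_differences (INR n)) as [HD _]; [lra|].
rewrite plus_INR in E1, E2. change (INR 1) with 1 in E1. change (INR 2) with 2 in E2.
assert (Hb : / (32 * (INR n + 3) ^ 3) <= / (2 * (INR n + 2) ^ 2)).
{ assert (0 < (INR n + 2) ^ 2) by (apply pow_lt; lra). apply Rinv_le_contravar; [lra|].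
  assert ((INR n + 2) ^ 2 <= (INR n + 3) ^ 2) by (apply pow_incr; lra). simpl in *. nra. }
(* The weights 1, 2, 1 add up to 4, so the margin is split into four equal errors. *)
replace (2 / (INR n + 2) ^ 2) with (4 * / (2 * (INR n + 2) ^ 2)) in HD by (field; lra).
apply Rabs_le_between in E0. apply Rabs_le_between in E1. apply Rabs_le_between in E2.
enough (IZR (c n) * IZR (c (n + 2)%nat) <= IZR (c (n + 1)%nat) ^ 2) by lra.
apply ln_le_inv; [now apply Rmult_lt_0_compat|now apply pow_lt|].
rewrite ln_mult by auto. simpl. rewrite Rmult_1_r, ln_mult by auto. lra.
Qed.

Lemma large_third_difference (c : nat -> Z) (hc : j_fourier_coefficients c) (n : nat) : (64 <= n)%nat ->
  IZR (c (n + 2)%nat) ^ 3 * IZR (c n) <= IZR (c (n + 1)%nat) ^ 3 * IZR (c (n + 3)%nat) /\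
  0 < IZR (c n) /\ 0 < IZR (c (n + 1)%nat) /\ 0 < IZR (c (n + 2)%nat).
Proof.
intros Hn.
assert (Hx : 64 <= INR n) by (apply le_INR in Hn; rewrite INR_IZR_INZ in Hn at 1; exact Hn).
destruct (ln_coef_error c hc n n) as [P0 E0]; try lia.
destruct (ln_coef_error c hc n (n + 1)) as [P1 E1]; try lia.
destruct (ln_coef_error c hc n (n + 2)) as [P2 E2]; try lia.
destruct (ln_coef_error c hc n (n + 3)) as [P3 E3]; try lia.
repeat split; auto.
destruct (ln_main_differences (INR n)) as [_ HD]; [lra|].
rewrite plus_INR in E1, E2, E3. change (INR 1) with 1 in E1. change (INR 2) with 2 in E2.
replace (INR 3) with 3 in E3 by (simpl; ring).
assert (0 < (INR n + 3) ^ 3) by (apply pow_lt; lra).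
(* The weights 1, 3, 3, 1 add up to 8, so the margin is split into eight equal errors. *)
replace (/ (4 * (INR n + 3) ^ 3)) with (8 * / (32 * (INR n + 3) ^ 3)) in HD by (field; lra).
apply Rabs_le_between in E0. apply Rabs_le_between in E1. apply Rabs_le_between in E2.
apply Rabs_le_between in E3.
apply ln_le_inv; [apply Rmult_lt_0_compat; auto; now apply pow_lt..|].
assert (Hcube : forall t, 0 < t -> ln (t ^ 3) = 3 * ln t).
{ intros t Ht. simpl. rewrite Rmult_1_r, !ln_mult by (auto; now apply Rmult_lt_0_compat). ring. }
rewrite !ln_mult, !Hcube by (auto; now apply pow_lt). lra.
Qed.

(** * Small indices *)

Fixpoint peval (l : list Z) (q : R) : R :=
  match l with [] => 0 | a :: l' => IZR a + q * peval l' q end.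

Fixpoint padd (l m : list Z) : list Z :=
  match l, m with
  | [], _ => m
  | _, [] => l
  | a :: l', b :: m' => (a + b)%Z :: padd l' m'
  end.

Definition pscal (a : Z) (l : list Z) : list Z := map (Z.mul a) l.

Fixpoint pmul (l m : list Z) : list Z :=
  match l with [] => [] | a :: l' => padd (pscal a m) (0%Z :: pmul l' m) end.

Lemma peval_padd (l m : list Z) (q : R) : peval (padd l m) q = peval l q + peval m q.
Proof.
revert m. induction l as [|a l IH]; intros [|b m]; simpl; try ring.
rewrite IH, plus_IZR. ring.
Qed.

Lemma peval_pscal (a : Z) (l : list Z) (q : R) : peval (pscal a l) q = IZR a * peval l q.
Proof. unfold pscal. induction l; simpl; [ring|]. rewrite IHl, mult_IZR. ring. Qed.

Lemma peval_pmul (l m : list Z) (q : R) : peval (pmul l m) q = peval l q * peval m q.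
Proof. induction l; simpl; [ring|]. rewrite peval_padd, peval_pscal. simpl. rewrite IHl. ring. Qed.

Definition pnorm (l : list Z) : R := fold_right (fun a s => Rabs (IZR a) + s) 0 l.

Lemma peval_bound (l : list Z) (q : R) : 0 <= q <= 1 -> Rabs (peval l q) <= pnorm l /\ 0 <= pnorm l.
Proof.
intros Hq. induction l as [|a l [IH1 IH2]]; simpl; [rewrite Rabs_R0; lra|].
pose proof (Rabs_pos (IZR a)). split; [|lra].
eapply Rle_trans; [apply Rabs_triang|]. apply Rplus_le_compat_l.
rewrite Rabs_mult, (Rabs_pos_eq q) by lra. pose proof (Rabs_pos (peval l q)). nra.
Qed.

Lemma peval_firstn (l : list Z) (K : nat) (q : R) : 0 <= q <= 1 ->
  Rabs (peval l q - peval (firstn K l) q) <= pnorm l * q ^ K.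
Proof.
intros Hq. revert K. induction l as [|a l IH]; intros [|K]; simpl.
- rewrite Rminus_0_r, Rabs_R0. lra.
- rewrite Rminus_0_r, Rabs_R0. lra.
- rewrite Rminus_0_r. pose proof (peval_bound (a :: l) q Hq) as [H _]. simpl in H. lra.
- replace (IZR a + q * peval l q - (IZR a + q * peval (firstn K l) q))
    with (q * (peval l q - peval (firstn K l) q)) by ring.
  rewrite Rabs_mult, (Rabs_pos_eq q) by lra.
  assert (0 <= q ^ K) by (apply pow_le; lra). pose proof (Rabs_pos (IZR a)).
  specialize (IH K). assert (0 <= q * q ^ K) by nra.
  apply Rle_trans with (q * (pnorm l * q ^ K)); [apply Rmult_le_compat_l; lra|]. nra.
Qed.

(* f(q) = l(q) + O(q^K) as q tends to 0. *)
Definition expands (K : nat) (f : R -> R) (l : list Z) : Prop :=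
  exists B, 0 <= B /\ forall q, 0 < q <= 1 / 2 -> Rabs (f q - peval l q) <= B * q ^ K.

Lemma expands_firstn K f l : expands K f l -> expands K f (firstn K l).
Proof.
intros (B & HB & H). exists (B + pnorm l). split.
- pose proof (peval_bound l 0 ltac:(lra)). lra.
- intros q Hq.
  replace (f q - peval (firstn K l) q) with ((f q - peval l q) + (peval l q - peval (firstn K l) q)) by ring.
  eapply Rle_trans; [apply Rabs_triang|]. rewrite Rmult_plus_distr_r.
  apply Rplus_le_compat; [auto|apply peval_firstn; lra].
Qed.

Lemma expands_of_firstn K f l : expands K f (firstn K l) -> expands K f l.
Proof.
intros (B & HB & H). exists (B + pnorm l). split.
- pose proof (peval_bound l 0 ltac:(lra)). lra.
- intros q Hq.
  replace (f q - peval l q) with ((f q - peval (firstn K l) q) - (peval l q - peval (firstn K l) q)) by ring.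
  eapply Rle_trans; [apply Rabs_triang|]. rewrite Rabs_Ropp, Rmult_plus_distr_r.
  apply Rplus_le_compat; [auto|apply peval_firstn; lra].
Qed.

Lemma expands_ext K f g l : (forall q, 0 < q <= 1 / 2 -> f q = g q) -> expands K f l -> expands K g l.
Proof.
intros E (B & HB & H). exists B. split; auto. intros q Hq. rewrite <- E; auto.
Qed.

Lemma expands_poly K l : expands K (peval l) l.
Proof.
exists 0. split; [lra|]. intros q _. replace (peval l q - peval l q) with 0 by ring.
rewrite Rabs_R0. lra.
Qed.

Lemma expands_mult K f g l m : expands K f l -> expands K g m ->
  expands K (fun q => f q * g q) (pmul l m).
Proof.
intros (B & HB & H) (B' & HB' & H').
exists (B * (B' + pnorm m) + pnorm l * B').
pose proof (peval_bound l 0 ltac:(lra)) as [_ Nl]. pose proof (peval_bound m 0 ltac:(lra)) as [_ Nm].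
split; [apply Rplus_le_le_0_compat; apply Rmult_le_pos; lra|].
intros q Hq. specialize (H q Hq). specialize (H' q Hq). rewrite peval_pmul.
pose proof (peval_bound l q ltac:(lra)) as [Bl _]. pose proof (peval_bound m q ltac:(lra)) as [Bm _].
assert (HqK : 0 <= q ^ K <= 1).
{ split; [apply pow_le; lra|]. rewrite <- (pow1 K). apply pow_incr; lra. }
assert (Hg : Rabs (g q) <= B' + pnorm m).
{ replace (g q) with ((g q - peval m q) + peval m q) by ring.
  eapply Rle_trans; [apply Rabs_triang|]. apply Rplus_le_compat; auto. nra. }
replace (f q * g q - peval l q * peval m q) with
  ((f q - peval l q) * g q + peval l q * (g q - peval m q)) by ring.
eapply Rle_trans; [apply Rabs_triang|]. rewrite !Rabs_mult, Rmult_plus_distr_r.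
apply Rplus_le_compat.
- replace (B * (B' + pnorm m) * q ^ K) with ((B * q ^ K) * (B' + pnorm m)) by ring.
  apply Rmult_le_compat; auto using Rabs_pos.
- rewrite Rmult_assoc. apply Rmult_le_compat; auto using Rabs_pos.
Qed.

(** A candidate quotient [m] is certified by multiplying back modulo q^K, however it was found: f -
    m = ((g - l) - (h m - l)) / h, and 1/h is bounded. *)
Lemma expands_div K (f g h : R -> R) (l p m : list Z) (B0 : R) :
  expands K g l -> expands K h p ->
  (forall q, 0 < q <= 1 / 2 -> h q * f q = g q) ->
  (forall q, 0 < q <= 1 / 2 -> 0 < h q /\ / h q <= B0) ->
  firstn K (pmul p m) = firstn K l -> expands K f m.
Proof.
intros Hg Hh Hf Hb E.
assert (H : expands K (fun q => h q * peval m q) l).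
{ apply expands_of_firstn. rewrite <- E. apply expands_firstn, expands_mult; auto using expands_poly. }
destruct H as (B & HB & H). destruct Hg as (B' & HB' & Hg).
exists (B0 * (B + B')).
assert (HB0 : 0 <= B0).
{ destruct (Hb (1 / 2)) as [H1 H2]; [lra|]. apply Rle_trans with (2 := H2).
  now apply Rlt_le, Rinv_0_lt_compat. }
split; [apply Rmult_le_pos; lra|].
intros q Hq. destruct (Hb q Hq) as [H1 H2].
replace (f q - peval m q) with (/ h q * ((g q - peval l q) - (h q * peval m q - peval l q))).
2:{ rewrite <- Hf by auto. field. lra. }
rewrite Rabs_mult, (Rabs_pos_eq (/ h q)) by (apply Rlt_le, Rinv_0_lt_compat; auto).
rewrite Rmult_assoc. apply Rmult_le_compat; auto using Rabs_pos.
- now apply Rlt_le, Rinv_0_lt_compat.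
- eapply Rle_trans; [apply Rabs_triang|]. rewrite Rabs_Ropp.
  specialize (H q Hq). specialize (Hg q Hq). lra.
Qed.

(** The constant term is at most q times a constant for all small q, hence 0; then one factor q is
    divided out. *)
Lemma peval_vanish (l : list Z) (B : R) : 0 <= B ->
  (forall q, 0 < q <= 1 / 2 -> Rabs (peval l q) <= B * q ^ length l) -> l = repeat 0%Z (length l).
Proof.
intros HB. induction l as [|a l IH]; intros H; auto. simpl.
assert (Ha : a = 0%Z).
{ apply eq_IZR. destruct (Req_dec (IZR a) 0) as [E|E]; auto. exfalso.
  assert (Hp : 0 < Rabs (IZR a)) by now apply Rabs_pos_lt. set (v := Rabs (IZR a)) in *.
  pose proof (peval_bound l 0 ltac:(lra)) as [_ Nl].
  (* Small enough that q (B + pnorm l) is less than v = |a|, which contradicts the assumed bound. *)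
  set (q := Rmin (1 / 2) (v / (2 * (B + pnorm l + 1)))).
  assert (Hv : 0 < v / (2 * (B + pnorm l + 1))) by (apply Rdiv_lt_0_compat; lra).
  assert (Hq : 0 < q <= 1 / 2) by (split; [apply Rmin_glb_lt; lra|apply Rmin_l]).
  assert (Hqv : q * (2 * (B + pnorm l + 1)) <= v).
  { apply Rmult_le_reg_r with (/ (2 * (B + pnorm l + 1))); [apply Rinv_0_lt_compat; lra|].
    rewrite Rmult_assoc, Rinv_r, Rmult_1_r by lra. apply Rmin_r. }
  specialize (H q Hq). simpl in H.
  pose proof (peval_bound l q ltac:(lra)) as [Bl _].
  assert (HqK : 0 <= q ^ length l <= 1).
  { split; [apply pow_le; lra|]. rewrite <- (pow1 (length l)). apply pow_incr; lra. }
  pose proof (Rabs_triang (IZR a + q * peval l q) (- (q * peval l q))) as Ht.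
  replace (IZR a + q * peval l q + - (q * peval l q)) with (IZR a) in Ht by ring.
  rewrite Rabs_Ropp, Rabs_mult, (Rabs_pos_eq q) in Ht by lra. fold v in Ht.
  assert (B * (q * q ^ length l) <= B * q) by (apply Rmult_le_compat_l; nra).
  assert (q * Rabs (peval l q) <= q * pnorm l) by (apply Rmult_le_compat_l; lra). nra. }
subst a. f_equal. apply IH. intros q Hq. specialize (H q Hq). simpl in H.
rewrite Rplus_0_l, Rabs_mult, (Rabs_pos_eq q) in H by lra.
apply Rmult_le_reg_l with q; lra.
Qed.

Lemma expands_unique K f l m : length l = K -> length m = K ->
  expands K f l -> expands K f m -> l = m.
Proof.
intros Hl Hm (B & HB & H) (B' & HB' & H').
assert (Hlen : length (padd l (pscal (-1) m)) = K).
{ assert (Hm' : length (pscal (-1) m) = K) by (unfold pscal; now rewrite length_map).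
  clear - Hl Hm'. revert Hm'. generalize (pscal (-1) m). revert K Hl.
  induction l as [|a l IH]; intros K Hl [|b m'] Hm'; simpl in *; subst; auto; try discriminate. }
assert (E : padd l (pscal (-1) m) = repeat 0%Z K).
{ rewrite <- Hlen. apply (peval_vanish _ (B + B')); [lra|]. rewrite Hlen.
  intros q Hq. specialize (H q Hq). specialize (H' q Hq). rewrite peval_padd, peval_pscal.
  replace (peval l q + -1 * peval m q) with ((f q - peval m q) - (f q - peval l q)) by ring.
  eapply Rle_trans; [apply Rabs_triang|]. rewrite Rabs_Ropp. lra. }
clear - Hl Hm E. unfold pscal in E. revert l m Hl Hm E.
induction K as [|K IH]; intros [|a l] [|b m] Hl Hm E; try discriminate; auto.
cbn [padd map repeat] in E. injection E as E1 E2. change (a + - b = 0)%Z in E1.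
injection Hl as Hl. injection Hm as Hm. f_equal; [lia|auto].
Qed.

Lemma Series_expands (a : nat -> Z) (K : nat) :
  ex_series (fun n => Rabs (IZR (a n)) * (1 / 2) ^ n) ->
  expands K (fun q => Series (fun n => IZR (a n) * q ^ n)) (map a (seq 0 K)).
Proof.
revert a. induction K as [|K IH]; intros a Ha.
- exists (Series (fun n => Rabs (IZR (a n)) * (1 / 2) ^ n)). split.
  + apply Series_nonneg. intros n. apply Rmult_le_pos; [apply Rabs_pos|apply pow_le; lra].
  + intros q Hq. simpl. rewrite Rminus_0_r, Rmult_1_r.
    assert (Ht : forall n, Rabs (IZR (a n) * q ^ n) <= Rabs (IZR (a n)) * (1 / 2) ^ n).
    { intros n. rewrite Rabs_mult, (Rabs_pos_eq (q ^ n)) by (apply pow_le; lra).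
      apply Rmult_le_compat_l; [apply Rabs_pos|]. apply pow_incr; lra. }
    eapply Rle_trans; [apply Series_Rabs|].
    * eapply ex_series_comparison; [|exact Ha]. intros n. rewrite Rabs_Rabsolu. apply Ht.
    * apply Series_le; auto. intros n. split; [apply Rabs_pos|apply Ht].
- assert (Ha' : ex_series (fun n => Rabs (IZR (a (S n))) * (1 / 2) ^ n)).
  { apply (ex_series_incr_1 (fun n => Rabs (IZR (a n)) * (1 / 2) ^ n)) in Ha.
    eapply ex_series_ext; [|apply (ex_series_scalR 2), Ha]. intros n. simpl.
    match goal with |- @eq _ ?u ?v => change (@eq R u v) end. field. }
  destruct (IH (fun n => a (S n)) Ha') as (B & HB & H). exists B. split; auto.
  intros q Hq. specialize (H q Hq).
  assert (Hs : ex_series (fun n => IZR (a n) * q ^ n)).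
  { eapply ex_series_comparison; [|exact Ha]. intros n.
    rewrite Rabs_mult, (Rabs_pos_eq (q ^ n)) by (apply pow_le; lra).
    apply Rmult_le_compat_l; [apply Rabs_pos|]. apply pow_incr; lra. }
  rewrite (Series_incr_1 _ Hs).
  rewrite (Series_ext _ (fun n => q * (IZR (a (S n)) * q ^ n))) by (intros; simpl; ring).
  rewrite Series_scal_l. cbn [seq map peval]. rewrite <- seq_shift, map_map.
  match goal with |- Rabs ?X <= _ => replace X with
    (q * (Series (fun n => IZR (a (S n)) * q ^ n) - peval (map (fun n => a (S n)) (seq 0 K)) q)) by (simpl; ring) end.
  rewrite Rabs_mult, (Rabs_pos_eq q) by lra. simpl.
  replace (B * (q * q ^ K)) with (q * (B * q ^ K)) by ring. apply Rmult_le_compat_l; lra.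
Qed.

(** * Expansion of the discriminant product *)

(** Multiplication by 1 - q^(k+1) as one shift and one subtraction, truncated at once. The
    computation performs it 24 * 70 times, so a general product would be wasteful. *)
Definition pmul_one_minus (K k : nat) (l : list Z) : list Z :=
  firstn K (padd l (repeat 0%Z (S k) ++ pscal (-1) l)).

Lemma peval_shift (k : nat) (l : list Z) (q : R) : peval (repeat 0%Z k ++ l) q = q ^ k * peval l q.
Proof. induction k; simpl; [ring|]. rewrite IHk. ring. Qed.

Lemma expands_one_minus K k f l : expands K f l ->
  expands K (fun q => (1 - q ^ S k) * f q) (pmul_one_minus K k l).
Proof.
intros (B & HB & H). apply expands_firstn. exists B. split; auto.
intros q Hq. rewrite peval_padd, peval_shift, peval_pscal.
replace ((1 - q ^ S k) * f q - (peval l q + q ^ S k * (-1 * peval l q)))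
  with ((1 - q ^ S k) * (f q - peval l q)) by ring.
assert (Hk : 0 <= q ^ S k <= q) by (apply pow_S_le; lra).
rewrite Rabs_mult, (Rabs_pos_eq (1 - q ^ S k)) by lra.
specialize (H q Hq). pose proof (Rabs_pos (f q - peval l q)). nra.
Qed.

Fixpoint iter_one_minus (K k e : nat) (l : list Z) : list Z :=
  match e with O => l | S e' => pmul_one_minus K k (iter_one_minus K k e' l) end.

Lemma expands_iter_one_minus K k e f l : expands K f l ->
  expands K (fun q => (1 - q ^ S k) ^ e * f q) (iter_one_minus K k e l).
Proof.
intros H. induction e; simpl.
- eapply expands_ext; [|exact H]. intros; ring.
- eapply expands_ext; [|apply (expands_one_minus K k _ _ IHe)]. intros; simpl; ring.
Qed.

Fixpoint eta_list (K N : nat) : list Z :=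
  match N with O => [1%Z] | S n => iter_one_minus K n 24 (eta_list K n) end.

Fixpoint eta_product (N : nat) (q : R) : R :=
  match N with O => 1 | S n => (1 - q ^ S n) ^ 24 * eta_product n q end.

Lemma expands_eta_product K N : expands K (eta_product N) (eta_list K N).
Proof.
induction N; cbn [eta_list eta_product].
- eapply expands_ext; [|apply (expands_poly K [1%Z])]. intros; simpl; ring.
- now apply expands_iter_one_minus.
Qed.

Definition real_mlog (x : R) : R := Series (fun n => / INR n * x ^ n).

Lemma mlog1m_of_real (x : R) : mlog1m (RtoC x) = RtoC (real_mlog x).
Proof.
unfold mlog1m, real_mlog. rewrite <- CSeries_RtoC. apply CSeries_ext. intros n.
now rewrite RtoC_mult, RtoC_pow.
Qed.

Lemma exp_real_mlog (x : R) : 0 <= x < 1 -> exp (- real_mlog x) = 1 - x.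
Proof.
intros Hx. apply RtoC_inj. rewrite <- Cexp_RtoC, RtoC_opp, <- mlog1m_of_real, RtoC_minus.
apply Cexp_mlog1m. rewrite Cmod_R, Rabs_pos_eq; lra.
Qed.

Lemma real_mlog_bound (x r : R) : 0 <= x <= r -> r < 1 -> 0 <= real_mlog x <= x * / (1 - r).
Proof.
intros Hx Hr.
assert (H0 : 0 <= real_mlog x).
{ apply Series_nonneg. intros n. apply Rmult_le_pos; [apply (Cmod_inv_INR n)|apply pow_le; lra]. }
split; auto. pose proof (mlog1m_bound (RtoC x) r) as H.
rewrite mlog1m_of_real, !Cmod_R, !Rabs_pos_eq in H by lra. apply H; lra.
Qed.

Lemma ex_series_real_eta (q : R) : 0 <= q < 1 -> ex_series (fun m => real_mlog (q ^ S m)).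
Proof.
intros Hq. apply ex_series_of_RtoC. eapply summable_ext; [|apply (summable_eta_log (RtoC q))].
- intros m. cbn beta. now rewrite <- RtoC_pow, mlog1m_of_real.
- rewrite Cmod_R, Rabs_pos_eq; lra.
Qed.

Lemma eta_product_tail (N : nat) (q : R) : 0 < q < 1 ->
  exp (- (24 * real_eta q)) =
  eta_product N q * exp (- (24 * Series (fun m => real_mlog (q ^ S (N + m))))).
Proof.
intros Hq. induction N.
- simpl eta_product. rewrite Rmult_1_l. reflexivity.
- rewrite IHN. cbn [eta_product].
  assert (Hs : ex_series (fun m => real_mlog (q ^ S (N + m)))).
  { apply (ex_series_incr_n (fun m => real_mlog (q ^ S m)) N). apply ex_series_real_eta; lra. }
  rewrite (Series_incr_1 _ Hs), Nat.add_0_r.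
  rewrite (Series_ext (fun k => real_mlog (q ^ S (N + S k))) (fun m => real_mlog (q ^ S (S N + m))))
    by (intros n; do 3 f_equal; lia).
  set (T := Series (fun m => real_mlog (q ^ S (S N + m)))).
  replace (- (24 * (real_mlog (q ^ S N) + T))) with (INR 24 * - real_mlog (q ^ S N) + - (24 * T))
    by (replace (INR 24) with 24 by (simpl; ring); ring).
  rewrite exp_plus, exp_INR_mult, exp_real_mlog.
  + ring.
  + pose proof (pow_S_le q N ltac:(lra)). lra.
Qed.

(** The factors of index above K multiply the finite product by exp(-24 T) with T = O(q^K), so they
    cannot affect the expansion to order K. *)
Lemma expands_eta_full (K : nat) : expands K (fun q => exp (- (24 * real_eta q))) (eta_list K K).
Proof.
destruct (expands_eta_product K K) as (B & HB & H).
pose proof (peval_bound (eta_list K K) 0 ltac:(lra)) as [_ Nl].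
exists (96 * (B + pnorm (eta_list K K)) + B). split; [lra|].
intros q Hq. rewrite (eta_product_tail K q) by lra. specialize (H q Hq).
set (T := Series (fun m => real_mlog (q ^ S (K + m)))).
assert (HqK : 0 <= q ^ K <= 1).
{ split; [apply pow_le; lra|]. rewrite <- (pow1 K). apply pow_incr; lra. }
assert (Hb : forall m, 0 <= real_mlog (q ^ S (K + m)) <= 2 * q * q ^ K * q ^ m).
{ intros m. pose proof (pow_S_le q (K + m) ltac:(lra)).
  destruct (real_mlog_bound (q ^ S (K + m)) (1 / 2)) as [h1 h2]; [lra|lra|]. split; auto.
  replace (2 * q * q ^ K * q ^ m) with (q ^ S (K + m) * / (1 - 1 / 2)); auto.
  simpl. rewrite pow_add. field. }
assert (HT : 0 <= T <= 4 * q ^ K).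
{ split; [apply Series_nonneg; intros m; apply Hb|].
  apply Rle_trans with (Series (fun m => 2 * q * q ^ K * q ^ m)).
  - apply Series_le; auto. apply ex_series_scalR, ex_series_geom_nonneg; lra.
  - rewrite Series_scal_l, Series_geom by (rewrite Rabs_pos_eq; lra).
    assert (/ (1 - q) <= 2) by (replace 2 with (/ (1 / 2)) by field; apply Rinv_le_contravar; lra).
    assert (0 < / (1 - q)) by (apply Rinv_0_lt_compat; lra).
    apply Rle_trans with (2 * q * q ^ K * 2); [|nra].
    apply Rmult_le_compat_l; auto. apply Rmult_le_pos; lra. }
(* 96 = 24 * 4, where 4 q^K bounds the tail T for q <= 1/2. *)
assert (He : 0 <= 1 - exp (- (24 * T)) <= 96 * q ^ K).
{ pose proof (one_minus_exp_le (24 * T) ltac:(lra)). lra. }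
set (P := eta_product K q) in *. set (L := peval (eta_list K K) q) in *.
assert (HP : Rabs P <= B + pnorm (eta_list K K)).
{ replace P with ((P - L) + L) by ring. eapply Rle_trans; [apply Rabs_triang|].
  destruct (peval_bound (eta_list K K) q ltac:(lra)) as [h _]. fold L in h. nra. }
replace (P * exp (- (24 * T)) - L) with (- (P * (1 - exp (- (24 * T)))) + (P - L)) by ring.
eapply Rle_trans; [apply Rabs_triang|].
rewrite Rabs_Ropp, Rabs_mult, (Rabs_pos_eq (1 - exp (- (24 * T)))) by lra.
pose proof (Rabs_pos P).
assert (Rabs P * (1 - exp (- (24 * T))) <= (B + pnorm (eta_list K K)) * (96 * q ^ K))
  by (apply Rmult_le_compat; lra).
lra.
Qed.

(** * The certified table of coefficients *)

(** The divisor sum in binary integers, since cubes in unary [nat] would be too large to compute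
    with. *)
Definition sigma3Z (n : nat) : Z :=
  fold_right Z.add 0%Z (map (fun d => (Z.of_nat d ^ 3)%Z)
    (filter (fun d => Nat.eqb (Nat.modulo n d) 0) (seq 1 n))).

Lemma sigma3Z_correct (n : nat) : Z.of_nat (Defs.sigma 3 n) = sigma3Z n.
Proof.
unfold Defs.sigma, sigma3Z. induction (filter _ _) as [|d l IH]; auto.
rewrite !map_cons.
change (Z.of_nat (Nat.pow d 3 + list_sum (map (fun d => Nat.pow d 3) l)) =
  (Z.of_nat d ^ 3 + fold_right Z.add 0 (map (fun d => (Z.of_nat d ^ 3)%Z) l))%Z).
rewrite Nat2Z.inj_add, IH, Nat2Z.inj_pow. reflexivity.
Qed.

Definition eis_coef (n : nat) : Z := match n with O => 1%Z | _ => (240 * sigma3Z n)%Z end.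

Definition eis_list (K : nat) : list Z := map eis_coef (seq 0 K).

Lemma real_eis_sigma (q : R) : 0 <= q < 1 ->
  ex_series (fun n => Rabs (IZR (eis_coef n)) * q ^ n) /\
  1 + 240 * real_eis q = Series (fun n => IZR (eis_coef n) * q ^ n).
Proof.
intros Hq. assert (Hc : Cmod (RtoC q) < 1) by (rewrite Cmod_R, Rabs_pos_eq; lra).
(* There are at most n divisors, each with cube at most n^3. *)
assert (Hle : forall n, 0 <= IZR (sigma3Z n) <= INR n ^ 4).
{ intros n. rewrite <- sigma3Z_correct, <- INR_IZR_INZ. split; [apply pos_INR|].
  rewrite <- pow_INR. apply le_INR. unfold Defs.sigma.
  assert (H : forall l, (forall d, In d l -> (d <= n)%nat) ->
     (list_sum (map (fun d => Nat.pow d 3) l) <= length l * Nat.pow n 3)%nat).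
  { induction l as [|d l IH]; intros Hl; [simpl; lia|]. cbn [map list_sum fold_right length].
    assert (Nat.pow d 3 <= Nat.pow n 3)%nat by (apply Nat.pow_le_mono_l, Hl; left; auto).
    specialize (IH (fun x Hx => Hl x (or_intror Hx))).
    change (fold_right Init.Nat.add 0 (map (fun d : nat => (d ^ 3)%nat) l))%nat
      with (list_sum (map (fun d : nat => (d ^ 3)%nat) l)). lia. }
  eapply Nat.le_trans; [apply H|].
  - intros d Hd. apply filter_In in Hd. destruct Hd as [Hd _]. apply in_seq in Hd. lia.
  - replace (Nat.pow n 4) with (n * Nat.pow n 3)%nat by (simpl; ring).
    apply Nat.mul_le_mono_r. eapply Nat.le_trans; [apply filter_length_le|]. now rewrite length_seq. }
assert (Hcoef : forall n, 0 <= IZR (eis_coef n)).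
{ intros [|n]; cbn [eis_coef]; [lra|]. rewrite mult_IZR. specialize (Hle (S n)). lra. }
assert (Hex : ex_series (fun n => IZR (eis_coef n) * q ^ n)).
{ apply ex_series_incr_1.
  eapply ex_series_comparison; [|apply (ex_series_scalR 240), (proj1 (ex_series_incr_1 (fun n => INR n ^ 4 * q ^ n))),
    (ex_series_pow_geom 4 q Hq)].
  intros n. cbn [eis_coef]. rewrite mult_IZR. specialize (Hle (S n)).
  assert (0 <= q ^ S n) by (apply pow_le; lra).
  rewrite Rabs_pos_eq by (apply Rmult_le_pos; lra). rewrite Rmult_assoc.
  apply Rmult_le_compat_l; [lra|]. apply Rmult_le_compat_r; lra. }
split.
- eapply ex_series_ext; [|exact Hex]. intros n. cbn beta. now rewrite (Rabs_pos_eq (IZR (eis_coef n))).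
- rewrite (Series_incr_1 _ Hex). simpl (q ^ 0). cbn [eis_coef]. rewrite Rmult_1_r. f_equal.
  apply RtoC_inj. rewrite RtoC_mult, <- eis_of_real, <- CSeries_sigma_3 by auto.
  rewrite (Series_ext _ (fun n => 240 * (INR (Defs.sigma 3 (S n)) * q ^ S n))).
  2:{ intros n. rewrite mult_IZR, <- sigma3Z_correct, <- INR_IZR_INZ. ring. }
  rewrite Series_scal_l, RtoC_mult, <- CSeries_RtoC. f_equal. apply CSeries_ext. intros n.
  now rewrite RtoC_mult, RtoC_pow.
Qed.

(** Long division of [l] by 1 + q p: [p] is the divisor stripped of its constant term 1, and each
    round emits one coefficient a and subtracts a p from the rest. Its output is checked rather than
    proved correct. *)
Fixpoint pdiv (fuel : nat) (l p : list Z) : list Z :=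
  match fuel, l with
  | S f, a :: l' => a :: pdiv f (padd l' (pscal (- a) p)) p
  | _, _ => []
  end.

(** The coefficients 1, 744, 196884, ... of q j(q), as the cube of E_4 divided by the product of the
    (1 - q^n)^24. *)
Definition j_list (K : nat) : list Z :=
  let e := eis_list K in
  pdiv K (firstn K (pmul e (firstn K (pmul e e)))) (tl (eta_list K K)).

Lemma j_list_check : firstn 70 (pmul (eta_list 70 70) (j_list 70)) =
  firstn 70 (pmul (eis_list 70) (firstn 70 (pmul (eis_list 70) (eis_list 70)))) /\
  firstn 70 (j_list 70) = j_list 70 /\ length (j_list 70) = 70%nat.
Proof. vm_compute. auto. Qed.

(** The coefficients of q j(q): multiplication by q removes the pole, whose coefficient 1 takes
    index 0. *)
Definition shifted_coef (c : nat -> Z) (n : nat) : Z := match n with O => 1%Z | S n => c n end.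

Lemma shifted_coef_series (c : nat -> Z) (hc : j_fourier_coefficients c) (q : R) : 0 < q < 1 ->
  ex_series (fun n => Rabs (IZR (shifted_coef c n)) * q ^ n) /\
  Series (fun n => IZR (shifted_coef c n) * q ^ n) = real_jq q.
Proof.
intros Hq. pose proof PI_RGT_0.
assert (Hex : ex_series (fun n => Rabs (IZR (shifted_coef c n)) * q ^ n)).
{ apply ex_series_incr_1.
  eapply ex_series_ext; [|apply (ex_series_scalR q), (j_coef_ex_series c hc q); lra].
  intros n. cbn [shifted_coef]. rewrite Cmod_R. simpl.
  match goal with |- @eq _ ?u ?v => change (@eq R u v) end. ring. }
split; auto.
assert (Hex' : ex_series (fun n => IZR (shifted_coef c n) * q ^ n)).
{ eapply ex_series_comparison; [|exact Hex]. intros n.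
  rewrite Rabs_mult, (Rabs_pos_eq (q ^ n)) by (apply pow_le; lra). lra. }
rewrite (Series_incr_1 _ Hex').
rewrite (Series_ext _ (fun n => q * (IZR (c n) * q ^ n))) by (intros; cbn [shifted_coef]; simpl; ring).
rewrite Series_scal_l.
set (y := - ln q / (2 * PI)).
assert (Hy : 0 < y).
{ assert (ln q < 0) by (rewrite <- ln_1; apply ln_increasing; lra). apply Rdiv_lt_0_compat; lra. }
assert (Eq : exp (- (2 * PI * y)) = q).
{ unfold y. replace (- (2 * PI * (- ln q / (2 * PI)))) with (ln q) by (field; lra). apply exp_ln; lra. }
pose proof (j_coef_CSeries c hc (0, y) Hy) as E.
rewrite j_imaginary, nome_imaginary, Eq in E by auto.
rewrite (CSeries_ext _ (fun n => RtoC (IZR (c n) * q ^ n))) in E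
  by (intros; now rewrite RtoC_mult, RtoC_pow).
rewrite CSeries_RtoC, <- RtoC_inv, <- RtoC_minus in E by lra.
apply RtoC_inj in E. rewrite E. cbn [shifted_coef]. simpl. field. lra.
Qed.

Definition j_table (n : nat) : Z := nth (S n) (j_list 70) 0%Z.

Lemma coef_table (c : nat -> Z) (hc : j_fourier_coefficients c) (n : nat) : (n < 69)%nat ->
  c n = j_table n.
Proof.
intros Hn. unfold j_table.
(* Both lists expand q j(q) to order 70 as q -> 0 through positive reals, and such an expansion is
   unique. *)
enough (E : map (shifted_coef c) (seq 0 70) = j_list 70).
{ rewrite <- E. rewrite (nth_indep _ 0%Z (shifted_coef c 0)) by (rewrite length_map, length_seq; lia).
  rewrite map_nth, seq_nth by lia. reflexivity. }
destruct j_list_check as (HL1 & HL2 & HL3).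
apply (expands_unique 70 (fun q => Series (fun n => IZR (shifted_coef c n) * q ^ n))).
- now rewrite length_map, length_seq.
- exact HL3.
- apply Series_expands. apply shifted_coef_series; auto. lra.
- apply (expands_div 70 _ (fun q => (1 + 240 * real_eis q) ^ 3) (fun q => exp (- (24 * real_eta q)))
    (pmul (eis_list 70) (firstn 70 (pmul (eis_list 70) (eis_list 70)))) (eta_list 70 70) _ (exp 48)).
  + assert (HE : expands 70 (fun q => 1 + 240 * real_eis q) (eis_list 70)).
    { eapply expands_ext; [|apply (Series_expands eis_coef)].
      - intros q Hq. symmetry. apply real_eis_sigma. lra.
      - apply real_eis_sigma. lra. }
    eapply expands_ext; [|apply expands_mult; [exact HE|apply expands_firstn, expands_mult; exact HE]].
    intros q Hq. cbn beta. ring.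
  + apply expands_eta_full.
  + intros q Hq. destruct (shifted_coef_series c hc q) as [_ ->]; [lra|]. unfold real_jq.
    rewrite (Rmult_comm ((1 + 240 * real_eis q) ^ 3)), <- Rmult_assoc, <- exp_plus.
    replace (- (24 * real_eta q) + 24 * real_eta q) with 0 by ring. rewrite exp_0. ring.
  + intros q Hq. split; [apply exp_pos|]. rewrite <- exp_Ropp, Ropp_involutive. apply exp_le.
    enough (real_eta q <= 2) by lra.
    apply Rle_trans with (Series (fun m => 2 * q * q ^ m)).
    * apply Series_le; [|apply ex_series_scalR, ex_series_geom_nonneg; lra].
      intros m. pose proof (pow_S_le q m ltac:(lra)).
      destruct (real_mlog_bound (q ^ S m) (1 / 2)) as [h1 h2]; [lra|lra|]. split; auto.
      replace (2 * q * q ^ m) with (q ^ S m * / (1 - 1 / 2)); auto. simpl. field.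
    * rewrite Series_scal_l, Series_geom by (rewrite Rabs_pos_eq; lra).
      apply Rmult_le_reg_r with (1 - q); [lra|]. rewrite Rmult_assoc, Rinv_l by lra. lra.
  + exact HL1.
Qed.

Definition concave_table (t : nat -> Z) : bool :=
  forallb (fun n => Z.leb (t n * t (n + 2)%nat) (t (n + 1)%nat ^ 2)) (seq 0 64).

(** The range ends at 65 so that positivity is also available at n+1 and n+2 for n <= 63. It begins
    at 1 because the inequality fails at n = 0. *)
Definition ratio_table (t : nat -> Z) : bool :=
  forallb (fun n => Z.leb (t (n + 2)%nat ^ 3 * t n) (t (n + 1)%nat ^ 3 * t (n + 3)%nat)
                    && Z.ltb 0 (t n))%bool (seq 1 65).

Lemma table_inequalities : concave_table j_table = true /\ ratio_table j_table = true.
Proof.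
apply andb_prop.
(* The [let] has the list computed once and shared, instead of anew at each access to the table. *)
change ((let l := j_list 70 in
  concave_table (fun n => nth (S n) l 0%Z) && ratio_table (fun n => nth (S n) l 0%Z))%bool = true).
vm_compute. reflexivity.
Qed.

Lemma concave_table_spec (t : nat -> Z) (n : nat) : concave_table t = true -> (n < 64)%nat ->
  IZR (t n) * IZR (t (n + 2)%nat) - IZR (t (n + 1)%nat) ^ 2 <= 0.
Proof.
unfold concave_table. rewrite forallb_forall. intros H Hn.
specialize (H n). apply Z.leb_le in H; [|apply in_seq; lia].
rewrite pow_IZR, <- mult_IZR, <- minus_IZR. apply IZR_le. simpl Z.of_nat. lia.
Qed.

Lemma ratio_table_spec (t : nat -> Z) (n : nat) : ratio_table t = true -> (1 <= n < 64)%nat ->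
  IZR (t (n + 2)%nat) ^ 3 * IZR (t n) <= IZR (t (n + 1)%nat) ^ 3 * IZR (t (n + 3)%nat) /\
  0 < IZR (t n) /\ 0 < IZR (t (n + 1)%nat) /\ 0 < IZR (t (n + 2)%nat).
Proof.
unfold ratio_table. rewrite forallb_forall. intros H Hn.
assert (H1 : forall k, (1 <= k < 66)%nat -> In k (seq 1 65)) by (intros; apply in_seq; lia).
assert (P : forall k, (1 <= k < 66)%nat -> 0 < IZR (t k)).
{ intros k Hk. specialize (H k (H1 k Hk)). apply andb_prop in H as [_ H].
  apply Z.ltb_lt in H. now apply IZR_lt. }
repeat split; try (apply P; lia).
specialize (H n (H1 n ltac:(lia))). apply andb_prop in H as [H _]. apply Z.leb_le in H.
rewrite !pow_IZR, <- !mult_IZR. apply IZR_le. exact H.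
Qed.

Lemma small_log_concave (c : nat -> Z) (hc : j_fourier_coefficients c) (n : nat) : (n < 64)%nat ->
  IZR (c n) * IZR (c (n + 2)%nat) - IZR (c (n + 1)%nat) ^ 2 <= 0.
Proof.
intros Hn. rewrite !(coef_table c hc) by lia.
exact (concave_table_spec j_table n (proj1 table_inequalities) Hn).
Qed.

Lemma small_third_difference (c : nat -> Z) (hc : j_fourier_coefficients c) (n : nat) : (1 <= n < 64)%nat ->
  IZR (c (n + 2)%nat) ^ 3 * IZR (c n) <= IZR (c (n + 1)%nat) ^ 3 * IZR (c (n + 3)%nat) /\
  0 < IZR (c n) /\ 0 < IZR (c (n + 1)%nat) /\ 0 < IZR (c (n + 2)%nat).
Proof.
intros Hn. rewrite !(coef_table c hc) by lia.
exact (ratio_table_spec j_table n (proj2 table_inequalities) Hn).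
Qed.

Theorem theorem3p1 (c : nat -> Z) (hc : j_fourier_coefficients c) :
  log_concave 0 (fun n => IZR (c n)) /\
  ratio_log_convex 1 (fun n => IZR (c n)).
Proof.
split.
- intros n _. cbn beta. destruct (le_lt_dec 64 n).
  + now apply large_log_concave.
  + now apply small_log_concave.
- intros n Hn. cbn beta.
  assert (H : IZR (c (n + 2)%nat) ^ 3 * IZR (c n) <= IZR (c (n + 1)%nat) ^ 3 * IZR (c (n + 3)%nat) /\
    0 < IZR (c n) /\ 0 < IZR (c (n + 1)%nat) /\ 0 < IZR (c (n + 2)%nat)).
  { destruct (le_lt_dec 64 n); [now apply large_third_difference|now apply small_third_difference]. }
  replace (n + 2 + 1)%nat with (n + 3)%nat by lia. replace (n + 1 + 1)%nat with (n + 2)%nat by lia.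
  destruct H as (H & H0 & H1 & H2).
  set (x0 := IZR (c n)) in *. set (x1 := IZR (c (n + 1)%nat)) in *.
  set (x2 := IZR (c (n + 2)%nat)) in *. set (x3 := IZR (c (n + 3)%nat)) in *.
  (* With the denominators cleared, the condition is x2^3 x0 <= x1^3 x3, that is, a nonnegative
     third difference of log c. *)
  replace (x1 / x0 * (x3 / x2) - (x2 / x1) ^ 2) with ((x1 ^ 3 * x3 - x2 ^ 3 * x0) * / (x0 * x2 * x1 ^ 2))
    by (field; lra).
  apply Rle_ge, Rmult_le_pos; [lra|].
  apply Rlt_le, Rinv_0_lt_compat. repeat apply Rmult_lt_0_compat; auto. lra.
Qed.
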